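(* Let $f$ be a transcendental meromorphic function in $\mathbb{C}$, and let $\varphi(z)\not\equiv 0,\infty$ be a small function of $f$. Let $k\ge 1$, $q_i\ge 0$ $(i=1,2,\ldots,k-1)$, $q_k\ge 1$ be integers, put $\mu_*=q_1+2q_2+\cdots+kq_k$, and let $q_0\ge 3+\mu_*$ be an integer. Let $a(z)\not\equiv 0,\infty$ be a small function of $f$, and put $M[f]=a(z)(f)^{q_0}(f')^{q_1}\cdots(f^{(k)})^{q_k}$. Then $$T(r,f)\le \frac{1}{q_0-2-\mu_*}\overline{N}\left(r,\frac{1}{M[f]-\varphi(z)}\right)+S(r,f).$$
   Context: Standard notation of Nevanlinna theory is used: $T(r,f)$ is the Nevanlinna characteristic, and $\overline{N}\left(r,\frac{1}{M[f]-\varphi}\right)$ is the reduced integrated counting function of the zeros of $M[f]-\varphi$ (each zero counted once). $S(r,f)$ denotes any quantity satisfying $S(r,f)=o(T(r,f))$ as $r\to\infty$, $r\notin E$, where $E$ is a set of positive real numbers of finite linear (Lebesgue) measure, not necessarily the same at each occurrence. A meromorphic function $b(z)\not\equiv 0,\infty$ is a small function of (with respect to) $f$ if $T(r,b)=S(r,f)$. *)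

(* Defs.v *)
From HB Require Import structures.
From mathcomp Require Import all_boot all_order all_algebra.
From mathcomp Require Import all_classical all_reals all_analysis.
From mathcomp.real_closed Require Import complex.

Set Implicit Arguments.
Unset Strict Implicit.
Unset Printing Implicit Defensive.

Import Order.TTheory GRing.Theory Num.Theory numFieldNormedType.Exports.

Local Open Scope classical_set_scope.
Local Open Scope complex_scope.
Local Open Scope ring_scope.

(* The complex numbers are [R[i]^o]: the topology and the normed module
   structure over [R[i]] used for limits and complex derivatives are attached
   to the regular module [^o].

   A meromorphic function is represented by a total function whose values on a
   closed discrete set (the poles and, possibly, removable points) are
   irrelevant. Accordingly, equality of meromorphic functions ([meq]), orders
   of poles and the characteristic only depend on values in punctured
   neighbourhoods, and pointwise operations ([+], [*], [^-1], [^`()]) compute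
   the corresponding operations on meromorphic functions. *)

Section Meromorphic.
Variable R : realType.
Implicit Types (f g : R[i]^o -> R[i]^o) (z : R[i]^o).

Definition holomorphic_at f z := \forall w \near z, derivable f w 1.

Definition meromorphic_at f z := exists n : nat, exists g,
  holomorphic_at g z /\ \forall w \near z^', f w = g w / (w - z) ^+ n.

Definition meromorphic f := forall z, meromorphic_at f z.

Definition meq f g := forall z, \forall w \near z^', f w = g w.

Definition rational_function f := exists p q : {poly R[i]},
  q != 0 /\ meq f (fun z => p.[z] / q.[z]).

Definition transcendental_meromorphic f := meromorphic f /\ ~ rational_function f.

(* For n = 0 this says that f is, up to a removable singularity, holomorphic
   and nonzero at z; the n satisfying it is unique when it exists. *)
Definition has_pole_order f z (n : nat) := exists g,
  [/\ holomorphic_at g z, g z != 0 &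
      \forall w \near z^', f w = g w / (w - z) ^+ n].

(* 0 when z is not a pole of f *)
Definition pole_order f z : nat := xget 0%N [set n | has_pole_order f z n].

End Meromorphic.

Section Nevanlinna.
Variable R : realType.
Implicit Types (f : R[i]^o -> R[i]^o) (r t : R).

Definition logp (x : R) : R := Num.max 0 (ln x).

Definition cmod (z : R[i]^o) : R := complex.Re `|z|.

Definition circle_pt r t : R[i]^o := (r * cos t) +i* (r * sin t).

(* m(r, f) *)
Definition proximity f r : R :=
  (2 * pi)^-1 *
  \int[lebesgue_measure]_(t in `[0, 2 * pi]) logp (cmod (f (circle_pt r t))).

(* n(t, f): the sum has finite support when f is meromorphic *)
Definition pole_count f t : R :=
  \sum_(z \in [set z : R[i]^o | cmod z <= t]) ((pole_order f z)%:R : R).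

Definition reduced_pole_count f t : R :=
  \sum_(z \in [set z : R[i]^o | cmod z <= t])
    ((0 < pole_order f z)%N%:R : R).

Definition integrated (n : R -> R) r : R :=
  \int[lebesgue_measure]_(t in `]0, r]) ((n t - n 0) / t) + n 0 * ln r.

(* N(r, f) *)
Definition counting f : R -> R := integrated (pole_count f).

Definition reduced_counting f : R -> R := integrated (reduced_pole_count f).

(* T(r, f) *)
Definition characteristic f r : R := proximity f r + counting f r.

(* S = S(r, f) *)
Definition small_error f (S : R -> R) := exists E : set R,
  [/\ E `<=` `]0, +oo[%classic,
      measurable E,
      (lebesgue_measure E < +oo)%E &
      forall eps : R, 0 < eps ->
        \forall r \near +oo, ~ E r -> `|S r| <= eps * `|characteristic f r|].

Definition small_function f (b : R[i]^o -> R[i]^o) :=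
  [/\ meromorphic b, ~ meq b (cst 0) & small_error f (characteristic b)].

(* a f^(q_0) (f')^(q_1) ... (f^(k))^(q_k) *)
Definition diff_monomial (a f : R[i]^o -> R[i]^o) (k : nat) (q : nat -> nat)
    (z : R[i]^o) : R[i]^o :=
  a z * \prod_(0 <= i < k.+1) (f^`(i)%classic z) ^+ q i.

End Nevanlinna.

(* q_1 + 2 q_2 + ... + k q_k *)
Definition weight (k : nat) (q : nat -> nat) : nat :=
  (\sum_(1 <= i < k.+1) i * q i)%N.

(* Main.v *)
(* Put F = M[f] / phi and n = q_0 + ... + q_k. The identity
   1/F = 1 - (F - 1)/F' * F'/F, the lemma on the logarithmic derivative and
   Jensen's formula for G = F' / (F - 1) give
   n m(r, 1/f) <= - N(ord G) + S(r, f), where N(D) is the integrated counting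
   function of a divisor D. A comparison of orders at each point bounds the
   divisor n ord^+ f - ord G by (mu + 1) times the distinct zeros of f, plus the
   distinct poles of f, plus the distinct zeros of M[f] - phi, plus terms from
   the small functions; so n T <= (mu + 2) T + Nbar(1/(M[f] - phi)) + S. If F is
   constant, the orders of f alone suffice. That log r = o(T(r, f)) comes from
   transcendence: otherwise f has finitely many zeros and poles, and the bound
   on logarithmic derivatives of zero-free functions makes f rational.

   The lemma on the logarithmic derivative is obtained without the monotonicity
   of T: dividing by a Blaschke-type product leaves a zero-free function, whose
   logarithmic derivative is a Cauchy integral of log |f|; the same product shows
   that T(s) <= C (r / (r - s))^2 T(r) for s < r, which together with Borel's
   growth lemma replaces monotonicity. All circles used avoid the zeros, the
   poles and the junk values of the functions at hand, so every mean over a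
   circle is the integral of a continuous function. *)
Require Import Defs.
From HB Require Import structures.
From mathcomp Require Import all_boot all_order all_algebra.
From mathcomp Require Import all_classical all_reals all_analysis.
From mathcomp.real_closed Require Import complex.
From mathcomp Require Import ring lra zify.

Set Implicit Arguments.
Unset Strict Implicit.
Unset Printing Implicit Defensive.

Import Order.TTheory GRing.Theory Num.Theory numFieldNormedType.Exports.

Local Open Scope classical_set_scope.
Local Open Scope complex_scope.
Local Open Scope ring_scope.

(** * The complex plane *)

Section ComplexModulus.
Variable R : realType.
Import ComplexField.Normc.
Implicit Types (z w u : R[i]^o) (x y r t : R).

(** The logarithmic derivative is bounded pointwise, not in the mean. Off a set of finite measure,
    the circle of radius r stays at distance of order n^-2 from the moduli of the n zeros and poles
    that matter, so that |h'/h| is at most a fixed power of a quantity polynomial in r, in 1/delta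
    and in a bound for the characteristic on [r, r + delta]; m(r, h'/h) only sees the logarithm of
    this power. Growth is measured by T(r, h) + T(r, 1/h). It is the mean of |log |h|| plus the
    count of |ord h|, two non-negative quantities that survive the passage to a zero-free function
    with the same boundary values. The estimate starts from 1/f because F = A f^n, with A built from
    logarithmic derivatives and small functions: 1/f^n = A/F turns a bound for m(r, 1/F) into one
    for n m(r, 1/f). The inequality obtained has n = q_0 + ... + q_k in place of q_0, which is
    stronger as soon as T is non-negative. Errors need upper bounds only, since the final S is the
    positive part of the excess of T over the main term. *)

Lemma cmodE z : cmod z = Num.sqrt (complex.Re z ^+ 2 + complex.Im z ^+ 2).
Proof. by rewrite /cmod normc_def. Qed.

Lemma normE z : `|z| = (cmod z)%:C :> R[i].
Proof. by rewrite /cmod normc_def. Qed.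

Lemma cmod_normc z : cmod z = normc (z : R[i]).
Proof. by rewrite cmodE; case: z. Qed.

Lemma cmod_ge0 z : 0 <= cmod z. Proof. by rewrite cmodE sqrtr_ge0. Qed.

Lemma cmod0 : cmod (0 : R[i]^o) = 0. Proof. by rewrite cmod_normc normc0. Qed.

Lemma cmod1 : cmod (1 : R[i]^o) = 1. Proof. by rewrite cmod_normc normc1. Qed.

Lemma cmod_eq0 z : (cmod z == 0) = (z == 0).
Proof.
apply/eqP/eqP => [|->]; last exact: cmod0.
by rewrite cmod_normc => /eq0_normc.
Qed.

Lemma cmod_gt0 z : (0 < cmod z) = (z != 0).
Proof. by rewrite lt_neqAle cmod_ge0 andbT eq_sym cmod_eq0. Qed.

Lemma cmodM z w : cmod (z * w) = cmod z * cmod w.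
Proof. by rewrite !cmod_normc normcM. Qed.

Lemma cmodV z : cmod (z^-1) = (cmod z)^-1.
Proof. by rewrite !cmod_normc normcV. Qed.

Lemma cmodf z w : cmod (z / w) = cmod z / cmod w.
Proof. by rewrite cmodM cmodV. Qed.

Lemma cmodN z : cmod (- z) = cmod z.
Proof. by rewrite !cmod_normc normcN. Qed.

Lemma cmodD z w : cmod (z + w) <= cmod z + cmod w.
Proof. by rewrite !cmod_normc le_normcD. Qed.

Lemma cmodB z w : cmod (z - w) = cmod (w - z).
Proof. by rewrite -cmodN opprB. Qed.

Lemma cmod_sub_ge z w : cmod z - cmod w <= cmod (z - w).
Proof. by rewrite lerBlDr -{1}(subrK w z) cmodD. Qed.

Lemma cmodDB z w u : cmod (z - u) <= cmod (z - w) + cmod (w - u).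
Proof. by rewrite (_ : z - u = (z - w) + (w - u)) ?cmodD// addrA subrK. Qed.

Lemma cmodX z n : cmod (z ^+ n) = cmod z ^+ n.
Proof. by elim: n => [|n IH]; rewrite ?expr0 ?cmod1// !exprS cmodM IH. Qed.

Lemma cmodR x : cmod (x%:C : R[i]^o) = `|x|.
Proof. by rewrite cmodE/= expr0n addr0 sqrtr_sqr. Qed.

Lemma cmodJ z : cmod (conjc (z : R[i]) : R[i]^o) = cmod z.
Proof. by rewrite !cmodE; case: z => a b /=; rewrite sqrrN. Qed.

Lemma Re_le_cmod z : `|complex.Re z| <= cmod z.
Proof. by rewrite cmodE -sqrtr_sqr ler_wsqrtr// lerDl sqr_ge0. Qed.

Lemma Im_le_cmod z : `|complex.Im z| <= cmod z.
Proof. by rewrite cmodE -sqrtr_sqr ler_wsqrtr// lerDr sqr_ge0. Qed.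

Lemma cmod_le_ReIm z : cmod z <= `|complex.Re z| + `|complex.Im z|.
Proof.
rewrite cmodE -(@ger0_norm _ (`|_| + `|_|)) ?addr_ge0// -sqrtr_sqr ler_wsqrtr//.
rewrite sqrrD !real_normK ?num_real// -addrA lerD2l lerDr -mulr_natr.
by rewrite !mulr_ge0.
Qed.

Lemma cmod_circle r t : 0 <= r -> cmod (circle_pt r t) = r.
Proof.
move=> r0; rewrite cmodE /= !exprMn -mulrDr cos2Dsin2 mulr1 sqrtr_sqr.
by rewrite ger0_norm.
Qed.

Lemma sqr_cmod z : (cmod z ^+ 2)%:C = z * (z : R[i])^* :> R[i].
Proof. by rewrite -sqr_normc normE rmorphXn. Qed.

Lemma ReD z w : complex.Re (z + w) = complex.Re z + complex.Re w.
Proof. by case: z => ? ?; case: w => ? ?. Qed.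

Lemma ImD z w : complex.Im (z + w) = complex.Im z + complex.Im w.
Proof. by case: z => ? ?; case: w => ? ?. Qed.

Lemma ReN z : complex.Re (- z) = - complex.Re z. Proof. by case: z. Qed.

Lemma ImN z : complex.Im (- z) = - complex.Im z. Proof. by case: z. Qed.

Lemma ReB z w : complex.Re (z - w) = complex.Re z - complex.Re w.
Proof. by rewrite ReD ReN. Qed.

Lemma ImB z w : complex.Im (z - w) = complex.Im z - complex.Im w.
Proof. by rewrite ImD ImN. Qed.

Lemma ReM z w : complex.Re (z * w) =
  complex.Re z * complex.Re w - complex.Im z * complex.Im w.
Proof. by case: z => ? ?; case: w => ? ?. Qed.

Lemma ImM z w : complex.Im (z * w) =
  complex.Re z * complex.Im w + complex.Im z * complex.Re w.
Proof. by case: z => ? ?; case: w => ? ?. Qed.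

Lemma complex_eq z w : complex.Re z = complex.Re w ->
  complex.Im z = complex.Im w -> z = w.
Proof. by case: z => ? ?; case: w => ? ? /= -> ->. Qed.

End ComplexModulus.

Section ComplexTopology.
Variable R : realType.
Implicit Types (z w : R[i]^o) (P : R[i]^o -> Prop).

(** A positive element of [R[i]] is a positive real number, so the radii of the complex-valued norm
    can be exchanged for real ones. Later epsilon arguments run on [cmod] through this lemma and its
    punctured and limit variants. *)
Lemma near_cmodP P z : (\forall w \near z, P w) <->
  exists e : R, 0 < e /\ forall w, cmod (w - z) < e -> P w.
Proof.
split.
  move=> /nbhs_normP[[a b]]/=; rewrite /= ltcE /= => /andP[/eqP-> a0] H.
  exists a; split=> // w wz; apply: H => /=.
  by rewrite -normrN opprB normE ltcR.
move=> [e [e0 H]]; apply/nbhs_normP; exists (e%:C); first by rewrite /= ltcR.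
by move=> w /=; rewrite -normrN opprB normE ltcR; exact: H.
Qed.

Lemma dnear_cmodP P z : (\forall w \near z^', P w) <->
  exists e : R, 0 < e /\ forall w, w != z -> cmod (w - z) < e -> P w.
Proof.
rewrite /dnbhs near_withinE; split.
  by move=> /near_cmodP[e [e0 H]]; exists e; split => // w wz we; exact: H.
by move=> [e [e0 H]]; apply/near_cmodP; exists e; split => // w we wz; exact: H.
Qed.

Lemma cvg_cmodP (T : Type) (F : set_system T) {FF : Filter F} (f : T -> R[i]^o) l :
  f @ F --> l <-> forall e : R, 0 < e -> \forall w \near F, cmod (f w - l) < e.
Proof.
split.
  move=> /cvgrPdist_lt H e e0; have e0' : 0 < (e%:C : R[i]) by rewrite ltcR.
  have := H _ e0'; apply: filterS => w.
  by rewrite -normrN opprB normE ltcR.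
move=> H; apply/cvgrPdist_lt => -[a b]; rewrite ltcE /= => /andP[/eqP-> a0].
by have := H _ a0; apply: filterS => w; rewrite -normrN opprB normE ltcR.
Qed.

Lemma ccontP (f : R[i]^o -> R[i]^o) z : {for z, continuous f} <->
  forall e : R, 0 < e -> exists d : R, 0 < d /\
    forall w, cmod (w - z) < d -> cmod (f w - f z) < e.
Proof.
rewrite /prop_for /continuous_at.
have FF : Filter (nbhs z) by exact: nbhs_filter.
split.
  by move=> /cvg_cmodP H e e0; apply/near_cmodP; exact: H.
by move=> H; apply/cvg_cmodP => e e0; apply/near_cmodP; exact: H.
Qed.

Lemma curve_contP (T : topologicalType) (g : T -> R[i]^o) t :
  {for t, continuous (fun s => complex.Re (g s))} ->
  {for t, continuous (fun s => complex.Im (g s))} -> {for t, continuous g}.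
Proof.
rewrite /prop_for /continuous_at => /cvgrPdist_lt H1 /cvgrPdist_lt H2 /=.
apply/cvgrPdist_lt => -[a b]; rewrite ltcE /= => /andP[/eqP-> a0].
have a2 : 0 < a / 2 by rewrite divr_gt0.
near=> s; rewrite normE ltcR; apply: le_lt_trans (cmod_le_ReIm _) _.
rewrite ReB ImB (splitr a) ltrD//; near: s; [exact: H1 | exact: H2].
Unshelve. all: by end_near. Qed.

Lemma continuous_Re : continuous (@complex.Re R : R[i]^o -> R).
Proof.
move=> z; have FF : Filter (nbhs z) by exact: nbhs_filter.
apply/cvgrPdist_lt => e e0; apply/near_cmodP; exists e; split=> // w we.
by rewrite -ReB; apply: le_lt_trans (Re_le_cmod _) _; rewrite cmodB.
Qed.

Lemma continuous_Im : continuous (@complex.Im R : R[i]^o -> R).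
Proof.
move=> z; have FF : Filter (nbhs z) by exact: nbhs_filter.
apply/cvgrPdist_lt => e e0; apply/near_cmodP; exists e; split=> // w we.
by rewrite -ImB; apply: le_lt_trans (Im_le_cmod _) _; rewrite cmodB.
Qed.

Lemma continuous_cmod : continuous (@cmod R : R[i]^o -> R).
Proof.
move=> z; have FF : Filter (nbhs z) by exact: nbhs_filter.
apply/cvgrPdist_lt => e e0; apply/near_cmodP; exists e; split=> // w we.
apply: le_lt_trans we; rewrite ler_norml lerNl opprB cmod_sub_ge.
by rewrite cmodB cmod_sub_ge.
Qed.

Lemma continuous_circle r : continuous (@circle_pt R r).
Proof.
move=> t; apply: curve_contP => /=; apply: cvgM; try exact: cvg_cst.
  exact: continuous_cos.
exact: continuous_sin.
Qed.

(** Multiplied out, the difference quotient no longer excludes [w = z], and chain rules become plain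
    estimates. *)
Lemma is_derive_cmodP (f : R[i]^o -> R[i]^o) z d : is_derive z 1 f d <->
  forall e : R, 0 < e -> exists h : R, 0 < h /\
    forall w, cmod (w - z) < h -> cmod (f w - f z - d * (w - z)) <= e * cmod (w - z).
Proof.
split.
  move=> [df dE] e e0.
  have /cvg_cmodP/(_ _ e0)/dnear_cmodP[h [h0 H]] := df.
  rewrite -[lim _]/('D_1 f z) dE in H.
  exists h; split=> // w wh; have [->|wz] := eqVneq w z.
    by rewrite !subrr mulr0 subr0 cmod0 mulr0.
  have wz0 : w - z != 0 by rewrite subr_eq0.
  have := H (w - z) wz0; rewrite subr0 => /(_ wh) /ltW.
  rewrite [(_ : R[i]^o)%:A]mulr1 /= subrK => H1.
  have {1}-> : f w - f z - d * (w - z) = ((w - z)^-1 *: (f w - f z) - d) * (w - z).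
    by rewrite mulrBl; congr (_ - _); rewrite /GRing.scale/= mulrC mulrA divff// mul1r.
  by rewrite cmodM ler_wpM2r// cmod_ge0.
move=> H.
have H1 : (fun h : R[i]^o => h^-1 *: (f (h *: (1 : R[i]^o) + z) - f z)) @ (0 : R[i]^o)^' --> d.
  apply/cvg_cmodP => e e0; apply/dnear_cmodP.
  have e2 : 0 < e / 2 by rewrite divr_gt0.
  have [h [h0 H1]] := H _ e2; exists h; split=> // w w0; rewrite subr0 => wh.
  have := H1 (w + z); rewrite addrK => /(_ wh) H2.
  have {1}-> : w^-1 *: (f (w *: 1 + z) - f z) - d = (f (w + z) - f z - d * w) / w.
    by rewrite mulrBl mulfK// /GRing.scale/= mulr1 mulrC.
  rewrite cmodf ltr_pdivrMr ?cmod_gt0//; apply: le_lt_trans H2 _.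
  by rewrite ltr_pM2r ?cmod_gt0// ltr_pdivrMr// ltr_pMr// ltr1n.
by split; [apply/cvg_ex; exists d | apply: cvg_lim H1].
Qed.

End ComplexTopology.

(** * Integrals *)

Section IntervalIntegral.
Variable R : realType.
Notation mu := (@lebesgue_measure R).
Implicit Types (a b c t M : R) (u v : R -> R).

Definition itg a b u : R := \int[mu]_(t in `[a, b]) u t.

Lemma itg_integrable a b u : {within `[a, b], continuous u} ->
  mu.-integrable `[a, b] (EFin \o u).
Proof. by move=> cu; apply: continuous_compact_integrable => //; exact: segment_compact. Qed.

Lemma eq_itg a b u v : (forall t, a <= t <= b -> u t = v t) ->
  itg a b u = itg a b v.
Proof. by move=> uv; apply: eq_Rintegral => t; rewrite inE/= in_itv/=; exact: uv. Qed.

Lemma itgD a b u v : {within `[a, b], continuous u} ->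
  {within `[a, b], continuous v} ->
  itg a b (fun t => u t + v t) = itg a b u + itg a b v.
Proof. by move=> cu cv; apply: RintegralD => //; exact: itg_integrable. Qed.

Lemma itgB a b u v : {within `[a, b], continuous u} ->
  {within `[a, b], continuous v} ->
  itg a b (fun t => u t - v t) = itg a b u - itg a b v.
Proof. by move=> cu cv; apply: RintegralB => //; exact: itg_integrable. Qed.

Lemma itgZ a b c u : {within `[a, b], continuous u} ->
  itg a b (fun t => c * u t) = c * itg a b u.
Proof. by move=> cu; apply: RintegralZl => //; exact: itg_integrable. Qed.

Lemma itg_cst a b c : a <= b -> itg a b (fun=> c) = c * (b - a).
Proof.
move=> ab; rewrite /itg Rintegral_cst//=.
rewrite lebesgue_measure_itv/= lte_fin.
by move: ab; rewrite le_eqVlt => /predU1P[->|->//]; rewrite ltxx subrr.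
Qed.

Lemma itg_le a b u v : {within `[a, b], continuous u} ->
  {within `[a, b], continuous v} ->
  (forall t, a <= t <= b -> u t <= v t) -> itg a b u <= itg a b v.
Proof.
move=> cu cv uv; by apply: le_Rintegral => //; exact: itg_integrable.
Qed.

Lemma itg_bound a b u M : a <= b -> {within `[a, b], continuous u} ->
  (forall t, a <= t <= b -> `|u t| <= M) -> `|itg a b u| <= M * (b - a).
Proof.
move=> ab cu uM; rewrite ler_norml -mulNr -!itg_cst//.
have cc (c : R) : {within `[a, b], continuous (fun=> c)} by move=> ?; exact: cvg_cst.
by apply/andP; split; apply: itg_le => // t /uM; rewrite ler_norml => /andP[].
Qed.

Lemma itg_split a c b u : a <= c -> c <= b -> {within `[a, b], continuous u} ->
  itg a b u = itg a c u + itg c b u.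
Proof.
move=> ac cb cu; apply/eqP; rewrite addrC -subr_eq; apply/eqP.
rewrite /itg (@Rintegral_itvB _ u (BLeft a) (BRight b) c).
- by rewrite Rintegral_itv_obnd_cbnd//; apply: integrableS (itg_integrable cu) => //;
    apply: subset_itvr; rewrite bnd_simp.
- exact: itg_integrable.
- by rewrite bnd_simp.
- by rewrite bnd_simp.
Qed.

Lemma itg_FTC a b U u : a <= b -> {within `[a, b], continuous u} ->
  (forall t, a <= t <= b -> is_derive t 1 U (u t)) -> itg a b u = U b - U a.
Proof.
rewrite le_eqVlt => /predU1P[->|ab] cu dU.
  by rewrite subrr /itg set_itv1 Rintegral_set1.
have cU t : a <= t <= b -> {for t, continuous U}.
  by move=> /dU[d _]; exact/differentiable_continuous/derivable1_diffP.
rewrite /itg /Rintegral (@continuous_FTC2 _ u U)//.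
- split=> [t| |].
  + by rewrite in_itv/= => /andP[/ltW ? /ltW ?]; have [] := dU t; rewrite ?H ?H0//; apply/andP.
  + by apply: cvg_at_right_filter; apply: cU; rewrite lexx ltW.
  + by apply: cvg_at_left_filter; apply: cU; rewrite lexx ltW.
- move=> t; rewrite in_itv/= => /andP[/ltW ? /ltW ?]; rewrite derive1E.
  by have [|_ ->] := dU t; first by apply/andP.
Qed.

End IntervalIntegral.

Section ComplexIntervalIntegral.
Variable R : realType.
Implicit Types (a b c t M r : R) (u v : R -> R[i]^o) (F G : R[i]^o -> R[i]^o).

(** Componentwise integral of a curve. The bounds [citg_bound] and [citg_le_cmod] treat the two
    components separately and lose a factor 2, harmless in estimates up to constants. *)
Definition citg a b u : R[i]^o :=
  itg a b (fun t => complex.Re (u t)) +i* itg a b (fun t => complex.Im (u t)).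

Lemma within_Re a b u : {within `[a, b], continuous u} ->
  {within `[a, b], continuous (fun t => complex.Re (u t))}.
Proof.
move=> cu t; apply: (@continuous_comp _ _ _ (u : subspace _ -> R[i]^o) (@complex.Re R)).
  exact: cu.
exact: continuous_Re.
Qed.

Lemma within_Im a b u : {within `[a, b], continuous u} ->
  {within `[a, b], continuous (fun t => complex.Im (u t))}.
Proof.
move=> cu t; apply: (@continuous_comp _ _ _ (u : subspace _ -> R[i]^o) (@complex.Im R)).
  exact: cu.
exact: continuous_Im.
Qed.

Lemma eq_citg a b u v : (forall t, a <= t <= b -> u t = v t) ->
  citg a b u = citg a b v.
Proof. by move=> uv; congr (_ +i* _); apply: eq_itg => t /uv->. Qed.

Lemma within_cst (T : topologicalType) a b (k : T) :
  {within `[a, b], continuous (fun=> k)}.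
Proof. by move=> t; exact: cvg_cst. Qed.

Lemma citgD a b u v : {within `[a, b], continuous u} ->
  {within `[a, b], continuous v} ->
  citg a b (fun t => u t + v t) = citg a b u + citg a b v.
Proof.
move=> cu cv; apply: complex_eq => /=.
  by rewrite -itgD; [apply: eq_itg => t _; rewrite ReD|exact: within_Re..].
by rewrite -itgD; [apply: eq_itg => t _; rewrite ImD|exact: within_Im..].
Qed.

Lemma citgZ a b (k : R[i]^o) u : {within `[a, b], continuous u} ->
  citg a b (fun t => k * u t) = k * citg a b u.
Proof.
move=> cu; have cR := within_Re cu; have cI := within_Im cu.
have sub (c : R) (f : R -> R) : {within `[a, b], continuous f} ->
    {within `[a, b], continuous (fun t => c * f t)}.
  by move=> cf t; apply: cvgM; [exact: cvg_cst|exact: cf].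
apply: complex_eq; rewrite ?ReM ?ImM/=.
  rewrite -itgZ// -itgZ// -itgB; [|exact: sub..].
  by apply: eq_itg => t _; rewrite ReM.
rewrite -itgZ// -itgZ// -itgD; [|exact: sub..].
by apply: eq_itg => t _; rewrite ImM.
Qed.

Lemma citg_cst a b (k : R[i]^o) : a <= b -> citg a b (fun=> k) = k * (b - a)%:C.
Proof. by move=> ab; apply: complex_eq; rewrite ?ReM ?ImM/= itg_cst//; ring. Qed.

Lemma citgN a b u : {within `[a, b], continuous u} ->
  citg a b (fun t => - u t) = - citg a b u.
Proof.
move=> cu; rewrite -[RHS]mulN1r -citgZ//.
by apply: eq_citg => t _; rewrite mulN1r.
Qed.

Lemma citgB a b u v : {within `[a, b], continuous u} ->
  {within `[a, b], continuous v} ->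
  citg a b (fun t => u t - v t) = citg a b u - citg a b v.
Proof.
move=> cu cv; have cnv : {within `[a, b], continuous (fun t => - v t)}.
  by move=> t; apply: (@cvgN _ (R[i]^o)); exact: cv.
by rewrite -(citgN cv) -(citgD cu cnv).
Qed.

Lemma citg_bound a b u M : a <= b -> {within `[a, b], continuous u} ->
  (forall t, a <= t <= b -> cmod (u t) <= M) ->
  cmod (citg a b u) <= 2 * M * (b - a).
Proof.
move=> ab cu uM; apply: le_trans (cmod_le_ReIm _) _.
rewrite -mulrA mulr2n mulrDl mul1r; apply: lerD.
  apply: itg_bound => //; first exact: within_Re.
  by move=> t /uM; exact/le_trans/Re_le_cmod.
apply: itg_bound => //; first exact: within_Im.
by move=> t /uM; exact/le_trans/Im_le_cmod.
Qed.

Lemma citg_le_cmod a b u : a <= b -> {within `[a, b], continuous u} ->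
  cmod (citg a b u) <= 2 * itg a b (fun t => cmod (u t)).
Proof.
move=> ab cu.
have cm : {within `[a, b], continuous (fun t => cmod (u t))}.
  move=> t; apply: (@continuous_comp _ _ _ (u : subspace _ -> R[i]^o) (@cmod R)).
    exact: cu.
  exact: continuous_cmod.
have H (f : R -> R) : {within `[a, b], continuous f} ->
    (forall t, `|f t| <= cmod (u t)) ->
    `|itg a b f| <= itg a b (fun t => cmod (u t)).
  move=> cf fu; rewrite ler_norml; apply/andP; split; last first.
    by apply: itg_le => // t _; apply: le_trans (fu t); exact: ler_norm.
  rewrite -mulN1r -itgZ//; apply: itg_le => // [t|t _].
    by apply: cvgM; [exact: cvg_cst|exact: cm].
  by have := fu t; rewrite mulN1r ler_norml => /andP[].
apply: le_trans (cmod_le_ReIm _) _.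
rewrite mulr2n mulrDl mul1r; apply: lerD; apply: H.
- exact: within_Re.
- by move=> t; exact: Re_le_cmod.
- exact: within_Im.
- by move=> t; exact: Im_le_cmod.
Qed.

Lemma citg_split a c b u : a <= c -> c <= b -> {within `[a, b], continuous u} ->
  citg a b u = citg a c u + citg c b u.
Proof.
move=> ac cb cu; apply: complex_eq => /=; apply: itg_split => //.
  exact: within_Re.
exact: within_Im.
Qed.

Lemma citg_FTC a b (U u : R -> R[i]^o) : a <= b -> {within `[a, b], continuous u} ->
  (forall t, a <= t <= b -> is_derive t 1 (fun s => complex.Re (U s)) (complex.Re (u t))) ->
  (forall t, a <= t <= b -> is_derive t 1 (fun s => complex.Im (U s)) (complex.Im (u t))) ->
  citg a b u = U b - U a.
Proof.
move=> ab cu dR dI; apply: complex_eq; rewrite /= ?ReB ?ImB.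
  by rewrite -(itg_FTC ab (within_Re cu) dR).
by rewrite -(itg_FTC ab (within_Im cu) dI).
Qed.

End ComplexIntervalIntegral.

(** * Goursat's theorem *)

Section Bisection.
Variable R : realType.
Implicit Types (x y p q : R).

Lemma half_powS (l : R) n : l / 2 ^+ n = l / 2 ^+ n.+1 + l / 2 ^+ n.+1.
Proof. by rewrite exprS invfM; field; rewrite expf_neq0. Qed.

Lemma archi_half (l e : R) : 0 < e -> exists N, forall n, (N <= n)%N -> l / 2 ^+ n < e.
Proof.
move=> e0; have [N _ HN] : \forall n \near \oo, (l * 2^-1 ^+ n) < e.
  have : l * 2^-1 ^+ n @[n --> \oo] --> l * 0.
    by apply: cvgM; [exact: cvg_cst|apply: cvg_expr; rewrite ger0_norm ?invf_lt1 ?ltr1n].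
  by rewrite mulr0 => /cvgr_lt; exact.
by exists N => n Nn; rewrite -exprVn; exact: HN.
Qed.

(** The left endpoints increase and the right endpoints [s n + l / 2 ^+ n] decrease, so the supremum
    of the left endpoints lies in every interval. *)
Lemma nested_limit (l : R) (s : nat -> R) : 0 <= l ->
  (forall n, s n <= s n.+1 <= s n + l / 2 ^+ n.+1) ->
  exists p, forall n, s n <= p <= s n + l / 2 ^+ n.
Proof.
move=> l0 sS.
have l2 n : 0 <= l / 2 ^+ n by rewrite divr_ge0// exprn_ge0.
have smono n k : s n <= s (n + k)%N.
  elim: k => [|k IH]; rewrite ?addn0// addnS; apply: le_trans IH _.
  by have /andP[] := sS (n + k)%N.
have sup_ n k : s (n + k)%N + l / 2 ^+ (n + k) <= s n + l / 2 ^+ n.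
  elim: k => [|k]; rewrite ?addn0// addnS; apply: le_trans.
  rewrite [in leRHS]half_powS addrA lerD2r.
  by have /andP[] := sS (n + k)%N.
have sub n m : s m <= s n + l / 2 ^+ n.
  have [mn|/ltnW nm] := leqP m n.
    by have := smono m (n - m)%N; rewrite subnKC// => h; apply: le_trans h _; rewrite lerDl.
  by have := sup_ n (m - n)%N; rewrite subnKC// ; apply: le_trans; rewrite lerDl.
have hs : has_sup (range s).
  by split; [exists (s 0%N), 0%N|exists (s 0%N + l / 2 ^+ 0) => _ [m _ <-]].
exists (sup (range s)) => n; apply/andP; split.
  by apply: (sup_upper_bound hs); exists n.
by apply: sup_le_ub => [|_ [m _ <-]]; [case: hs|exact: sub].
Qed.

(* Halving a rectangle both ways turns a local property into a global one. *)
Lemma bisection (P : R -> R -> nat -> Prop) x0 y0 (lx ly : R) :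
  0 <= lx -> 0 <= ly ->
  (forall x y n, x0 <= x -> x + lx / 2 ^+ n <= x0 + lx ->
    y0 <= y -> y + ly / 2 ^+ n <= y0 + ly ->
    P x y n.+1 -> P (x + lx / 2 ^+ n.+1) y n.+1 ->
    P x (y + ly / 2 ^+ n.+1) n.+1 ->
    P (x + lx / 2 ^+ n.+1) (y + ly / 2 ^+ n.+1) n.+1 -> P x y n) ->
  (forall p q, x0 <= p <= x0 + lx -> y0 <= q <= y0 + ly ->
    exists N, forall n x y, (N <= n)%N ->
      x0 <= x -> x + lx / 2 ^+ n <= x0 + lx ->
      y0 <= y -> y + ly / 2 ^+ n <= y0 + ly ->
      x <= p <= x + lx / 2 ^+ n -> y <= q <= y + ly / 2 ^+ n -> P x y n) ->
  P x0 y0 0.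
Proof.
move=> lx0 ly0 Psplit Ploc; apply: contrapT => NP.
have lx2 n : 0 <= lx / 2 ^+ n by rewrite divr_ge0// exprn_ge0.
have ly2 n : 0 <= ly / 2 ^+ n by rewrite divr_ge0// exprn_ge0.
pose bad n (s : R * R) := [/\ x0 <= s.1, s.1 + lx / 2 ^+ n <= x0 + lx,
  y0 <= s.2, s.2 + ly / 2 ^+ n <= y0 + ly & ~ P s.1 s.2 n].
(* The implication makes the successor total, as [choice] requires; for a rectangle that is not bad
   its value is arbitrary. *)
have step (ns : nat * (R * R)) : exists s' : R * R, bad ns.1 ns.2 ->
    [/\ bad ns.1.+1 s', ns.2.1 <= s'.1 <= ns.2.1 + lx / 2 ^+ ns.1.+1 &
        ns.2.2 <= s'.2 <= ns.2.2 + ly / 2 ^+ ns.1.+1].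
  case: ns => n [x y]/=; have [b|nb] := pselect (bad n (x, y)); last by exists (x, y).
  case: (b) => /= h1 h2 h3 h4 NPxy.
  have hx' : x + lx / 2 ^+ n.+1 + lx / 2 ^+ n.+1 <= x0 + lx.
    by rewrite -addrA -half_powS.
  have hy' : y + ly / 2 ^+ n.+1 + ly / 2 ^+ n.+1 <= y0 + ly.
    by rewrite -addrA -half_powS.
  have hx : x + lx / 2 ^+ n.+1 <= x0 + lx by apply: le_trans hx'; rewrite lerDl.
  have hy : y + ly / 2 ^+ n.+1 <= y0 + ly by apply: le_trans hy'; rewrite lerDl.
  have hx1 : x <= x + lx / 2 ^+ n.+1 by rewrite lerDl.
  have hy1 : y <= y + ly / 2 ^+ n.+1 by rewrite lerDl.
  have x1 := le_trans h1 hx1; have y1 := le_trans h3 hy1.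
  have [P1|N1] := pselect (P x y n.+1); last by exists (x, y) => _; rewrite /bad/= !lexx hx1 hy1.
  have [P2|N2] := pselect (P (x + lx / 2 ^+ n.+1) y n.+1).
    have [P3|N3] := pselect (P x (y + ly / 2 ^+ n.+1) n.+1).
      exists (x + lx / 2 ^+ n.+1, y + ly / 2 ^+ n.+1) => _.
      rewrite /bad/= !lexx hx1 hy1; split=> //; split => // P4.
      by apply: NPxy; exact: Psplit.
    by exists (x, y + ly / 2 ^+ n.+1) => _; rewrite /bad/= !lexx hx1 hy1.
  by exists (x + lx / 2 ^+ n.+1, y) => _; rewrite /bad/= !lexx hx1 hy1.
have [f Hf] := choice step.
pose s := fix s n := if n is m.+1 then f (m, s m) else (x0, y0).
have bs n : bad n (s n).
  elim: n => [|n IH]; first by rewrite /bad/= expr0 !divr1 !lexx.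
  by case: (Hf (n, s n) IH).
have [n|p Hp] := @nested_limit lx (fun n => (s n).1) lx0.
  by case: (Hf (n, s n) (bs n)).
have [n|q Hq] := @nested_limit ly (fun n => (s n).2) ly0.
  by case: (Hf (n, s n) (bs n)).
have [||N HN] := Ploc p q.
- by have := Hp 0%N; rewrite /= expr0 divr1.
- by have := Hq 0%N; rewrite /= expr0 divr1.
have [h1 h2 h3 h4] := bs N; apply; apply: HN => //.
Qed.

(** An interval is a rectangle whose second side has length 0. *)
Lemma bisection1 (P : R -> nat -> Prop) x0 (l : R) : 0 <= l ->
  (forall x n, x0 <= x -> x + l / 2 ^+ n <= x0 + l ->
    P x n.+1 -> P (x + l / 2 ^+ n.+1) n.+1 -> P x n) ->
  (forall p, x0 <= p <= x0 + l -> exists N, forall n x, (N <= n)%N ->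
      x0 <= x -> x + l / 2 ^+ n <= x0 + l ->
      x <= p <= x + l / 2 ^+ n -> P x n) ->
  P x0 0.
Proof.
move=> l0 Ps Pl; apply: (@bisection (fun x y n => P x n) x0 0 l 0) => //.
  by move=> x y n ? ? _ _ ? ? _ _; exact: Ps.
move=> p q px _; have [N HN] := Pl p px; exists N => n x y ? ? ? _ _ ? _.
exact: HN.
Qed.

End Bisection.

Section Goursat.
Variable R : realType.
Implicit Types (x y a b M : R) (h : R[i]^o -> R[i]^o) (z w : R[i]^o).

Lemma holo_continuous h z d : is_derive z 1 h d -> {for z, continuous h}.
Proof. by move=> [dh _]; exact/differentiable_continuous/derivable1_diffP. Qed.

Lemma within_curve (T : topologicalType) a b (g : R -> R[i]^o) (h : R[i]^o -> T) :
  (forall t, a <= t <= b -> {for t, continuous g}) ->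
  (forall t, a <= t <= b -> {for g t, continuous h}) ->
  {within `[a, b], continuous (fun t => h (g t))}.
Proof.
move=> cg ch; apply: continuous_in_subspaceT => t /set_mem/=; rewrite in_itv/= => tab.
by apply: continuous_comp; [exact: cg|exact: ch].
Qed.

Lemma continuous_horiz y : continuous (fun x => x +i* y : R[i]^o).
Proof. by move=> x; apply: curve_contP => //=; exact: cvg_cst. Qed.

Lemma continuous_vert x : continuous (fun y => x +i* y : R[i]^o).
Proof. by move=> y; apply: curve_contP => //=; exact: cvg_cst. Qed.

(** The contour integral over the boundary of the rectangle, counterclockwise; the factor ['i] is
    [dz = i dt] on the vertical sides. *)
Definition rect_int h x y a b : R[i]^o :=
  (citg x (x + a) (fun s => h (s +i* y)) -
   citg x (x + a) (fun s => h (s +i* (y + b)))) +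
  'i%C * (citg y (y + b) (fun t => h ((x + a) +i* t)) -
          citg y (y + b) (fun t => h (x +i* t))).

Definition cont_on_rect h x y a b := forall s t,
  x <= s <= x + a -> y <= t <= y + b -> {for (s +i* t : R[i]^o), continuous h}.

Lemma cont_rect_horiz h x y a b t : cont_on_rect h x y a b -> y <= t <= y + b ->
  {within `[x, x + a], continuous (fun s => h (s +i* t))}.
Proof.
move=> ch tb; apply: (@within_curve _ x (x + a) (fun s => s +i* t) h) => s sa.
  exact: continuous_horiz.
exact: ch.
Qed.

Lemma cont_rect_vert h x y a b s : cont_on_rect h x y a b -> x <= s <= x + a ->
  {within `[y, y + b], continuous (fun t => h (s +i* t))}.
Proof.
move=> ch sb; apply: (@within_curve _ y (y + b) (fun t => s +i* t) h) => t ta.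
  exact: continuous_vert.
exact: ch.
Qed.

Lemma rect_int_split h x y a b : 0 <= a -> 0 <= b ->
  cont_on_rect h x y (a + a) (b + b) ->
  rect_int h x y (a + a) (b + b) =
    rect_int h x y a b + rect_int h (x + a) y a b +
    rect_int h x (y + b) a b + rect_int h (x + a) (y + b) a b.
Proof.
move=> a0 b0 ch; rewrite /rect_int.
have xx : x <= x + a by rewrite lerDl.
have xx2 : x + a <= x + (a + a) by rewrite addrA lerDl.
have yy : y <= y + b by rewrite lerDl.
have yy2 : y + b <= y + (b + b) by rewrite addrA lerDl.
have c1 := @cont_rect_horiz h x y _ _ y ch; have c2 := @cont_rect_horiz h x y _ _ (y + (b + b)) ch.
have c3 := @cont_rect_vert h x y _ _ x ch; have c4 := @cont_rect_vert h x y _ _ (x + (a + a)) ch.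
rewrite (citg_split xx xx2 (c1 _)) ?(lexx, le_trans yy yy2)//.
rewrite (citg_split xx xx2 (c2 _)) ?(lexx, le_trans yy yy2)//.
rewrite (citg_split yy yy2 (c3 _)) ?(lexx, le_trans xx xx2)//.
rewrite (citg_split yy yy2 (c4 _)) ?(lexx, le_trans xx xx2)//.
rewrite !addrA; ring.
Qed.

Lemma rect_int_bound h x y a b M : 0 <= a -> 0 <= b -> cont_on_rect h x y a b ->
  (forall s t, x <= s <= x + a -> y <= t <= y + b -> cmod (h (s +i* t)) <= M) ->
  cmod (rect_int h x y a b) <= 4 * M * (a + b).
Proof.
move=> a0 b0 ch hM; rewrite /rect_int.
have xx : x <= x + a by rewrite lerDl.
have yy : y <= y + b by rewrite lerDl.
have H1 t : y <= t <= y + b -> cmod (citg x (x + a) (fun s => h (s +i* t))) <= 2 * M * a.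
  move=> tb; have -> : 2 * M * a = 2 * M * ((x + a) - x) by ring.
  apply: citg_bound => //; first exact: (cont_rect_horiz ch).
  by move=> s sa; apply: hM.
have H2 s : x <= s <= x + a -> cmod (citg y (y + b) (fun t => h (s +i* t))) <= 2 * M * b.
  move=> tb; have -> : 2 * M * b = 2 * M * ((y + b) - y) by ring.
  apply: citg_bound => //; first exact: (cont_rect_vert ch).
  by move=> t sa; apply: hM.
have ci : cmod ('i%C : R[i]^o) = 1 by rewrite cmodE /= expr0n expr1n add0r sqrtr1.
apply: le_trans (cmodD _ _) _; rewrite cmodM ci mul1r.
have -> : 4 * M * (a + b) = (2 * M * a + 2 * M * a) + (2 * M * b + 2 * M * b) by ring.
have y1 : y <= y <= y + b by rewrite lexx yy.
have y2 : y <= y + b <= y + b by rewrite lexx yy.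
have x1 : x <= x <= x + a by rewrite lexx xx.
have x2 : x <= x + a <= x + a by rewrite lexx xx.
apply: lerD; apply: le_trans (cmodD _ _) _; rewrite cmodN.
  exact: lerD (H1 _ y1) (H1 _ y2).
exact: lerD (H2 _ x2) (H2 _ x1).
Qed.

Lemma cforB (f g : R[i]^o -> R[i]^o) z : {for z, continuous f} ->
  {for z, continuous g} -> {for z, continuous (fun w => f w - g w)}.
Proof. by move=> cf cg; exact: (cvgB cf cg). Qed.

Lemma continuous_affine (k d z : R[i]^o) : {for z, continuous (fun w => k + d * w)}.
Proof.
apply: (@holo_continuous _ _ d); apply/is_derive_cmodP => e e0; exists 1; split=> // w _.
rewrite (_ : _ - _ = 0); first by rewrite cmod0 mulr_ge0 ?cmod_ge0// ltW.
ring.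
Qed.

(** On opposite sides the integrand differs by a constant, [- d * i b] for the horizontal pair and
    [d * a] for the vertical one, and the two contributions cancel. *)
Lemma rect_int_affine (k d : R[i]^o) x y a b : 0 <= a -> 0 <= b ->
  rect_int (fun z => k + d * z) x y a b = 0.
Proof.
move=> a0 b0.
have ch : cont_on_rect (fun z => k + d * z) x y a b.
  by move=> s t _ _; exact: continuous_affine.
have xx : x <= x + a by rewrite lerDl.
have yy : y <= y + b by rewrite lerDl.
have y1 : y <= y <= y + b by rewrite lexx yy.
have y2 : y <= y + b <= y + b by rewrite lexx yy.
have x1 : x <= x <= x + a by rewrite lexx xx.
have x2 : x <= x + a <= x + a by rewrite lexx xx.
rewrite /rect_int -(citgB (cont_rect_horiz ch y1) (cont_rect_horiz ch y2)).
rewrite -(citgB (cont_rect_vert ch x2) (cont_rect_vert ch x1)).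
rewrite (@eq_citg _ _ _ _ (fun=> - (d * (0 +i* b)))); last first.
  by move=> s _; apply: complex_eq; rewrite !(ReB, ReD, ReM, ReN, ImB, ImD, ImM, ImN)/=; ring.
rewrite [X in _ + _ * X](@eq_citg _ _ _ _ (fun=> d * (a%:C))); last first.
  by move=> s _; apply: complex_eq; rewrite !(ReB, ReD, ReM, ReN, ImB, ImD, ImM, ImN)/=; ring.
rewrite !citg_cst//; apply: complex_eq;
  by rewrite !(ReB, ReD, ReM, ReN, ImB, ImD, ImM, ImN)/=; ring.
Qed.

Lemma rect_intB h1 h2 x y a b : 0 <= a -> 0 <= b ->
  cont_on_rect h1 x y a b -> cont_on_rect h2 x y a b ->
  rect_int (fun z => h1 z - h2 z) x y a b = rect_int h1 x y a b - rect_int h2 x y a b.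
Proof.
move=> a0 b0 c1 c2; rewrite /rect_int.
have xx : x <= x + a by rewrite lerDl.
have yy : y <= y + b by rewrite lerDl.
have y1 : y <= y <= y + b by rewrite lexx yy.
have y2 : y <= y + b <= y + b by rewrite lexx yy.
have x1 : x <= x <= x + a by rewrite lexx xx.
have x2 : x <= x + a <= x + a by rewrite lexx xx.
rewrite (citgB (cont_rect_horiz c1 y1) (cont_rect_horiz c2 y1)).
rewrite (citgB (cont_rect_horiz c1 y2) (cont_rect_horiz c2 y2)).
rewrite (citgB (cont_rect_vert c1 x2) (cont_rect_vert c2 x2)).
rewrite (citgB (cont_rect_vert c1 x1) (cont_rect_vert c2 x1)).
ring.
Qed.

Lemma le_itv_dist p s (x l : R) : x <= p <= x + l -> x <= s <= x + l -> `|s - p| <= l.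
Proof. by move=> ? ?; rewrite ler_norml; lra. Qed.

(** The integral over a rectangle is the sum over its quarters, so a bound proportional to the area
    propagates upwards. Near a point of differentiability [h] may be replaced by its difference from
    an affine function, which gives such a bound with an arbitrarily small factor. *)
Theorem goursat h x0 y0 lx ly : 0 <= lx -> 0 <= ly ->
  (forall s t, x0 <= s <= x0 + lx -> y0 <= t <= y0 + ly ->
     exists d, is_derive (s +i* t : R[i]^o) 1 h d) ->
  rect_int h x0 y0 lx ly = 0.
Proof.
move=> lx0 ly0 dh; apply/eqP; rewrite -cmod_eq0 eq_le cmod_ge0 andbT.
have ch0 : cont_on_rect h x0 y0 lx ly.
  by move=> s t hs ht; have [d] := dh s t hs ht; exact: holo_continuous.
set L := lx + ly; have L0 : 0 <= L by rewrite addr_ge0.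
have lx2 n : 0 <= lx / 2 ^+ n by rewrite divr_ge0// exprn_ge0.
have ly2 n : 0 <= ly / 2 ^+ n by rewrite divr_ge0// exprn_ge0.
have csub x y n : x0 <= x -> x + lx / 2 ^+ n <= x0 + lx ->
    y0 <= y -> y + ly / 2 ^+ n <= y0 + ly ->
    cont_on_rect h x y (lx / 2 ^+ n) (ly / 2 ^+ n).
  move=> h1 h2 h3 h4 s t /andP[s1 s2] /andP[t1 t2]; apply: ch0; apply/andP; split;
  by [exact: le_trans s1|exact: le_trans h2|exact: le_trans t1|exact: le_trans h4].
apply/ler_addgt0Pr => e e0; rewrite add0r.
(* A rectangle of generation n has side sum [L / 2 ^+ n], and there the integrand is at most
   [eps * (L / 2 ^+ n)]; [rect_int_bound] then yields [eps * K] over 4^n. The denominator [K + 1]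
   below allows for a degenerate rectangle with [K = 0]. *)
set K := 4 * L * L; have K0 : 0 <= K by rewrite !mulr_ge0.
have e1 : 0 < e / (K + 1) by rewrite divr_gt0// ltr_wpDl.
apply: (@le_trans _ _ (e / (K + 1) * K)); last first.
  by rewrite mulrAC ler_pdivrMr ?ltr_wpDl// ler_pM2l// lerDl.
set eps := e / (K + 1) in e1 *.
pose P x y n := cmod (rect_int h x y (lx / 2 ^+ n) (ly / 2 ^+ n)) <=
  eps * K / 2 ^+ n / 2 ^+ n.
suff : P x0 y0 0%N by rewrite /P expr0 !divr1.
apply: (@bisection _ P x0 y0 lx ly) => //.
  move=> x y n h1 h2 h3 h4; rewrite /P => P1 P2 P3 P4.
  rewrite (half_powS lx) (half_powS ly) rect_int_split//; last first.
    by rewrite -!half_powS; exact: csub.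
  have -> : eps * K / 2 ^+ n / 2 ^+ n = eps * K / 2 ^+ n.+1 / 2 ^+ n.+1 +
     eps * K / 2 ^+ n.+1 / 2 ^+ n.+1 + eps * K / 2 ^+ n.+1 / 2 ^+ n.+1 +
     eps * K / 2 ^+ n.+1 / 2 ^+ n.+1.
    by rewrite exprS; field; rewrite expf_neq0.
  apply: le_trans (cmodD _ _) _; apply: lerD P4.
  apply: le_trans (cmodD _ _) _; apply: lerD P3.
  by apply: le_trans (cmodD _ _) _; apply: lerD P1 P2.
move=> p q hp hq; have [d /is_derive_cmodP/(_ _ e1)[de [de0 Hd]]] := dh p q hp hq.
have [N HN] := archi_half L de0.
exists N => n x y Nn h1 h2 h3 h4 hpx hqy; rewrite /P.
pose w0 : R[i]^o := p +i* q.
pose af (w : R[i]^o) : R[i]^o := (h w0 - d * w0) + d * w.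
have caf : cont_on_rect af x y (lx / 2 ^+ n) (ly / 2 ^+ n).
  by move=> s t _ _; exact: continuous_affine.
have chs := csub x y n h1 h2 h3 h4.
have -> : rect_int h x y (lx / 2 ^+ n) (ly / 2 ^+ n) =
    rect_int (fun z => h z - af z) x y (lx / 2 ^+ n) (ly / 2 ^+ n).
  by rewrite rect_intB// rect_int_affine// subr0.
have -> : eps * K / 2 ^+ n / 2 ^+ n =
    4 * (eps * (L / 2 ^+ n)) * (lx / 2 ^+ n + ly / 2 ^+ n).
  by rewrite -mulrDl -/L /K; field; rewrite expf_neq0.
apply: (rect_int_bound (lx2 n) (ly2 n)).
  by move=> s t hs ht; exact: cforB (chs s t hs ht) (caf s t hs ht).
move=> s t hs ht.
have wL : cmod ((s +i* t : R[i]^o) - w0) <= L / 2 ^+ n.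
  apply: le_trans (cmod_le_ReIm _) _; rewrite /L mulrDl; apply: lerD => /=.
    exact: (le_itv_dist hpx).
  exact: (le_itv_dist hqy).
have -> : h (s +i* t) - af (s +i* t) = h (s +i* t) - h w0 - d * ((s +i* t : R[i]^o) - w0).
  by rewrite /af; ring.
apply: le_trans (Hd _ _) _; first by apply: le_lt_trans wL _; exact: HN.
by rewrite ler_pM2l.
Qed.

End Goursat.

(** * Complex derivatives, curves and the exponential function *)

Section Derivatives.
Variable R : realType.
Implicit Types (x y s t e r : R) (z w d v : R[i]^o) (f g F : R[i]^o -> R[i]^o).

Lemma is_derive_normP (f : R -> R) t (d : R) : is_derive t 1 f d <->
  forall e, 0 < e -> exists h : R, 0 < h /\
    forall s, `|s - t| < h -> `|f s - f t - d * (s - t)| <= e * `|s - t|.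
Proof.
have E (s : R) : s != 0 -> s^-1 *: (f (s *: 1 + t) - f t) - d = (f (s + t) - f t - d * s) / s.
  by move=> s0; rewrite mulrBl mulfK// /GRing.scale/= mulr1 mulrC.
split.
  move=> [df dE] e e0.
  have /cvgrPdist_le/(_ _ e0) := df.
  rewrite -[lim _]/('D_1 f t) dE near_withinE => /nbhs_normP[h /= h0 H].
  exists h; split=> // s sh; have [->|st] := eqVneq s t.
    by rewrite !subrr mulr0 subr0 normr0 mulr0.
  have st0 : s - t != 0 by rewrite subr_eq0.
  have /= := H (s - t); rewrite sub0r normrN => /(_ sh st0).
  rewrite distrC E// subrK normrM normfV ler_pdivrMr ?normr_gt0//.
move=> H.
have H1 : (fun h : R => h^-1 *: (f (h *: (1 : R) + t) - f t)) @ (0 : R)^' --> d.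
  apply/cvgrPdist_le => e e0; have [h [h0 H1]] := H _ e0.
  rewrite near_withinE; apply/nbhs_normP; exists h => // s /=.
  rewrite sub0r normrN => sh s0; rewrite distrC E// normrM normfV ler_pdivrMr ?normr_gt0//.
  by have := H1 (s + t); rewrite addrK; exact.
by split; [apply/cvg_ex; exists d | apply: cvg_lim H1].
Qed.

(* [cderive] is the derivative of a curve [R -> C]; the library derivative does
   not apply, as [R[i]^o] carries no structure of normed module over [R]. *)
Definition cderive (g : R -> R[i]^o) t v := forall e, 0 < e ->
  exists h : R, 0 < h /\ forall s, `|s - t| < h ->
    cmod (g s - g t - v * (s - t)%:C) <= e * `|s - t|.

Lemma cderive_Re (g : R -> R[i]^o) t v : cderive g t v ->
  is_derive t 1 (fun s => complex.Re (g s)) (complex.Re v).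
Proof.
move=> dg; apply/is_derive_normP => e e0; have [h [h0 H]] := dg e e0.
exists h; split=> // s sh; apply: le_trans (H s sh).
by apply: le_trans (Re_le_cmod _); rewrite !ReB ReM/= mulr0 subr0.
Qed.

Lemma cderive_Im (g : R -> R[i]^o) t v : cderive g t v ->
  is_derive t 1 (fun s => complex.Im (g s)) (complex.Im v).
Proof.
move=> dg; apply/is_derive_normP => e e0; have [h [h0 H]] := dg e e0.
exists h; split=> // s sh; apply: le_trans (H s sh).
by apply: le_trans (Im_le_cmod _); rewrite !ImB ImM/= mulr0 add0r.
Qed.

Lemma cderiveP (g : R -> R[i]^o) t v :
  is_derive t 1 (fun s => complex.Re (g s)) (complex.Re v) ->
  is_derive t 1 (fun s => complex.Im (g s)) (complex.Im v) -> cderive g t v.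
Proof.
move=> /is_derive_normP H1 /is_derive_normP H2 e e0.
have e2 : 0 < e / 2 by rewrite divr_gt0.
have [h1 [h10 {}H1]] := H1 _ e2; have [h2 [h20 {}H2]] := H2 _ e2.
exists (Num.min h1 h2); split; first by rewrite lt_min h10.
move=> s; rewrite lt_min => /andP[s1 s2]; apply: le_trans (cmod_le_ReIm _) _.
rewrite !ReB !ImB ReM ImM/= !mulr0 subr0 add0r (splitr e) mulrDl.
exact: lerD (H1 s s1) (H2 s s2).
Qed.

Lemma cderive_comp (g : R -> R[i]^o) t v f d : cderive g t v ->
  is_derive (g t) 1 f d -> cderive (fun s => f (g s)) t (d * v).
Proof.
move=> dg /is_derive_cmodP df e e0.
set A := cmod v + 1; set B := cmod d + 1.
have A0 : 0 < A by rewrite ltr_wpDl ?cmod_ge0.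
have B0 : 0 < B by rewrite ltr_wpDl ?cmod_ge0.
pose e1 := e / 2 / A; have e10 : 0 < e1 by rewrite !divr_gt0.
pose e2 := Num.min 1 (e / 2 / B); have e20 : 0 < e2 by rewrite lt_min ltr01 !divr_gt0.
have [h1 [h10 H1]] := df _ e10; have [h2 [h20 H2]] := dg _ e20.
exists (Num.min h2 (h1 / A)); split; first by rewrite lt_min h20 divr_gt0.
move=> s; rewrite lt_min => /andP[s2 s1].
have g1 : cmod (g s - g t) <= A * `|s - t|.
  rewrite -[g s - g t](subrK (v * (s - t)%:C)); apply: le_trans (cmodD _ _) _.
  rewrite cmodM cmodR /A mulrDl mul1r addrC lerD2l; apply: le_trans (H2 s s2) _.
  by rewrite ler_piMl// ge_min lexx.
have g2 : cmod (g s - g t) < h1.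
  by apply: le_lt_trans g1 _; rewrite mulrC -ltr_pdivlMr.
have -> : f (g s) - f (g t) - d * v * (s - t)%:C =
   (f (g s) - f (g t) - d * (g s - g t)) + d * (g s - g t - v * (s - t)%:C).
  by rewrite [X in _ = _ + X]mulrBr addrA subrK mulrA.
apply: le_trans (cmodD _ _) _; rewrite cmodM (splitr e) mulrDl; apply: lerD.
  apply: le_trans (H1 _ g2) _; rewrite /e1 -mulrA ler_pM2l ?divr_gt0// mulrC ler_pdivrMr//.
  by rewrite mulrC.
apply: (@le_trans _ _ (B * (e2 * `|s - t|))).
  apply: ler_pM; rewrite ?cmod_ge0//; last exact: H2.
  by rewrite lerDl.
rewrite mulrA ler_wpM2r// mulrC -ler_pdivlMr// ge_min lexx orbT//.
Qed.

Lemma is_derive_ccomp f g z d v : is_derive z 1 g v ->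
  is_derive (g z) 1 f d -> is_derive z 1 (fun w => f (g w)) (d * v).
Proof.
move=> /is_derive_cmodP dg /is_derive_cmodP df; apply/is_derive_cmodP => e e0.
set A := cmod v + 1; set B := cmod d + 1.
have A0 : 0 < A by rewrite ltr_wpDl ?cmod_ge0.
have B0 : 0 < B by rewrite ltr_wpDl ?cmod_ge0.
pose e1 := e / 2 / A; have e10 : 0 < e1 by rewrite !divr_gt0.
pose e2 := Num.min 1 (e / 2 / B); have e20 : 0 < e2 by rewrite lt_min ltr01 !divr_gt0.
have [h1 [h10 H1]] := df _ e10; have [h2 [h20 H2]] := dg _ e20.
exists (Num.min h2 (h1 / A)); split; first by rewrite lt_min h20 divr_gt0.
move=> s; rewrite lt_min => /andP[s2 s1].
have g1 : cmod (g s - g z) <= A * cmod (s - z).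
  rewrite -[g s - g z](subrK (v * (s - z))); apply: le_trans (cmodD _ _) _.
  rewrite cmodM /A mulrDl mul1r addrC lerD2l; apply: le_trans (H2 s s2) _.
  by rewrite ler_piMl ?cmod_ge0// ge_min lexx.
have g2 : cmod (g s - g z) < h1.
  by apply: le_lt_trans g1 _; rewrite mulrC -ltr_pdivlMr.
have -> : f (g s) - f (g z) - d * v * (s - z) =
   (f (g s) - f (g z) - d * (g s - g z)) + d * (g s - g z - v * (s - z)).
  by rewrite [X in _ = _ + X]mulrBr addrA subrK mulrA.
apply: le_trans (cmodD _ _) _; rewrite cmodM (splitr e) mulrDl; apply: lerD.
  apply: le_trans (H1 _ g2) _; rewrite /e1 -mulrA ler_pM2l ?divr_gt0// mulrC ler_pdivrMr//.
  by rewrite mulrC.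
apply: (@le_trans _ _ (B * (e2 * cmod (s - z)))).
  apply: ler_pM; rewrite ?cmod_ge0//; last exact: H2.
  by rewrite lerDl.
by rewrite mulrA ler_wpM2r ?cmod_ge0// mulrC -ler_pdivlMr// ge_min lexx orbT.
Qed.

Lemma cderive_circle r t : cderive (circle_pt r) t ('i%C * circle_pt r t).
Proof.
apply: cderiveP => /=; last first.
  have -> : 0 * (r * sin t) + 1 * (r * cos t) = r *: cos t by rewrite mul0r mul1r add0r.
  exact: is_deriveZ.
have -> : 0 * (r * cos t) - 1 * (r * sin t) = r *: - sin t.
  by rewrite mul0r mul1r add0r scalerN.
exact: is_deriveZ.
Qed.

Lemma cderive_radius r t : cderive (fun s => circle_pt s t) r (circle_pt 1 t).
Proof.
apply: cderiveP => /=; apply/is_derive_normP => e e0; exists 1; split=> // s _;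
  by rewrite mul1r -mulrBl mulrC subrr normr0 mulr_ge0// ltW.
Qed.

Lemma cderive_segment z v t : cderive (fun s => z + v * s%:C) t v.
Proof.
move=> e e0; exists 1; split=> // s _.
rewrite (_ : _ - _ = 0) ?cmod0; first by rewrite mulr_ge0// ltW.
by apply: complex_eq; rewrite !(ReB, ReD, ReM, ImB, ImD, ImM)/=; ring.
Qed.

Definition cexp z : R[i]^o := circle_pt (expR (complex.Re z)) (complex.Im z).

Lemma cexpD z w : cexp (z + w) = cexp z * cexp w.
Proof.
rewrite /cexp ReD ImD expRD; apply: complex_eq; rewrite ?ReM ?ImM /= ?cosD ?sinD; ring.
Qed.

(** By the functional equation the derivative of [cexp] anywhere reduces to its behaviour at 0;
    these are the real estimates needed there, on a common radius. *)
Lemma expR_near0 e : 0 < e -> exists h : R, 0 < h /\ forall x, `|x| < h ->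
  [/\ `|expR x - 1 - x| <= e * `|x|, `|cos x - 1| <= e * `|x|,
      `|sin x - x| <= e * `|x|, expR x <= 2 & `|expR x - 1| <= e].
Proof.
move=> e0.
have /is_derive_normP/(_ _ e0)[h1 [h10 H1]] := @is_derive_expR R 0.
have /is_derive_normP/(_ _ e0)[h2 [h20 H2]] := @is_derive_cos R 0.
have /is_derive_normP/(_ _ e0)[h3 [h30 H3]] := @is_derive_sin R 0.
have e1 : 0 < Num.min e 1 by rewrite lt_min e0 ltr01.
have /cvgrPdist_lt/(_ _ e1)/nbhs_normP[h4 /= h40 H4] := @continuous_expR R 0.
exists (Num.min (Num.min h1 h2) (Num.min h3 h4)).
split; first by rewrite !lt_min h10 h20 h30.
move=> x; rewrite !lt_min => /andP[/andP[x1 x2] /andP[x3 x4]]; split.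
- by have := H1 x; rewrite subr0 expR0 mul1r; exact.
- by have := H2 x; rewrite subr0 cos0 sin0 oppr0 mul0r subr0; exact.
- by have := H3 x; rewrite subr0 sin0 cos0 mul1r subr0; exact.
- have := H4 x; rewrite /= sub0r normrN expR0 => /(_ x4).
  by rewrite lt_min => /andP[_]; rewrite ltr_norml => /andP[]; lra.
- have := H4 x; rewrite /= sub0r normrN expR0 => /(_ x4).
  by rewrite lt_min distrC => /andP[/ltW].
Qed.

Lemma is_derive_cexp z : is_derive z 1 cexp (cexp z).
Proof.
apply/is_derive_cmodP => e e0.
set A := cmod (cexp z) + 1.
have A0 : 0 < A by rewrite ltr_wpDl ?cmod_ge0.
(* With [c = e / A / 6] and [m = cmod u], the real and the imaginary part of [cexp u - 1 - u] are
   each at most [2 c m + c m]; hence the 6. *)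
have e1 : 0 < e / A / 6 by rewrite !divr_gt0.
have [h [h0 H]] := expR_near0 e1; exists h; split=> // w wh.
set u : R[i]^o := w - z; rewrite -/u in wh.
have -> : cexp w - cexp z - cexp z * u = cexp z * (cexp u - 1 - u).
  have -> : cexp w = cexp z * cexp u by rewrite -cexpD /u addrC subrK.
  by rewrite !mulrBr mulr1.
clearbody u.
have ux : `|complex.Re u| <= cmod u := Re_le_cmod u.
have uy : `|complex.Im u| <= cmod u := Im_le_cmod u.
have [a1 _ _ a2 a3] := H _ (le_lt_trans ux wh).
have [_ b1 b2 _ _] := H _ (le_lt_trans uy wh).
rewrite cmodM; apply: (@le_trans _ _ (A * (e / A * cmod u))); last first.
  by rewrite mulrA [A * _]mulrC divfK// gt_eqF.
apply: ler_pM; rewrite ?cmod_ge0//; first by rewrite lerDl.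
set c := e / A / 6 in e1 a1 a3 b1 b2 *.
have -> : e / A = 6 * c by rewrite /c; field; rewrite gt_eqF.
apply: le_trans (cmod_le_ReIm _) _; rewrite !ReB !ImB /=.
set x := complex.Re u in ux a1 a2 a3 *; set y := complex.Im u in uy b1 b2 *.
set m := cmod u in ux uy *; have m0 : 0 <= m := cmod_ge0 u.
have -> : expR x * cos y - 1 - x = expR x * (cos y - 1) + (expR x - 1 - x) by ring.
have -> : expR x * sin y - 0 - y = expR x * (sin y - y) + (expR x - 1) * y by ring.
have p1 : `|expR x * (cos y - 1)| <= 2 * (c * m).
  rewrite normrM ger0_norm ?expR_ge0//; apply: ler_pM; rewrite ?expR_ge0//.
  by apply: le_trans b1 _; rewrite ler_pM2l.
have p2 : `|expR x * (sin y - y)| <= 2 * (c * m).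
  rewrite normrM ger0_norm ?expR_ge0//; apply: ler_pM; rewrite ?expR_ge0//.
  by apply: le_trans b2 _; rewrite ler_pM2l.
have p3 : `|expR x - 1 - x| <= c * m by apply: le_trans a1 _; rewrite ler_pM2l.
have p4 : `|(expR x - 1) * y| <= c * m by rewrite normrM; apply: ler_pM.
have -> : 6 * c * m = (2 * (c * m) + c * m) + (2 * (c * m) + c * m) by ring.
by apply: lerD; apply: le_trans (ler_normD _ _) _; apply: lerD.
Qed.

End Derivatives.

(** * Cauchy's formula *)

Section CircleMean.
Variable R : realType.
Implicit Types (r s t e M : R) (z w d : R[i]^o) (f g F G : R[i]^o -> R[i]^o)
  (u v : R[i]^o -> R).

(** Continuity along the parametrised circle only: a function with junk values off the circle still
    qualifies. *)
Definition oncirc (T : topologicalType) (u : R[i]^o -> T) r :=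
  continuous (fun t : R => u (circle_pt r t)).

Definition avg u r : R := (2 * pi)^-1 * itg 0 (2 * pi) (fun t => u (circle_pt r t)).

(** As [dw = i w dt], this is the contour integral of [F w / w] divided by 2 pi i. Cauchy's kernel
    therefore appears below as [w / (w - z)]. *)
Definition cavg F r : R[i]^o :=
  ((2 * pi)^-1)%:C * citg 0 (2 * pi) (fun t => F (circle_pt r t)).

Lemma pi2_gt0 : 0 < 2 * pi :> R. Proof. by rewrite mulr_gt0// pi_gt0. Qed.

Lemma pi2_ge0 : 0 <= 2 * pi :> R. Proof. exact/ltW/pi2_gt0. Qed.

Lemma oncirc_within (T : topologicalType) (u : R[i]^o -> T) r : oncirc u r ->
  {within `[0, 2 * pi], continuous (fun t => u (circle_pt r t))}.
Proof. by move=> cu; apply: continuous_subspaceT. Qed.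

Lemma oncirc_for (T : topologicalType) (u : R[i]^o -> T) r : 0 <= r ->
  (forall w, cmod w = r -> {for w, continuous u}) -> oncirc u r.
Proof.
move=> r0 cu t; apply: continuous_comp; first exact: continuous_circle.
by apply: cu; rewrite cmod_circle.
Qed.

Lemma oncirc_comp (T U : topologicalType) (u : R[i]^o -> T) (h : T -> U) r :
  oncirc u r -> (forall w, cmod w = r -> {for u w, continuous h}) -> 0 <= r ->
  oncirc (fun w => h (u w)) r.
Proof.
move=> cu ch r0 t; apply: (@continuous_comp _ _ _ (fun t : R => u (circle_pt r t)) h).
  exact: cu.
by apply: ch; rewrite cmod_circle.
Qed.

Lemma oncirc_cmod F r : oncirc F r -> oncirc (fun w => cmod (F w)) r.
Proof.
move=> cF t; apply: (@continuous_comp _ _ _ (fun t : R => F (circle_pt r t)) (@cmod R)).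
  exact: cF.
exact: continuous_cmod.
Qed.

Lemma oncircD u v r : oncirc u r -> oncirc v r -> oncirc (fun w => u w + v w) r.
Proof. by move=> cu cv t; apply: cvgD; [exact: cu|exact: cv]. Qed.

Lemma oncircM u v r : oncirc u r -> oncirc v r -> oncirc (fun w => u w * v w) r.
Proof. by move=> cu cv t; apply: cvgM; [exact: cu|exact: cv]. Qed.

Lemma oncirc_cst (T : topologicalType) (c : T) r : oncirc (fun=> c) r.
Proof. by move=> t; exact: cvg_cst. Qed.

Lemma oncircN u r : oncirc u r -> oncirc (fun w => - u w) r.
Proof. by move=> cu t; apply: cvgN; exact: cu. Qed.

Lemma avgD u v r : oncirc u r -> oncirc v r ->
  avg (fun w => u w + v w) r = avg u r + avg v r.
Proof. by move=> cu cv; rewrite /avg -mulrDr -(itgD (oncirc_within cu) (oncirc_within cv)). Qed.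

Lemma avgB u v r : oncirc u r -> oncirc v r ->
  avg (fun w => u w - v w) r = avg u r - avg v r.
Proof. by move=> cu cv; rewrite /avg -mulrBr -(itgB (oncirc_within cu) (oncirc_within cv)). Qed.

Lemma avgZ c u r : oncirc u r -> avg (fun w => c * u w) r = c * avg u r.
Proof. by move=> cu; rewrite /avg mulrCA -(itgZ c (oncirc_within cu)). Qed.

Lemma avg_cst c r : avg (fun=> c) r = c.
Proof.
by rewrite /avg itg_cst ?pi2_ge0// subr0 mulrC mulfK// gt_eqF ?pi2_gt0.
Qed.

Lemma eq_avg u v r : 0 <= r -> (forall w, cmod w = r -> u w = v w) ->
  avg u r = avg v r.
Proof.
by move=> r0 uv; rewrite /avg; congr (_ * _); apply: eq_itg => t _; rewrite uv// cmod_circle.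
Qed.

Lemma avg_le u v r : 0 <= r -> oncirc u r -> oncirc v r ->
  (forall w, cmod w = r -> u w <= v w) -> avg u r <= avg v r.
Proof.
move=> r0 cu cv uv; rewrite ler_pM2l ?invr_gt0 ?pi2_gt0//.
apply: (itg_le (oncirc_within cu) (oncirc_within cv)) => t _.
by rewrite uv// cmod_circle.
Qed.

Lemma avg_ge0 u r : 0 <= r -> oncirc u r -> (forall w, cmod w = r -> 0 <= u w) ->
  0 <= avg u r.
Proof. by move=> r0 cu u0; rewrite -{1}(avg_cst 0 r); apply: avg_le => //; exact: oncirc_cst. Qed.

Lemma avg_sum (I : Type) (s : seq I) (u : I -> R[i]^o -> R) r :
  (forall i, oncirc (u i) r) ->
  oncirc (fun w => \sum_(i <- s) u i w) r /\
  avg (fun w => \sum_(i <- s) u i w) r = \sum_(i <- s) avg (u i) r.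
Proof.
move=> cu; elim: s => [|i s [IH1 IH2]].
  have E : (fun w : R[i]^o => \sum_(i <- [::]) u i w) = fun=> 0.
    by apply/funext => w; rewrite big_nil.
  by rewrite big_nil E avg_cst; split => //; exact: oncirc_cst.
have E : (fun w : R[i]^o => \sum_(j <- i :: s) u j w) =
    fun w => u i w + \sum_(j <- s) u j w.
  by apply/funext => w; rewrite big_cons.
by rewrite E big_cons avgD// IH2; split=> //; exact: oncircD.
Qed.

Lemma oncirc_cplxD F G r : oncirc F r -> oncirc G r -> oncirc (fun w => F w + G w) r.
Proof. by move=> cF cG t; exact: (cvgD (cF t) (cG t)). Qed.

Lemma oncirc_cplxM F G r : oncirc F r -> oncirc G r -> oncirc (fun w => F w * G w) r.
Proof. by move=> cF cG t; exact: (cvgM (cF t) (cG t)). Qed.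

Lemma oncirc_cplxN F r : oncirc F r -> oncirc (fun w => - F w) r.
Proof. by move=> cF t; exact: (cvgN (cF t)). Qed.

Lemma oncirc_cplxV F r : 0 <= r -> oncirc F r -> (forall w, cmod w = r -> F w != 0) ->
  oncirc (fun w => (F w)^-1) r.
Proof.
move=> r0 cF F0 t; have F0t : F (circle_pt r t) != 0 by rewrite F0// cmod_circle.
exact: (cvgV F0t (cF t)).
Qed.

Lemma oncirc_id r : oncirc (fun w => w) r.
Proof. exact: continuous_circle. Qed.

Lemma oncirc_conj F r : oncirc F r -> oncirc (fun w => conjc (F w : R[i]) : R[i]^o) r.
Proof.
move=> cF t; apply: curve_contP.
  have -> : (fun s : R => complex.Re (conjc (F (circle_pt r s) : R[i]))) =
     fun s => complex.Re (F (circle_pt r s)).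
    by apply/funext => s; case: (F _).
  apply: (@continuous_comp _ _ _ (fun t : R => F (circle_pt r t)) (@complex.Re R)).
    exact: cF.
  exact: continuous_Re.
have -> : (fun s : R => complex.Im (conjc (F (circle_pt r s) : R[i]))) =
   fun s => - complex.Im (F (circle_pt r s)).
  by apply/funext => s; case: (F _).
apply: cvgN; apply: (@continuous_comp _ _ _ (fun t : R => F (circle_pt r t)) (@complex.Im R)).
  exact: cF.
exact: continuous_Im.
Qed.

Lemma cavgD F G r : oncirc F r -> oncirc G r ->
  cavg (fun w => F w + G w) r = cavg F r + cavg G r.
Proof.
move=> cF cG; rewrite /cavg -mulrDr; congr (_ * _).
exact: (citgD (oncirc_within cF) (oncirc_within cG)).
Qed.

Lemma cavgB F G r : oncirc F r -> oncirc G r ->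
  cavg (fun w => F w - G w) r = cavg F r - cavg G r.
Proof.
move=> cF cG; rewrite /cavg -mulrBr; congr (_ * _).
exact: (citgB (oncirc_within cF) (oncirc_within cG)).
Qed.

Lemma cavgZ (k : R[i]^o) F r : oncirc F r -> cavg (fun w => k * F w) r = k * cavg F r.
Proof.
move=> cF; rewrite /cavg mulrCA; congr (_ * _).
exact: (citgZ k (oncirc_within cF)).
Qed.

Lemma cavg_cst (k : R[i]^o) r : cavg (fun=> k) r = k.
Proof.
rewrite /cavg citg_cst ?pi2_ge0// subr0 mulrCA -rmorphM mulVf ?mulr1//.
by rewrite gt_eqF// pi2_gt0.
Qed.

Lemma eq_cavg F G r : 0 <= r -> (forall w, cmod w = r -> F w = G w) ->
  cavg F r = cavg G r.
Proof.
by move=> r0 FG; rewrite /cavg; congr (_ * _); apply: eq_citg => t _; rewrite FG// cmod_circle.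
Qed.

Lemma cavg_conj F r : oncirc F r ->
  cavg (fun w => conjc (F w : R[i])) r = conjc (cavg F r : R[i]).
Proof.
move=> cF; rewrite /cavg rmorphM /= oppr0; congr (_ * _).
have cI := within_Im (oncirc_within cF).
apply: complex_eq => /=; first by apply: eq_itg => t _; case: (F _).
rewrite -mulN1r -(itgZ (-1) cI).
by apply: eq_itg => t _; case: (F _) => a b /=; rewrite mulN1r.
Qed.

Lemma cavg_Re F r : complex.Re (cavg F r) = avg (fun w => complex.Re (F w)) r.
Proof. by rewrite /cavg ReM /= mul0r subr0. Qed.

Lemma cavg_le F r : oncirc F r -> cmod (cavg F r) <= 2 * avg (fun w => cmod (F w)) r.
Proof.
move=> cF; rewrite /cavg cmodM cmodR ger0_norm ?invr_ge0 ?pi2_ge0//.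
rewrite /avg mulrCA ler_pM2l ?invr_gt0 ?pi2_gt0//.
exact: (citg_le_cmod pi2_ge0 (oncirc_within cF)).
Qed.

End CircleMean.

Section MeanValue.
Variable R : realType.
Implicit Types (r s t e M rho : R) (z w d : R[i]^o) (f g F G : R[i]^o -> R[i]^o).

Lemma circle_pt_2pi r : circle_pt r (2 * pi) = circle_pt r 0.
Proof.
by rewrite /circle_pt mulr_natl cos2pi sin2pi cos0 sin0.
Qed.

Lemma cexp_polar r t : 0 < r -> cexp (ln r +i* t) = circle_pt r t.
Proof. by move=> r0; rewrite /cexp /= lnK. Qed.

(* Goursat in the logarithmic coordinate [w = exp (s + i t)]: the horizontal
   sides of the rectangle cancel by periodicity. *)
Lemma cavg_annulus F r1 r2 : 0 < r1 -> r1 <= r2 ->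
  (forall w, r1 <= cmod w <= r2 -> exists d, is_derive w 1 F d) ->
  cavg F r1 = cavg F r2.
Proof.
move=> r10 r12 dF; have r20 := lt_le_trans r10 r12.
pose h z := F (cexp z).
have ln12 : 0 <= ln r2 - ln r1 by rewrite subr_ge0 ler_ln// posrE.
have := @goursat R h (ln r1) 0 (ln r2 - ln r1) (2 * pi) ln12 (pi2_ge0 R).
have lnE : ln r1 + (ln r2 - ln r1) = ln r2 by rewrite addrC subrK.
rewrite /rect_int !add0r lnE => H.
have {H}H : 'i%C * (citg 0 (2 * pi) (fun t : R => h (ln r2 +i* t)) -
    citg 0 (2 * pi) (fun t : R => h (ln r1 +i* t))) = 0 :> R[i]^o.
  have {}H := H _; rewrite -[RHS]H; last first.
    move=> s t /andP[s1 s2] _.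
    have E : cmod (cexp (s +i* t)) = expR s by rewrite /cexp cmod_circle// expR_ge0.
    have [|d Hd] := dF (cexp (s +i* t)).
      by rewrite E -[leLHS]lnK ?posrE// ler_expR s1/= -[leRHS]lnK ?posrE// ler_expR
         s2.
    by exists (d * cexp (s +i* t)); apply: is_derive_ccomp Hd; exact: is_derive_cexp.
  have -> : citg (ln r1) (ln r2) (fun s => h (s +i* (2 * pi))) =
      citg (ln r1) (ln r2) (fun s => h (s +i* 0)).
    by apply: eq_citg => s _; rewrite /h /cexp /= circle_pt_2pi.
  by rewrite subrr add0r.
move/eqP: H; rewrite mulf_eq0 => /orP[|].
  by rewrite eq_complex /= oner_eq0 andbF.
rewrite subr_eq0 => /eqP H; rewrite /cavg; congr (_ * _).
transitivity (citg 0 (2 * pi) (fun t : R => h (ln r1 +i* t))).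
  by apply: eq_citg => t _; rewrite /h cexp_polar.
by rewrite -H; apply: eq_citg => t _; rewrite /h cexp_polar.
Qed.

Lemma cmod_circleB r r' t : cmod (circle_pt r t - circle_pt r' t) = `|r - r'|.
Proof.
have -> : circle_pt r t - circle_pt r' t = circle_pt (r - r') t.
  by apply: complex_eq; rewrite ?ReB ?ImB /=; ring.
by rewrite cmodE /= !exprMn -mulrDr cos2Dsin2 mulr1 sqrtr_sqr.
Qed.

(** Continuity is assumed at the points of the circle itself and nowhere else; bisection of the
    angle makes it uniform. *)
Lemma circle_uniform F r0 e : 0 <= r0 -> 0 < e ->
  (forall w, cmod w = r0 -> {for w, continuous F}) ->
  exists h : R, 0 < h /\ forall r, `|r - r0| < h -> forall t, 0 <= t <= 2 * pi ->
    cmod (F (circle_pt r t) - F (circle_pt r0 t)) <= e.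
Proof.
move=> r00 e0 cF.
pose P x n := exists h : R, 0 < h /\ forall r, `|r - r0| < h -> forall t,
  x <= t <= x + 2 * pi / 2 ^+ n -> cmod (F (circle_pt r t) - F (circle_pt r0 t)) <= e.
suff : P 0 0%N.
  by move=> [h [h0 H]]; exists h; split=> // r rh t ht; apply: H => //; rewrite expr0 divr1 add0r.
apply: (@bisection1 _ P 0 (2 * pi) (pi2_ge0 R)).
  move=> x n _ _ [h1 [h10 H1]] [h2 [h20 H2]].
  exists (Num.min h1 h2); split; first by rewrite lt_min h10.
  move=> r; rewrite lt_min => /andP[rh1 rh2] t /andP[t1 t2].
  have [tm|tm] := leP t (x + 2 * pi / 2 ^+ n.+1).
    by apply: H1 => //; rewrite t1.
  by apply: H2 => //; rewrite (ltW tm)/= -addrA -half_powS.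
move=> p _.
have e2 : 0 < e / 2 by rewrite divr_gt0.
have /ccontP/(_ _ e2)[h1 [h10 H1]] := cF _ (cmod_circle p r00).
have h12 : 0 < h1 / 2 by rewrite divr_gt0.
have : \forall t \near p, cmod (circle_pt r0 t - circle_pt r0 p) < h1 / 2.
  by have := @continuous_circle R r0 p; rewrite /continuous_at => /cvg_cmodP; exact.
move=> /nbhs_normP[h2 /= h20 H2].
have [N HN] := archi_half (2 * pi) h20.
exists N => n x Nn _ _ px; exists (h1 / 2); split => // r rr t tx.
have tp : `|t - p| < h2 by apply: le_lt_trans (HN n Nn); exact: (le_itv_dist px).
have {}H2 := H2 t _; rewrite /= distrC in H2; have {}H2 := H2 tp.
have n1 : cmod (F (circle_pt r0 t) - F (circle_pt r0 p)) < e / 2.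
  by apply: H1; apply: lt_trans H2 _; rewrite ltr_pdivrMr// ltr_pMr// ltr1n.
have n2 : cmod (F (circle_pt r t) - F (circle_pt r0 p)) < e / 2.
  apply: H1; apply: le_lt_trans (cmodDB _ (circle_pt r0 t) _) _.
  by rewrite cmod_circleB (splitr h1) ltrD.
apply: le_trans (cmodDB _ (F (circle_pt r0 p)) _) _; apply: ltW.
by rewrite (splitr e) ltrD// cmodB.
Qed.

(** Carries a constant mean across a radius that the annulus argument cannot reach: the radius 0,
    the modulus of an exceptional point, or the boundary of the disc. *)
Lemma cavg_limit F r0 (c : R[i]^o) : 0 <= r0 ->
  (forall w, cmod w = r0 -> {for w, continuous F}) ->
  (forall h : R, 0 < h -> exists r, [/\ 0 <= r, `|r - r0| < h, oncirc F r & cavg F r = c]) ->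
  cavg F r0 = c.
Proof.
move=> r00 cF H; apply/eqP; rewrite -subr_eq0 -cmod_eq0 eq_le cmod_ge0 andbT.
apply/ler_addgt0Pr => e e0; rewrite add0r.
have e4 : 0 < e / 4 by rewrite divr_gt0.
have [h [h0 Hh]] := circle_uniform r00 e4 cF.
have [r [r_ge0 rh cFr <-]] := H h h0.
have cFr0 := oncirc_for r00 cF.
rewrite /cavg -mulrBr -(citgB (oncirc_within cFr0) (oncirc_within cFr)).
rewrite cmodM cmodR ger0_norm ?invr_ge0 ?pi2_ge0//.
rewrite mulrC ler_pdivrMr ?pi2_gt0//.
have -> : e * (2 * pi) = 2 * (e / 2) * (2 * pi - 0) by field.
apply: citg_bound; first exact: pi2_ge0.
  by apply: continuous_subspaceT => t; exact: (cvgB (cFr0 t) (cFr t)).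
move=> t ht; rewrite cmodB; apply: le_trans (Hh r rh t ht) _.
by rewrite ler_pM2l// lef_pV2 ?posrE// ler_nat.
Qed.

Lemma mean_value F z0 rho : 0 <= rho ->
  (forall w, cmod w <= rho -> {for w, continuous F}) ->
  (forall w, cmod w <= rho -> w != z0 -> exists d, is_derive w 1 F d) ->
  cavg F rho = F 0.
Proof.
move=> rho0 cF dF.
have cFr r : 0 <= r <= rho -> forall w, cmod w = r -> {for w, continuous F}.
  by move=> /andP[_ rr] w wr; apply: cF; rewrite wr.
have oF r : 0 <= r <= rho -> oncirc F r.
  by move=> hr; apply: oncirc_for; [case/andP: hr|exact: cFr].
have F0 : cavg F 0 = F 0.
  rewrite -[RHS](cavg_cst _ 0); apply: eq_cavg => // w /eqP; rewrite cmod_eq0 => /eqP ->//.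
have small r : 0 <= r <= rho -> (r < cmod z0) || (rho < cmod z0) -> cavg F r = F 0.
  move=> /andP[r0 rr] rz; have [->//|rn0] := eqVneq r 0.
  have rp : 0 < r by rewrite lt_neqAle eq_sym rn0.
  rewrite -F0; apply/esym; apply: cavg_limit => //.
    by apply: cFr; rewrite lexx.
  move=> h h0; pose r1 := Num.min (h / 2) r.
  have r10 : 0 < r1 by rewrite lt_min rp divr_gt0.
  have r1r : r1 <= r by rewrite ge_min lexx orbT.
  exists r1; split; first exact: ltW.
  - rewrite subr0 ger0_norm ?ltW//; apply: (@le_lt_trans _ _ (h / 2)).
      by rewrite ge_min lexx.
    by rewrite ltr_pdivrMr// ltr_pMr// ltr1n.
  - by apply: oF; rewrite (ltW r10) (le_trans r1r).
  apply: cavg_annulus => // w /andP[w1 w2]; apply: dF; first exact: le_trans rr.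
  apply: contraTneq rz => wz; rewrite negb_or -!leNgt -wz w2/=.
  exact: le_trans w2 rr.
have [zr|rz] := leP (cmod z0) rho; last by apply: small; rewrite ?rho0 ?lexx ?rz ?orbT.
have zz : 0 <= cmod z0 <= rho by rewrite cmod_ge0.
have Fz : cavg F (cmod z0) = F 0.
  have [->//|zn0] := eqVneq (cmod z0) 0.
  have zp : 0 < cmod z0 by rewrite lt_neqAle eq_sym zn0 cmod_ge0.
  apply: cavg_limit; [exact: cmod_ge0|exact: cFr|move=> h h0].
  pose r1 := Num.max 0 (cmod z0 - h / 2).
  have h2 : 0 < h / 2 by rewrite divr_gt0.
  have h21 : h / 2 < h by rewrite ltr_pdivrMr// ltr_pMr// ltr1n.
  have r1z : r1 < cmod z0 by rewrite gt_max zp ltrBlDr ltrDl.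
  have r10 : 0 <= r1 by rewrite le_max lexx.
  have r1r : 0 <= r1 <= rho by rewrite r10 (le_trans (ltW r1z)).
  exists r1; split => //.
  - rewrite distrC ger0_norm ?subr_ge0 ?(ltW r1z)//; apply: le_lt_trans h21.
    by rewrite lerBlDl -lerBlDr le_max lexx orbT.
  - exact: oF.
  - by apply: small; rewrite ?r1z.
have [->//|rzn] := eqVneq rho (cmod z0).
have zr1 : cmod z0 < rho by rewrite lt_neqAle eq_sym rzn.
rewrite -Fz; apply/esym; apply: cavg_limit; [exact: cmod_ge0|exact: cFr|move=> h h0].
pose r1 := Num.min rho (cmod z0 + h / 2).
have h2 : 0 < h / 2 by rewrite divr_gt0.
have h21 : h / 2 < h by rewrite ltr_pdivrMr// ltr_pMr// ltr1n.
have r1z : cmod z0 < r1 by rewrite lt_min zr1 ltrDl.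
have r10 : 0 <= r1 by apply: le_trans (ltW r1z); exact: cmod_ge0.
have r1r : 0 <= r1 <= rho by rewrite r10 ge_min lexx.
exists r1; split => //.
- rewrite ger0_norm ?subr_ge0 ?(ltW r1z)//; apply: le_lt_trans h21.
  by rewrite lerBlDl ge_min lexx orbT.
- exact: oF.
- apply: cavg_annulus; [by apply: le_lt_trans r1z; exact: cmod_ge0|by case/andP: r1r|].
  move=> w /andP[w1 w2]; apply: dF => //.
  by apply: contraTneq w1 => ->; rewrite -ltNge.
Qed.

End MeanValue.

Section Cauchy.
Variable R : realType.
Implicit Types (r s t e M rho : R) (z w d : R[i]^o) (f g F G phi : R[i]^o -> R[i]^o).

Lemma is_derive_idc z : is_derive z 1 (fun w : R[i]^o => w) (1 : R[i]^o).
Proof. exact: is_derive_id. Qed.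

Lemma is_derive_cstc (k z : R[i]^o) : is_derive z 1 (fun w : R[i]^o => k) (0 : R[i]^o).
Proof. exact: is_derive_cst. Qed.

Lemma is_derive_addc f g z d (e : R[i]^o) : is_derive z 1 f d -> is_derive z 1 g e ->
  is_derive z 1 (fun w => f w + g w) (d + e : R[i]^o).
Proof. by move=> df dg; exact: is_deriveD. Qed.

Lemma is_derive_oppc f z d : is_derive z 1 f d ->
  is_derive z 1 (fun w => - f w) (- d : R[i]^o).
Proof. by move=> df; exact: is_deriveN. Qed.

Lemma is_derive_subc f g z d (e : R[i]^o) : is_derive z 1 f d -> is_derive z 1 g e ->
  is_derive z 1 (fun w => f w - g w) (d - e : R[i]^o).
Proof. by move=> df dg; exact: is_deriveB. Qed.

Lemma is_derive_mulc f g z d (e : R[i]^o) : is_derive z 1 f d -> is_derive z 1 g e ->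
  is_derive z 1 (fun w => f w * g w) (f z * e + g z * d : R[i]^o).
Proof.
move=> df dg.
have := @is_deriveM (R[i]) (R[i]^o) f g z 1 d e df dg; rewrite /GRing.scale/=.
exact.
Qed.

Lemma is_derive_invc f z d : is_derive z 1 f d -> f z != 0 ->
  is_derive z 1 (fun w => (f w)^-1) (- d / (f z) ^+ 2 : R[i]^o).
Proof.
move=> [df <-] fz; split; first exact: derivableV.
by rewrite (deriveV fz df) /GRing.scale/= mulNr mulrC mulNr.
Qed.

Definition holo_on f rho := forall w, cmod w <= rho -> exists d, is_derive w 1 f d.

Lemma holo_on_for f rho w : holo_on f rho -> cmod w <= rho -> {for w, continuous f}.
Proof. by move=> hf /hf[d]; exact: holo_continuous. Qed.

Lemma holo_on_oncirc f rho r : holo_on f rho -> 0 <= r <= rho -> oncirc f r.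
Proof.
move=> hf /andP[r0 rr]; apply: oncirc_for => // w wr; apply: (holo_on_for hf).
by rewrite wr.
Qed.

Lemma oncirc_sub r z : oncirc (fun w => w - z) r.
Proof.
by move=> t; apply: (cvgB (@continuous_circle R r t)); exact: cvg_cst.
Qed.

Lemma oncirc_scale (k : R[i]^o) F r : oncirc F r -> oncirc (fun w => k * F w) r.
Proof. by move=> cF; exact: (oncirc_cplxM (@oncirc_cst _ _ k r) cF). Qed.

Lemma oncirc_exp n F r : oncirc F r -> oncirc (fun w => F w ^+ n) r.
Proof.
move=> cF; elim: n => [|n IH]; first exact: oncirc_cst.
have -> : (fun w : R[i]^o => F w ^+ n.+1) = fun w => F w * F w ^+ n.
  by apply/funext => w; rewrite exprS.
exact: (oncirc_cplxM cF IH).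
Qed.

Lemma sub_neq0 w z rho : cmod w = rho -> cmod z < rho -> w - z != 0.
Proof. by move=> wr zr; rewrite subr_eq0; apply: contraTneq zr => <-; rewrite wr ltxx. Qed.

Lemma circle_conj w rho : 0 < rho -> cmod w = rho ->
  conjc (w : R[i]) = (rho ^+ 2)%:C / w :> R[i]^o.
Proof.
move=> r0 wr; have w0 : w != 0 by rewrite -cmod_gt0 wr.
have -> : (rho ^+ 2)%:C = w * (conjc (w : R[i]) : R[i]^o) by rewrite -sqr_cmod wr.
by rewrite mulrAC mulfV// mul1r.
Qed.

Lemma reflect_neq0 (z w : R[i]^o) rho : cmod w <= rho -> cmod z < rho ->
  (rho ^+ 2)%:C - (conjc (z : R[i]) : R[i]^o) * w != 0.
Proof.
move=> wr zr; rewrite subr_eq0; apply/eqP => E.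
have := congr1 (@cmod R) E; rewrite cmodM cmodJ cmodR.
have r0 : 0 < rho by apply: le_lt_trans zr; exact: cmod_ge0.
rewrite ger0_norm ?exprn_ge0 ?(ltW r0)// => /eqP; rewrite gt_eqF// expr2.
apply: (@le_lt_trans _ _ (cmod z * rho)); first by rewrite ler_wpM2l ?cmod_ge0.
by rewrite ltr_pM2r.
Qed.

Lemma is_derive_reflect (c : R[i]^o) (z w : R[i]^o) :
  is_derive w 1 (fun w => c - z * w) (- z).
Proof.
have := is_derive_subc (is_derive_cstc c w) (is_derive_mulc (is_derive_cstc z w) (is_derive_idc w)).
by rewrite mulr0 addr0 mulr1 add0r.
Qed.

Lemma conjM z w : conjc (z * w : R[i]) = conjc (z : R[i]) * conjc (w : R[i]) :> R[i]^o.
Proof. exact: (rmorphM (@conjc R)). Qed.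

Lemma conjB z w : conjc (z - w : R[i]) = conjc (z : R[i]) - conjc (w : R[i]) :> R[i]^o.
Proof. exact: (rmorphB (@conjc R)). Qed.

Lemma conjV z : conjc (z^-1 : R[i]) = (conjc (z : R[i]))^-1 :> R[i]^o.
Proof. exact: conjc_inv. Qed.

(* On [|w| = rho] conjugation is the holomorphic map [w |-> rho^2 / w], so the
   conjugate of the mean of a Cauchy kernel is a mean of a function
   holomorphic in the disc. *)
Lemma cavg_kernel z rho : cmod z < rho -> cavg (fun w => w / (w - z)) rho = 1.
Proof.
move=> zr; have r0 : 0 < rho by apply: le_lt_trans zr; exact: cmod_ge0.
have c1 : oncirc (fun w => w / (w - z)) rho.
  apply: oncirc_cplxM; first exact: oncirc_id.
  apply: oncirc_cplxV (ltW r0) (@oncirc_sub rho z) _.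
  by move=> w wr; exact: sub_neq0 zr.
apply: (can_inj (@conjcK R)); rewrite -cavg_conj// conjc1.
pose F w : R[i]^o := (rho ^+ 2)%:C * ((rho ^+ 2)%:C - (conjc (z : R[i]) : R[i]^o) * w)^-1.
have dF : holo_on F rho.
  move=> w wr; have nz := reflect_neq0 wr zr.
  have := is_derive_invc (is_derive_reflect (rho ^+ 2)%:C (conjc (z : R[i])) w) nz.
  move=> /(is_derive_mulc (is_derive_cstc (rho ^+ 2)%:C w)) D.
  by eexists; exact: D.
transitivity (cavg F rho).
  apply: eq_cavg; first exact: ltW.
  move=> w wr; have w0 : w != 0 by rewrite -cmod_gt0 wr.
  rewrite conjM conjV conjB (circle_conj r0 wr) /F.
  have wr' : cmod w <= rho by rewrite wr.
  have nz := reflect_neq0 wr' zr.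
  move: nz; set b : R[i]^o := (rho ^+ 2)%:C; set c : R[i]^o := conjc _ => nz.
  clearbody b c; have -> : b / w - c = (b - c * w) / w by rewrite mulrBl mulfK.
  by rewrite invf_div mulrA mulfVK.
rewrite (@mean_value _ F 0 rho) ?ltW//.
- rewrite /F mulr0 subr0 mulfV//; apply/eqP => /(congr1 (@cmod R)).
  by rewrite cmodR cmod0 => /eqP; rewrite normr_eq0 expf_eq0/= gt_eqF.
- by move=> w wr; exact: holo_on_for dF wr.
- by move=> w wr _; exact: dF.
Qed.

(** The mean value property of [k], the function [w (f w - f z) / (w - z)] continued by [z * d] at
    [z], gives mean [k 0 = 0]; splitting off [f z] times the mean of the kernel leaves the
    formula. *)
Theorem cauchy_formula f z rho : holo_on f rho -> cmod z < rho ->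
  cavg (fun w => f w * w / (w - z)) rho = f z.
Proof.
move=> hf zr; have r0 : 0 < rho by apply: le_lt_trans zr; exact: cmod_ge0.
have [d dfz] := hf z (ltW zr).
pose k w : R[i]^o := if w == z then z * d else w * ((f w - f z) / (w - z)).
have ck : forall w, cmod w <= rho -> w != z -> exists d, is_derive w 1 k d.
  move=> w wr wz; have [e dfw] := hf w wr.
  have nz : w - z != 0 by rewrite subr_eq0.
  have D1 := is_derive_subc dfw (is_derive_cstc (f z) w).
  have D2 := is_derive_invc (is_derive_subc (is_derive_idc w) (is_derive_cstc z w)) nz.
  have D3 := is_derive_mulc (is_derive_idc w) (is_derive_mulc D1 D2).
  eexists; apply: near_eq_is_derive D3.
  apply/near_cmodP; exists (cmod (w - z)); split; first by rewrite cmod_gt0.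
  move=> v vw; rewrite /k; case: eqP => // vz.
  by move: vw; rewrite vz cmodB ltxx.
have kz : {for z, continuous k}.
  apply/ccontP => e e0.
  have e1 : 0 < e / 2 / rho by rewrite !divr_gt0.
  have e2 : 0 < e / 2 / (cmod d + 1) by rewrite !divr_gt0// ltr_wpDl ?cmod_ge0.
  have /is_derive_cmodP/(_ _ e1)[h [h0 H]] := dfz.
  exists (Num.min (Num.min h (rho - cmod z)) (e / 2 / (cmod d + 1))); split.
    by rewrite !lt_min h0 subr_gt0 zr.
  move=> w; rewrite !lt_min => /andP[/andP[w1 w2] w3].
  rewrite /k eqxx; case: eqP => [_|/eqP wz]; first by rewrite subrr cmod0.
  have nz : w - z != 0 by rewrite subr_eq0.
  have wr : cmod w <= rho by have := cmod_sub_ge w z; lra.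
  have -> : w * ((f w - f z) / (w - z)) - z * d =
      w * ((f w - f z - d * (w - z)) / (w - z)) + (w - z) * d by field.
  apply: le_lt_trans (cmodD _ _) _; rewrite (splitr e); apply: ler_ltD.
    rewrite cmodM cmodf; apply: (@le_trans _ _ (rho * (e / 2 / rho))).
      apply: ler_pM; rewrite ?divr_ge0 ?cmod_ge0// ler_pdivrMr ?cmod_gt0//.
      exact: H.
    by rewrite mulrC divfK// gt_eqF.
  rewrite cmodM; apply: (@le_lt_trans _ _ (cmod (w - z) * (cmod d + 1))).
    by rewrite ler_wpM2l ?cmod_ge0// lerDl.
  by rewrite -ltr_pdivlMr// ltr_wpDl ?cmod_ge0.
have k0 : k 0 = 0 by rewrite /k; case: eqP => [<-|_]; rewrite mul0r.
have : cavg k rho = 0.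
  transitivity (k 0); last exact: k0.
  apply: (@mean_value _ k z _ (ltW r0) _ ck).
  move=> w wr; have [->//|wz] := eqVneq w z.
  by have [e] := ck w wr wz; exact: holo_continuous.
have cs : oncirc (fun w => (w - z)^-1) rho.
  apply: oncirc_cplxV (ltW r0) (@oncirc_sub rho z) _.
  by move=> w wr; exact: sub_neq0 zr.
have cf : oncirc f rho by apply: (holo_on_oncirc hf); rewrite lexx ltW.
have cK : oncirc (fun w => w / (w - z)) rho := oncirc_cplxM (@oncirc_id _ rho) cs.
have cfK : oncirc (fun w => f w * w / (w - z)) rho :=
  oncirc_cplxM (oncirc_cplxM cf (@oncirc_id _ rho)) cs.
have cZ : oncirc (fun w => f z * (w / (w - z))) rho :=
  oncirc_scale cK.
rewrite (@eq_cavg _ _ (fun w => f w * w / (w - z) - f z * (w / (w - z)))) ?ltW//; last first.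
  move=> w wr; have nz := sub_neq0 wr zr; rewrite /k.
  have -> : (w == z) = false by apply/negbTE; rewrite -subr_eq0.
  by field.
rewrite (cavgB cfK cZ) (cavgZ _ cK) (cavg_kernel zr) mulr1 => /eqP.
by rewrite subr_eq0 => /eqP.
Qed.

Section CauchyIntegral.
Variables (phi : R[i]^o -> R[i]^o) (rho : R).
Hypothesis cphi : oncirc phi rho.

Let K (n : nat) z := cavg (fun w => phi w / (w - z) ^+ n) rho.

Let oK n z : cmod z < rho -> oncirc (fun w => phi w / (w - z) ^+ n) rho.
Proof.
move=> zr; have r0 : 0 <= rho by apply: le_trans (ltW zr); exact: cmod_ge0.
have nz w : cmod w = rho -> (w - z) ^+ n != 0.
  by move=> wr; rewrite expf_neq0//; exact: sub_neq0 zr.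
have ci := oncirc_cplxV r0 (@oncirc_exp n _ _ (@oncirc_sub rho z)) nz.
exact: (oncirc_cplxM cphi ci).
Qed.

(* [E h w] is the Taylor remainder of the kernel *)
Let Kderive n m (c : nat) (C : R) (z : R[i]^o) : cmod z < rho -> 0 <= C ->
  (forall h w, cmod w = rho -> cmod h <= (rho - cmod z) / 2 ->
    cmod (1 / (w - (z + h)) ^+ n - 1 / (w - z) ^+ n - c%:R * h / (w - z) ^+ m) <=
      C * cmod h ^+ 2) ->
  is_derive z 1 (K n) (c%:R * K m z).
Proof.
move=> zr C0 HC; have r0 : 0 <= rho by apply: le_trans (ltW zr); exact: cmod_ge0.
set A := avg (fun w => cmod (phi w)) rho.
have A0 : 0 <= A by apply: avg_ge0 => //; [exact: oncirc_cmod|move=> w _; exact: cmod_ge0].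
have eta0 : 0 < (rho - cmod z) / 2 by rewrite divr_gt0// subr_gt0.
apply/is_derive_cmodP => e e0.
set B := 2 * (C * A) + 1; have B0 : 0 < B.
  by rewrite ltr_wpDl// mulr_ge0// mulr_ge0.
exists (Num.min ((rho - cmod z) / 2) (e / B)); split; first by rewrite lt_min eta0 divr_gt0.
move=> w; rewrite lt_min => /andP[w1 w2]; set h : R[i]^o := w - z in w1 w2 *.
have wE : w = z + h by rewrite /h addrC subrK.
have wr : cmod w < rho by have := cmod_sub_ge w z; rewrite -/h; lra.
have c1 := @oK n w wr; have c2 := @oK n z zr; have c3 := @oK m z zr.
have c4 : oncirc (fun v => (c%:R * h) * (phi v / (v - z) ^+ m)) rho.
  exact: oncirc_scale.
have c5 : oncirc (fun v => phi v / (v - w) ^+ n - phi v / (v - z) ^+ n) rho.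
  exact: (oncirc_cplxD c1 (oncirc_cplxN c2)).
have -> : K n w - K n z - c%:R * K m z * h =
    cavg (fun v => phi v / (v - w) ^+ n - phi v / (v - z) ^+ n -
      (c%:R * h) * (phi v / (v - z) ^+ m)) rho.
  by rewrite (cavgB c5 c4) (cavgB c1 c2) (cavgZ _ c3) /K; congr (_ - _); rewrite mulrAC.
have c6 : oncirc (fun v => phi v / (v - w) ^+ n - phi v / (v - z) ^+ n -
      (c%:R * h) * (phi v / (v - z) ^+ m)) rho.
  exact: (oncirc_cplxD c5 (oncirc_cplxN c4)).
apply: le_trans (cavg_le c6) _.
have c7 := oncirc_cmod cphi.
apply: (@le_trans _ _ (2 * (C * cmod h ^+ 2 * A))); last first.
  have -> : 2 * (C * cmod h ^+ 2 * A) = 2 * (C * A) * cmod h * cmod h by ring.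
  rewrite ler_wpM2r ?cmod_ge0//; apply: (@le_trans _ _ (cmod h * B)).
    by rewrite mulrC ler_wpM2l ?cmod_ge0// lerDl.
  by rewrite -ler_pdivlMr// ltW.
rewrite ler_pM2l// -avgZ//; apply: avg_le => //.
- exact: oncirc_cmod.
- by apply: oncircM => //; exact: oncirc_cst.
move=> v vr.
have -> : phi v / (v - w) ^+ n - phi v / (v - z) ^+ n - (c%:R * h) * (phi v / (v - z) ^+ m)
  = phi v * (1 / (v - (z + h)) ^+ n - 1 / (v - z) ^+ n - c%:R * h / (v - z) ^+ m).
  by rewrite -wE; ring.
by rewrite cmodM mulrC ler_wpM2r ?cmod_ge0// HC// ltW.
Qed.

Lemma cauchy_integral_derive1 z : cmod z < rho ->
  is_derive z 1 (fun v => cavg (fun w => phi w / (w - v)) rho)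
    (cavg (fun w => phi w / (w - z) ^+ 2) rho).
Proof.
move=> zr; set eta := rho - cmod z; have eta0 : 0 < eta by rewrite subr_gt0.
(* With [u = w - z] the Taylor remainder of the kernel is [h^2 / (u^2 (u - h))], where [|u| >= eta]
   and [|u - h| >= eta / 2]; hence [2 / eta^3]. *)
have := @Kderive 1%N 2%N 1%N (2 / eta ^+ 3) z zr; rewrite mul1r /K.
apply; first by rewrite divr_ge0// exprn_ge0 ?ltW.
move=> h w wr hh.
have u0 : w - z != 0 by exact: sub_neq0 zr.
have ueta : eta <= cmod (w - z) by have := cmod_sub_ge w z; rewrite wr.
have veta : eta / 2 <= cmod (w - z - h).
  by have := cmod_sub_ge (w - z) h; rewrite -/eta in hh *; lra.
have v0 : w - z - h != 0 by rewrite -cmod_gt0; lra.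
rewrite opprD addrA.
have -> : 1 / (w - z - h) ^+ 1 - 1 / (w - z) ^+ 1 - 1%:R * h / (w - z) ^+ 2 =
  h ^+ 2 / ((w - z) ^+ 2 * (w - z - h)) by rewrite !expr1; field; rewrite u0 v0.
rewrite cmodf cmodX mulrC ler_wpM2r ?exprn_ge0 ?cmod_ge0// cmodM cmodX.
have -> : 2 / eta ^+ 3 = (eta ^+ 2 * (eta / 2))^-1 by field; rewrite gt_eqF.
rewrite lef_pV2 ?posrE; last 2 first.
- by rewrite !mulr_gt0 ?exprn_gt0// cmod_gt0.
- by rewrite !mulr_gt0 ?exprn_gt0.
apply: ler_pM => //; rewrite ?exprn_ge0 ?divr_ge0 ?(ltW eta0)//.
by rewrite lerXn2r// nnegrE ?cmod_ge0// ltW.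
Qed.

Lemma cauchy_integral_derive2 z : cmod z < rho ->
  exists d, is_derive z 1 (fun v => cavg (fun w => phi w / (w - v) ^+ 2) rho) d.
Proof.
move=> zr; set eta := rho - cmod z; have eta0 : 0 < eta by rewrite subr_gt0.
(* The remainder is now [h^2 (3 u - 2 h) / (u^3 (u - h)^2)]. The numerator [3 u - 2 h] is at most
   [4 |u|], which leaves [4 / (eta^2 (eta / 2)^2)]. *)
exists (2%:R * K 3 z); apply: (@Kderive 2%N 3%N 2%N (16 / eta ^+ 4) z zr).
  by rewrite divr_ge0// exprn_ge0 ?ltW.
move=> h w wr hh.
have u0 : w - z != 0 by exact: sub_neq0 zr.
have ueta : eta <= cmod (w - z) by have := cmod_sub_ge w z; rewrite wr.
have veta : eta / 2 <= cmod (w - z - h).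
  by have := cmod_sub_ge (w - z) h; rewrite -/eta in hh *; lra.
have v0 : w - z - h != 0 by rewrite -cmod_gt0; lra.
rewrite opprD addrA.
have -> : 1 / (w - z - h) ^+ 2 - 1 / (w - z) ^+ 2 - 2%:R * h / (w - z) ^+ 3 =
  h ^+ 2 * (((w - z) - h + (w - z) - h + (w - z)) / ((w - z) ^+ 3 * (w - z - h) ^+ 2)).
  by field; rewrite u0 v0.
rewrite cmodM cmodX mulrC ler_wpM2r ?exprn_ge0 ?cmod_ge0// cmodf cmodM !cmodX.
have U0 : 0 < cmod (w - z) by rewrite cmod_gt0.
have V0 : 0 < cmod (w - z - h) by rewrite cmod_gt0.
set U := cmod (w - z) in ueta U0 *; set V := cmod (w - z - h) in veta V0 *.
have num : cmod ((w - z) - h + (w - z) - h + (w - z)) <= 4 * U.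
  have -> : (w - z) - h + (w - z) - h + (w - z) = (w - z) + (w - z) + (w - z) + (- h - h) by ring.
  apply: le_trans (cmodD _ _) _.
  have := cmodD (w - z + (w - z)) (w - z); have := cmodD (w - z) (w - z).
  have := cmodD (- h) (- h); rewrite !cmodN -/U.
  by rewrite -/eta in hh *; lra.
apply: (@le_trans _ _ (4 * U / (U ^+ 3 * V ^+ 2))).
  by rewrite ler_wpM2r// invr_ge0 mulr_ge0// exprn_ge0// ltW.
have -> : 4 * U / (U ^+ 3 * V ^+ 2) = 4 * (U ^+ 2 * V ^+ 2)^-1.
  by field; rewrite !gt_eqF.
have -> : 16 / eta ^+ 4 = 4 * (eta ^+ 2 * (eta / 2) ^+ 2)^-1 by field; rewrite gt_eqF.
rewrite ler_pM2l// lef_pV2 ?posrE ?mulr_gt0 ?exprn_gt0// ?divr_gt0//.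
by apply: ler_pM; rewrite ?exprn_ge0 ?divr_ge0 ?(ltW eta0)//;
  rewrite lerXn2r// nnegrE ?divr_ge0 ?ltW.
Qed.

End CauchyIntegral.
End Cauchy.

(** * Local theory of holomorphic functions *)

Section Holomorphic.
Variable R : realType.
Implicit Types (r s t e M rho : R) (z w d : R[i]^o) (f g F G phi : R[i]^o -> R[i]^o).

Lemma nearA (P : R[i]^o -> Prop) z : (forall w, P w) -> \forall w \near z, P w.
Proof. by move=> H; apply/near_cmodP; exists 1; split. Qed.

Lemma holoP f z : holomorphic_at f z <->
  exists e, 0 < e /\ forall w, cmod (w - z) < e -> exists d, is_derive w 1 f d.
Proof.
rewrite /holomorphic_at; split.
  move=> /near_cmodP[e [e0 H]]; exists e; split=> // w we.
  by exists ('D_1 f w); exact: derivableP (H w we).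
move=> [e [e0 H]]; apply/near_cmodP; exists e; split=> // w we.
by have [d [df _]] := H w we.
Qed.

Lemma derive1c f z d : is_derive z 1 f d -> f^`()%classic z = d.
Proof. by move=> [_ df]; rewrite derive1E. Qed.

Lemma holo_is_derive f z : holomorphic_at f z -> is_derive z 1 f (f^`()%classic z).
Proof.
move=> /holoP[e [e0 H]]; have [|d df] := H z; first by rewrite subrr cmod0.
by rewrite (derive1c df).
Qed.

Lemma holo_near f z : holomorphic_at f z -> \forall w \near z, holomorphic_at f w.
Proof.
move=> /holoP[e [e0 H]]; apply/near_cmodP; exists e; split=> // w we.
apply/holoP; exists (e - cmod (w - z)); split; first by rewrite subr_gt0.
by move=> v vw; apply: H; apply: le_lt_trans (cmodDB _ w _) _; rewrite -ltrBrDr.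
Qed.

Lemma holo_eq f g z : (\forall w \near z, f w = g w) -> holomorphic_at f z ->
  holomorphic_at g z.
Proof.
move=> /near_cmodP[e [e0 H]] /holoP[e' [e'0 H']]; apply/holoP.
exists (Num.min e e'); split; first by rewrite lt_min e0.
move=> w; rewrite lt_min => /andP[w1 w2]; have [d df] := H' w w2; exists d.
apply: near_eq_is_derive df; apply/near_cmodP; exists (e - cmod (w - z)).
split; first by rewrite subr_gt0.
by move=> v vw; apply: H; apply: le_lt_trans (cmodDB _ w _) _; rewrite -ltrBrDr.
Qed.

Lemma holo_cont f z : holomorphic_at f z -> {for z, continuous f}.
Proof. by move=> /holo_is_derive; exact: holo_continuous. Qed.

Lemma holo_cst (k : R[i]^o) z : holomorphic_at (fun=> k) z.
Proof. by apply/holoP; exists 1; split=> // w _; exists 0; exact: is_derive_cstc. Qed.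

Lemma holo_id z : holomorphic_at (fun w => w) z.
Proof. by apply/holoP; exists 1; split=> // w _; exists 1; exact: is_derive_idc. Qed.

Lemma holoD f g z : holomorphic_at f z -> holomorphic_at g z ->
  holomorphic_at (fun w => f w + g w) z.
Proof.
move=> /holoP[e [e0 H]] /holoP[e' [e'0 H']]; apply/holoP.
exists (Num.min e e'); split; first by rewrite lt_min e0.
move=> w; rewrite lt_min => /andP[w1 w2].
have [d df] := H w w1; have [d' df'] := H' w w2.
by exists (d + d'); exact: is_derive_addc.
Qed.

Lemma holoM f g z : holomorphic_at f z -> holomorphic_at g z ->
  holomorphic_at (fun w => f w * g w) z.
Proof.
move=> /holoP[e [e0 H]] /holoP[e' [e'0 H']]; apply/holoP.
exists (Num.min e e'); split; first by rewrite lt_min e0.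
move=> w; rewrite lt_min => /andP[w1 w2].
have [d df] := H w w1; have [d' df'] := H' w w2.
by exists (f w * d' + g w * d); exact: is_derive_mulc.
Qed.

Lemma holoN f z : holomorphic_at f z -> holomorphic_at (fun w => - f w) z.
Proof.
move=> /holoP[e [e0 H]]; apply/holoP; exists e; split=> // w /H[d df].
by exists (- d); exact: is_derive_oppc.
Qed.

Lemma holoB f g z : holomorphic_at f z -> holomorphic_at g z ->
  holomorphic_at (fun w => f w - g w) z.
Proof. by move=> hf hg; exact: holoD hf (holoN hg). Qed.

Lemma near_neq0 f z : {for z, continuous f} -> f z != 0 -> \forall w \near z, f w != 0.
Proof.
move=> /ccontP cf fz; apply/near_cmodP.
have m0 : 0 < cmod (f z) by rewrite cmod_gt0.
have [e [e0 H]] := cf _ m0; exists e; split => // w /H; rewrite cmodB => Hw.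
by rewrite -cmod_gt0; have := cmod_sub_ge (f z) (f w); lra.
Qed.

Lemma holoV f z : holomorphic_at f z -> f z != 0 -> holomorphic_at (fun w => (f w)^-1) z.
Proof.
move=> hf fz; have /near_cmodP[e1 [e10 H1]] := near_neq0 (holo_cont hf) fz.
have /holoP[e [e0 H]] := hf; apply/holoP; exists (Num.min e e1).
split; first by rewrite lt_min e0.
move=> w; rewrite lt_min => /andP[w1 w2]; have [d df] := H w w1.
by eexists; exact: is_derive_invc df (H1 _ w2).
Qed.

Lemma holoX f n z : holomorphic_at f z -> holomorphic_at (fun w => f w ^+ n) z.
Proof.
move=> hf; elim: n => [|n IH]; first exact: holo_cst.
have -> : (fun w : R[i]^o => f w ^+ n.+1) = fun w => f w * f w ^+ n.
  by apply/funext => w; rewrite exprS.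
exact: holoM.
Qed.

Lemma holo_sub z c : holomorphic_at (fun w => w - c) z.
Proof. exact: holoB (@holo_id z) (@holo_cst c z). Qed.

Lemma holo_shift f z c : holomorphic_at f (z + c) -> holomorphic_at (fun w => f (w + c)) z.
Proof.
move=> /holoP[e [e0 H]]; apply/holoP; exists e; split=> // w we.
have [|d df] := H (w + c); first by rewrite opprD addrACA subrr addr0.
have := is_derive_ccomp (is_derive_addc (is_derive_idc w) (is_derive_cstc c w)) df.
by rewrite addr0 mulr1; exists d.
Qed.

Lemma holo_local f z : holomorphic_at f z ->
  exists rho, 0 < rho /\ holo_on (fun w => f (w + z)) rho.
Proof.
move=> /holoP[e [e0 H]]; exists (e / 2); rewrite divr_gt0//; split=> // w we.
have wz : cmod (w + z - z) < e.
  by rewrite addrK; apply: le_lt_trans we _; rewrite ltr_pdivrMr// ltr_pMr// ltr1n.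
have [d df] := H _ wz.
have := is_derive_ccomp (is_derive_addc (is_derive_idc w) (is_derive_cstc z w)) df.
by rewrite addr0 mulr1; exists d.
Qed.

Lemma holo_of_shift f z : holomorphic_at (fun w => f (w + z)) 0 -> holomorphic_at f z.
Proof.
move=> h; have := @holo_shift (fun w => f (w + z)) z (- z); rewrite subrr => /(_ h).
by apply: holo_eq; apply: nearA => w; rewrite subrK.
Qed.

Lemma near_shift (P : R[i]^o -> Prop) z : (\forall w \near (0 : R[i]^o), P (w + z)) ->
  \forall w \near z, P w.
Proof.
move=> /near_cmodP[e [e0 H]]; apply/near_cmodP; exists e; split=> // w we.
by have := H (w - z); rewrite subrK subr0; exact.
Qed.

Lemma near_disc (P : R[i]^o -> Prop) rho : 0 < rho ->
  (forall w, cmod w < rho -> P w) -> \forall w \near (0 : R[i]^o), P w.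
Proof.
by move=> r0 H; apply/near_cmodP; exists rho; split=> // w; rewrite subr0; exact: H.
Qed.

Lemma near_disc_at (P : R[i]^o -> Prop) rho v : cmod v < rho ->
  (forall w, cmod w < rho -> P w) -> \forall w \near v, P w.
Proof.
move=> vr H; apply/near_cmodP; exists (rho - cmod v); rewrite subr_gt0; split=> // w wv.
by apply: H; rewrite -(subrK v w); apply: le_lt_trans (cmodD _ _) _; rewrite -ltrBrDr.
Qed.

(** Cauchy's formula presents [F] as a Cauchy integral, and such integrals can be differentiated
    twice. This is all that is needed to see that a derivative is again holomorphic. *)
Lemma disc_derive F rho : 0 < rho -> holo_on F rho ->
  exists K : R[i]^o -> R[i]^o, forall v, cmod v < rho ->
    is_derive v 1 F (K v) /\ exists d, is_derive v 1 K d.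
Proof.
move=> r0 hF.
have cF : oncirc F rho by apply: (holo_on_oncirc hF); rewrite lexx ltW.
have cphi : oncirc (fun w => F w * w) rho := oncirc_cplxM cF (@oncirc_id _ rho).
exists (fun v => cavg (fun w => F w * w / (w - v) ^+ 2) rho) => v vr; split.
  apply: near_eq_is_derive (cauchy_integral_derive1 cphi vr).
  by apply: (near_disc_at vr) => w wr; rewrite cauchy_formula.
exact: (cauchy_integral_derive2 cphi vr).
Qed.

Lemma holo_derive f z : holomorphic_at f z -> holomorphic_at (f^`()%classic) z.
Proof.
move=> /holo_local[rho [r0 /(disc_derive r0)[K HK]]].
have E v : cmod v < rho -> f^`()%classic (v + z) = K v.
  move=> vr; apply: derive1c; have [df _] := HK v vr.
  have D : is_derive (v + z) 1 (fun w => w - z) (1 : R[i]^o).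
    by have := is_derive_subc (is_derive_idc (v + z)) (is_derive_cstc z (v + z)); rewrite subr0.
  have vE : v = (v + z) - z by rewrite addrK.
  rewrite {1}vE in df; have := is_derive_ccomp D df; rewrite mulr1.
  by apply: near_eq_is_derive; apply: nearA => w; rewrite subrK.
apply: holo_of_shift; apply: (@holo_eq K); first by apply: (near_disc r0) => w /E.
by apply/holoP; exists rho; split=> // w; rewrite subr0 => /HK[].
Qed.

(** The quotient is itself a Cauchy integral: with the zero moved to 0, the identity [F w * w / (w -
    v) - F w = v * (F w / (w - v))] gives [F v - F 0 = v * G v] after taking means. *)
Lemma holo_factor f z : holomorphic_at f z -> f z = 0 ->
  exists g, holomorphic_at g z /\ \forall w \near z, f w = (w - z) * g w.
Proof.
move=> /holo_local[rho [r0 hF]] fz.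
pose F w := f (w + z); rewrite -/F in hF.
have cF : oncirc F rho by apply: (holo_on_oncirc hF); rewrite lexx ltW.
pose G v := cavg (fun w => F w / (w - v)) rho.
have hG : forall v, cmod v < rho -> exists d, is_derive v 1 G d.
  by move=> v vr; eexists; exact: (cauchy_integral_derive1 cF vr).
exists (fun w => G (w - z)); split.
  apply: holo_of_shift; apply: (@holo_eq G); first by apply: nearA => w; rewrite addrK.
  by apply/holoP; exists rho; split=> // w; rewrite subr0 => /hG.
apply: near_shift; apply: (near_disc r0) => v vr; rewrite addrK -/(F v).
have F0 : F 0 = 0 by rewrite /F add0r.
have cs : oncirc (fun w => (w - v)^-1) rho.
  have nz w : cmod w = rho -> w - v != 0 by move=> wr; exact: sub_neq0 vr.
  exact: (oncirc_cplxV (ltW r0) (@oncirc_sub R rho v) nz).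
have c1 : oncirc (fun w => F w * w / (w - v)) rho.
  exact: (oncirc_cplxM (oncirc_cplxM cF (@oncirc_id _ rho)) cs).
have -> : F v = F v - F 0 by rewrite F0 subr0.
have z0 : cmod (0 : R[i]^o) < rho by rewrite cmod0.
rewrite -{1}(cauchy_formula hF vr) -(cauchy_formula hF z0).
rewrite /G -(cavgZ v (oncirc_cplxM cF cs)).
rewrite (@eq_cavg _ (fun w => F w * w / (w - 0)) F) ?ltW//; last first.
  by move=> w wr; rewrite subr0 mulfK// -cmod_gt0 wr.
rewrite -(cavgB c1 cF); apply: eq_cavg; first exact: ltW.
move=> w wr; have nz := sub_neq0 wr vr.
by field.
Qed.

(** Cauchy's formula for [F w / w ^+ n] on the circle of radius [rho] bounds [F v] by a constant
    times [(|v| / rho)^n], and for [|v| < rho / 2] this tends to 0. No power series is involved. *)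
Lemma holo_flat f z : holomorphic_at f z ->
  (forall n, exists g, holomorphic_at g z /\ \forall w \near z, f w = (w - z) ^+ n * g w) ->
  \forall w \near z, f w = 0.
Proof.
move=> /holo_local[rho [r0 hF]] H.
pose F w := f (w + z); rewrite -/F in hF.
have cF : oncirc F rho by apply: (holo_on_oncirc hF); rewrite lexx ltW.
set A := avg (fun w => cmod (F w)) rho.
have A0 : 0 <= A by apply: avg_ge0; [exact: ltW|exact: oncirc_cmod|move=> w _; exact: cmod_ge0].
have F0 : F 0 = 0.
  have [g [_ /near_cmodP[e [e0 He]]]] := H 1%N.
  by rewrite /F add0r He ?subrr ?cmod0// expr1 mul0r.
have r2 : 0 < rho / 2 by rewrite divr_gt0.
have bound v n : 0 < cmod v < rho / 2 -> cmod (F v) <= 4 * A / 2 ^+ n.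
  move=> /andP[v0 v2].
  have vr : cmod v < rho by lra.
  have vn0 : v != 0 by rewrite -cmod_gt0.
  have [g [hg /near_cmodP[e [e0 He]]]] := H n.
  pose G w : R[i]^o := if w == 0 then g z else F w / w ^+ n.
  have hG : holo_on G rho.
    move=> w wr; have [w0|w0] := eqVneq w 0.
      have /holo_is_derive dg : holomorphic_at (fun w => g (w + z)) 0.
        by apply: holo_shift; rewrite add0r.
      exists ((fun w => g (w + z))^`()%classic 0); rewrite w0.
      apply: near_eq_is_derive dg; apply: (near_disc e0) => u ue.
      rewrite /G; case: eqP => [->|/eqP u0]; first by rewrite add0r.
      by rewrite /F He ?addrK// mulrAC mulfV ?mul1r// expf_neq0.
    have [d df] := hF w wr.
    have wn0 : w ^+ n != 0 by rewrite expf_neq0.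
    have /holo_is_derive dX := holoX n (@holo_id w).
    have D := is_derive_mulc df (is_derive_invc dX wn0).
    eexists; apply: near_eq_is_derive D.
    have := near_neq0 (holo_cont (@holo_id w)) w0.
    by apply: filterS => u u0; rewrite /G (negbTE u0).
  have cG : oncirc G rho by apply: (holo_on_oncirc hG); rewrite lexx ltW.
  have cs : oncirc (fun w => (w - v)^-1) rho.
    have nz w : cmod w = rho -> w - v != 0 by move=> wr; exact: sub_neq0 vr.
    exact: (oncirc_cplxV (ltW r0) (@oncirc_sub R rho v) nz).
  have c1 : oncirc (fun w => G w * w / (w - v)) rho.
    exact: (oncirc_cplxM (oncirc_cplxM cG (@oncirc_id _ rho)) cs).
  have Gv : cmod (G v) <= 2 * (2 / rho ^+ n * A).
    rewrite -(cauchy_formula hG vr); apply: le_trans (cavg_le c1) _.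
    rewrite ler_pM2l// /A -(avgZ _ (oncirc_cmod cF)); apply: avg_le; first exact: ltW.
    - exact: oncirc_cmod.
    - by apply: oncircM; [exact: oncirc_cst|exact: oncirc_cmod].
    move=> w wr; have w0 : w != 0 by rewrite -cmod_gt0 wr.
    rewrite /G (negbTE w0) !cmodM !cmodV cmodX wr.
    have rv : rho / 2 <= cmod (w - v) by have := cmod_sub_ge w v; rewrite wr; lra.
    have -> : 2 / rho ^+ n * cmod (F w) = cmod (F w) / rho ^+ n * rho * (rho / 2)^-1.
      by field; rewrite expf_neq0 ?gt_eqF.
    rewrite ler_wpM2l ?mulr_ge0 ?cmod_ge0 ?invr_ge0 ?exprn_ge0 ?(ltW r0)//.
    by rewrite lef_pV2 ?posrE//; lra.
  have -> : F v = v ^+ n * G v.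
    by rewrite /G (negbTE vn0) mulrCA mulfV ?mulr1// expf_neq0.
  rewrite cmodM cmodX.
  have -> : 4 * A / 2 ^+ n = (rho / 2) ^+ n * (2 * (2 / rho ^+ n * A)).
    by rewrite expr_div_n; field; rewrite !expf_neq0 ?gt_eqF.
  apply: ler_pM; rewrite ?exprn_ge0 ?cmod_ge0//.
  by rewrite lerXn2r ?nnegrE ?cmod_ge0 ?ltW.
apply: near_shift; apply: (near_disc r2) => v vr.
have [->|v0] := eqVneq v 0; first exact: F0.
apply/eqP; rewrite -cmod_eq0 eq_le cmod_ge0 andbT; apply/ler_addgt0Pr => e e0.
have [N HN] := archi_half (4 * A) e0; rewrite add0r.
by apply: le_trans (bound v N _) (ltW (HN N (leqnn N))); rewrite cmod_gt0 v0.
Qed.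

End Holomorphic.

(** * Orders of meromorphic functions *)

Section Germs.
Variable R : realType.
Implicit Types (r s t e M rho : R) (z w d c : R[i]^o) (f g h F G : R[i]^o -> R[i]^o)
  (P Q : R[i]^o -> Prop) (n m : int).

Lemma near_dnear P z : (\forall w \near z, P w) -> \forall w \near z^', P w.
Proof.
by move=> /near_cmodP[e [e0 H]]; apply/dnear_cmodP; exists e; split=> // w _; exact: H.
Qed.

Lemma dnearS P Q z : (forall w, w != z -> P w -> Q w) ->
  (\forall w \near z^', P w) -> \forall w \near z^', Q w.
Proof.
move=> PQ /dnear_cmodP[e [e0 H]]; apply/dnear_cmodP; exists e; split=> // w wz we.
by apply: PQ => //; exact: H.
Qed.

Lemma dnearI P Q z : (\forall w \near z^', P w) -> (\forall w \near z^', Q w) ->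
  \forall w \near z^', P w /\ Q w.
Proof.
move=> /dnear_cmodP[e [e0 H]] /dnear_cmodP[e' [e'0 H']]; apply/dnear_cmodP.
exists (Num.min e e'); split; first by rewrite lt_min e0.
by move=> w wz; rewrite lt_min => /andP[w1 w2]; split; [exact: H|exact: H'].
Qed.

Lemma dnearS2 P Q (S : R[i]^o -> Prop) z : (forall w, w != z -> P w -> Q w -> S w) ->
  (\forall w \near z^', P w) -> (\forall w \near z^', Q w) -> \forall w \near z^', S w.
Proof.
move=> H p q; have := dnearI p q; apply: dnearS => w wz [? ?]; exact: H.
Qed.

Lemma dnear_near P z : (\forall w \near z^', P w) ->
  \forall w \near z^', \forall v \near w, P v.
Proof.
move=> /dnear_cmodP[e [e0 H]]; apply/dnear_cmodP; exists e; split=> // w wz we.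
have wz0 : 0 < cmod (w - z) by rewrite cmod_gt0 subr_eq0.
apply/near_cmodP; exists (Num.min (cmod (w - z)) (e - cmod (w - z))).
split; first by rewrite lt_min wz0 subr_gt0.
move=> v; rewrite lt_min => /andP[v1 v2]; apply: H.
  by apply: contraTneq v1 => ->; rewrite cmodB ltxx.
by apply: le_lt_trans (cmodDB _ w _) _; rewrite -ltrBrDr.
Qed.

Lemma dnear_exists P z : (\forall w \near z^', P w) -> exists w, w != z /\ P w.
Proof.
move=> /dnear_cmodP[e [e0 H]]; have e2 : 0 < e / 2 by rewrite divr_gt0.
have wz : z + (e / 2)%:C != z.
  rewrite -subr_eq0 addrAC subrr add0r -cmod_eq0 cmodR gtr0_norm//.
  by rewrite gt_eqF.
exists (z + (e / 2)%:C); split=> //; apply: H => //.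
by rewrite addrAC subrr add0r cmodR gtr0_norm// ltr_pdivrMr// ltr_pMr// ltr1n.
Qed.

Lemma eq_at_dnear g h z : {for z, continuous g} -> {for z, continuous h} ->
  (\forall w \near z^', g w = h w) -> g z = h z.
Proof.
move=> cg ch gh; apply/eqP; rewrite -subr_eq0; apply/negPn/negP => nz.
have := near_neq0 (cforB cg ch) nz => /near_dnear nz'.
have [w [_ [H1 H2]]] := dnear_exists (dnearI gh nz').
by move: H2; rewrite H1 subrr eqxx.
Qed.

Definition zero_germ f z := \forall w \near z^', f w = 0.

(** Signed order, positive at zeros and negative at poles. A germ that vanishes identically has no
    order. *)
Definition ord_at f z n := exists g, [/\ holomorphic_at g z, g z != 0 &
  \forall w \near z^', f w = g w * (w - z) ^ n].

Definition regular_at f z := exists g, holomorphic_at g z /\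
  \forall w \near z^', f w = g w.

Lemma holo_mulX g c z k : holomorphic_at g z ->
  holomorphic_at (fun w => g w * (w - c) ^+ k) z.
Proof. by move=> hg; exact: holoM hg (holoX k (@holo_sub R z c)). Qed.

Lemma holo_expz z n w : w != z -> holomorphic_at (fun v : R[i]^o => (v - z) ^ n) w.
Proof.
move=> wz; have ww : (w - z) != 0 by rewrite subr_eq0.
case: n => k; first exact: (holoX k (@holo_sub R w z)).
have wk : (w - z) ^+ k.+1 != 0 by rewrite expf_neq0.
exact: (holoV (holoX k.+1 (@holo_sub R w z)) wk).
Qed.

(** Either some power of [w - z] splits off with a non-zero cofactor, or [holo_factor] can be
    repeated for ever and [holo_flat] applies. *)
Lemma holo_ord f z : holomorphic_at f z ->
  zero_germ f z \/ exists n : nat, ord_at f z n%:Z.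
Proof.
move=> hf; have [|N] := pselect (exists n : nat, exists g,
    [/\ holomorphic_at g z, g z != 0 & \forall w \near z, f w = (w - z) ^+ n * g w]).
  move=> [n [g [hg gz fg]]]; right; exists n, g; split=> //.
  by apply: dnearS (near_dnear fg) => w _ ->; rewrite mulrC -exprnP.
left; apply: near_dnear; apply: (holo_flat hf) => n.
elim: n => [|n [g [hg fg]]].
  by exists f; split=> //; apply: nearA => w; rewrite expr0 mul1r.
have gz : g z = 0 by apply: contrapT => /eqP gz; apply: N; exists n, g; split.
have [k [hk gk]] := holo_factor hg gz; exists k; split=> //.
move: fg gk => /near_cmodP[e [e0 H]] /near_cmodP[e' [e'0 H']]; apply/near_cmodP.
exists (Num.min e e'); split; first by rewrite lt_min e0.
move=> w; rewrite lt_min => /andP[w1 w2].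
by rewrite H// H'// exprSr mulrA.
Qed.

Lemma ord_eq f g z n : (\forall w \near z^', f w = g w) -> ord_at f z n -> ord_at g z n.
Proof.
move=> fg [h [hh hz fh]]; exists h; split=> //.
by apply: dnearS2 fg fh => w _ -> ->.
Qed.

Lemma exprz_neq0 (x : R[i]^o) n : x != 0 -> x ^ n != 0.
Proof. exact: expfz_neq0. Qed.

Lemma ordM f g z n m : ord_at f z n -> ord_at g z m ->
  ord_at (fun w => f w * g w) z (n + m).
Proof.
move=> [f1 [hf fz ff]] [g1 [hg gz gg]]; exists (fun w => f1 w * g1 w).
split; [exact: holoM|by rewrite mulf_neq0|].
apply: dnearS2 ff gg => w wz -> ->; rewrite expfzDr ?subr_eq0//.
by rewrite mulrACA.
Qed.

Lemma ordV f z n : ord_at f z n -> ord_at (fun w => (f w)^-1) z (- n).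
Proof.
move=> [f1 [hf fz ff]]; exists (fun w => (f1 w)^-1).
split; [exact: holoV|by rewrite invr_eq0|].
by apply: dnearS ff => w wz ->; rewrite invfM invr_expz.
Qed.

Lemma ord_nonzero f z : holomorphic_at f z -> f z != 0 -> ord_at f z 0.
Proof.
move=> hf fz; exists f; split=> //.
by apply: near_dnear; apply: nearA => w; rewrite expr0z mulr1.
Qed.

Lemma ord_cst c z : c != 0 -> ord_at (fun=> c) z 0.
Proof. by move=> c0; apply: ord_nonzero => //; exact: holo_cst. Qed.

Lemma ord_exp f z n k : ord_at f z n -> ord_at (fun w => f w ^+ k) z (n * k%:Z).
Proof.
move=> fo; elim: k => [|k IH].
  by rewrite mulr0; have := @ord_cst 1 z (oner_neq0 _).
have -> : (fun w : R[i]^o => f w ^+ k.+1) = fun w => f w * f w ^+ k.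
  by apply/funext => w; rewrite exprS.
by rewrite intS mulrDr mulr1; exact: ordM.
Qed.

Lemma ord_sub c : ord_at (fun w => w - c) c 1.
Proof.
exists (fun=> 1); split; [exact: holo_cst|exact: oner_neq0|].
by apply: near_dnear; apply: nearA => w; rewrite expr1z mul1r.
Qed.

Lemma ord_not_zero f z n : ord_at f z n -> ~ zero_germ f z.
Proof.
move=> [g [hg gz fg]] zf.
have nz := near_dnear (near_neq0 (holo_cont hg) gz).
have [w [wz [[H1 H2] H3]]] := dnear_exists (dnearI (dnearI fg zf) nz).
by move: H1; rewrite H2 => /esym/eqP; rewrite mulf_eq0 (negbTE H3)/=; apply/negP;
  rewrite exprz_neq0// subr_eq0.
Qed.

Lemma ord_unique f z n m : ord_at f z n -> ord_at f z m -> n = m.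
Proof.
wlog nm : n m / (n <= m)%R.
  by move=> H on om; have [/H|/ltW/H H'] := leP n m; [exact|apply/esym; exact: H'].
move=> [g [hg gz fg]] [h [hh hz fh]].
apply/eqP; apply: contraT => neq.
have [k kE] : exists k : nat, m = n + k.+1%:Z.
  exists (`|m - n|%N.-1); have : n != m by []. 
  by lia.
have : g z = (fun w => h w * (w - z) ^+ k.+1) z.
  have hk : holomorphic_at (fun w => h w * (w - z) ^+ k.+1) z.
    exact: holoM hh (holoX k.+1 (@holo_sub R z z)).
  apply: (eq_at_dnear (holo_cont hg) (holo_cont hk)).
  apply: dnearS2 fg fh => w wz -> /eqP.
  have nz : (w - z) ^ n != 0 by rewrite exprz_neq0// subr_eq0.
  rewrite kE expfzDr ?subr_eq0// mulrCA [X in _ == X]mulrC -subr_eq0 -mulrBl mulf_eq0 (negbTE nz) orbF.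
  by rewrite subr_eq0 => /eqP ->; rewrite -exprnP.
by rewrite /= subrr expr0n mulr0 => E; rewrite E eqxx in gz.
Qed.

(** Isolation of zeros, of poles and of misplaced values, all at once. *)
Lemma ord_good f z n : ord_at f z n ->
  \forall w \near z^', holomorphic_at f w /\ f w != 0.
Proof.
move=> [g [hg gz fg]].
have nz := near_dnear (near_neq0 (holo_cont hg) gz).
have hg' := near_dnear (holo_near hg).
apply: dnearS2 (dnearI (dnear_near fg) nz) hg' => w wz [H1 H2] H3.
have ww : w - z != 0 by rewrite subr_eq0.
have hz : holomorphic_at (fun v => g v * (v - z) ^ n) w.
  exact: holoM H3 (holo_expz n wz).
split.
  apply: holo_eq hz; move: H1 => /near_cmodP[e [e0 He]]; apply/near_cmodP.
  by exists e; split=> // v /He.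
move: H1 => /near_cmodP[e [e0 He]]; rewrite He ?subrr ?cmod0//.
by rewrite mulf_neq0// exprz_neq0.
Qed.

Lemma mero_zero_or_ord f z : meromorphic_at f z -> zero_germ f z \/ exists n, ord_at f z n.
Proof.
move=> [k [g [hg fg]]]; have [zg|[n og]] := holo_ord hg.
  by left; apply: dnearS2 fg zg => w _ -> ->; rewrite mul0r.
right; exists (n%:Z + - k%:Z).
have o1 : ord_at (fun w => (w - z) ^+ k) z k%:Z.
  by have := ord_exp k (@ord_sub z); rewrite mul1r.
have := ordM og (ordV o1); apply: ord_eq.
by apply: dnearS fg => w _ ->.
Qed.

Lemma ord_mero f z n : ord_at f z n -> meromorphic_at f z.
Proof.
move=> [g [hg gz fg]]; case: n fg => k fg.
  exists 0%N, (fun w => g w * (w - z) ^+ k).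
  split; first exact: holo_mulX.
  by apply: dnearS fg => w _ ->; rewrite expr0 divr1.
by exists k.+1, g; split.
Qed.

Lemma zero_mero f z : zero_germ f z -> meromorphic_at f z.
Proof.
move=> zf; exists 0%N, (fun=> 0); split; first exact: holo_cst.
by apply: dnearS zf => w _ ->; rewrite mul0r.
Qed.

Lemma mero_eq f g z : (\forall w \near z^', f w = g w) -> meromorphic_at f z ->
  meromorphic_at g z.
Proof.
move=> fg [n [h [hh fh]]]; exists n, h; split=> //.
by apply: dnearS2 fg fh => w _ -> ->.
Qed.

Lemma meroD f g z : meromorphic_at f z -> meromorphic_at g z ->
  meromorphic_at (fun w => f w + g w) z.
Proof.
move=> [n [f1 [hf ff]]] [m [g1 [hg gg]]].
exists (n + m)%N, (fun w => f1 w * (w - z) ^+ m + g1 w * (w - z) ^+ n).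
split; first exact: holoD (holo_mulX z m hf) (holo_mulX z n hg).
apply: dnearS2 ff gg => w wz -> ->; have nz : w - z != 0 by rewrite subr_eq0.
have := expf_neq0 n nz; have := expf_neq0 m nz; rewrite exprD.
move: (_ ^+ n) (_ ^+ m) => X Y Y0 X0.
by field; rewrite X0 Y0.
Qed.

Lemma meroM f g z : meromorphic_at f z -> meromorphic_at g z ->
  meromorphic_at (fun w => f w * g w) z.
Proof.
move=> [n [f1 [hf ff]]] [m [g1 [hg gg]]].
exists (n + m)%N, (fun w => f1 w * g1 w); split; first exact: holoM.
by apply: dnearS2 ff gg => w wz -> ->; rewrite exprD invfM mulrACA.
Qed.

Lemma mero_holo f z : holomorphic_at f z -> meromorphic_at f z.
Proof.
move=> hf; exists 0%N, f; split=> //.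
by apply: near_dnear; apply: nearA => w; rewrite expr0 divr1.
Qed.

Lemma mero_cst c z : meromorphic_at (fun=> c) z.
Proof. by apply: mero_holo; exact: holo_cst. Qed.

Lemma meroN f z : meromorphic_at f z -> meromorphic_at (fun w => - f w) z.
Proof.
move=> /(meroM (mero_cst (-1) z)); apply: mero_eq.
by apply: near_dnear; apply: nearA => w; rewrite mulN1r.
Qed.

Lemma meroB f g z : meromorphic_at f z -> meromorphic_at g z ->
  meromorphic_at (fun w => f w - g w) z.
Proof. by move=> mf mg; exact: meroD mf (meroN mg). Qed.

Lemma meroX f k z : meromorphic_at f z -> meromorphic_at (fun w => f w ^+ k) z.
Proof.
move=> mf; elim: k => [|k IH]; first exact: mero_cst.
have -> : (fun w : R[i]^o => f w ^+ k.+1) = fun w => f w * f w ^+ k.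
  by apply/funext => w; rewrite exprS.
exact: meroM.
Qed.

Lemma meroV f z : meromorphic_at f z -> meromorphic_at (fun w => (f w)^-1) z.
Proof.
move=> /mero_zero_or_ord[zf|[n fo]]; last exact: ord_mero (ordV fo).
by apply: zero_mero; apply: dnearS zf => w _ ->; rewrite invr0.
Qed.

Lemma is_derive_expz z n w : w != z ->
  is_derive w 1 (fun v : R[i]^o => (v - z) ^ n) (n%:~R * (w - z) ^ (n - 1) : R[i]^o).
Proof.
move=> wz; have nz : w - z != 0 by rewrite subr_eq0.
have D1 : is_derive w 1 (fun v => v - z) (1 : R[i]^o).
  by have := is_derive_subc (is_derive_idc w) (is_derive_cstc z w); rewrite subr0.
have E (m : int) : (w - z) * (w - z) ^ (m - 1) = (w - z) ^ m.
  by rewrite -{1}(expr1z (w - z)) -expfzDr// [1 + _]addrC subrK.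
have DX k : is_derive w 1 (fun v => (v - z) ^+ k) (k%:R * (w - z) ^ (k%:Z - 1) : R[i]^o).
  elim: k => [|k IH]; first by rewrite mul0r; exact: is_derive_cstc.
  have -> : (fun v : R[i]^o => (v - z) ^+ k.+1) = fun v => (v - z) * (v - z) ^+ k.
    by apply/funext => v; rewrite exprS.
  have := is_derive_mulc D1 IH; congr (is_derive _ _ _ _).
  rewrite mulrCA E mulr1 (_ : k.+1%:Z - 1 = k%:Z); last by rewrite intS; ring.
  by rewrite -exprnP -natr1 mulrDl mul1r.
case: n => k; first exact: DX.
have := is_derive_invc (DX k.+1); rewrite expf_neq0// => /(_ isT).
congr (is_derive _ _ _ _).
have -> : Negz k - 1 = (k.+1%:Z - 1) - (k.+1%:Z + k.+1%:Z) by rewrite NegzE; ring.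
rewrite NegzE mulrNz mulNr mulNr; congr (- _); rewrite -mulrA; congr (_ * _).
by rewrite [RHS]expfzDr// -[X in _ = _ * X]invr_expz [X in _ = _ / X]expfzDr// -!exprnP expr2.
Qed.

Lemma dnear_derive f h z : (\forall w \near z^', f w = h w) ->
  (\forall w \near z^', exists d, is_derive (w : R[i]^o) 1 h d) ->
  \forall w \near z^', f^`()%classic w = h^`()%classic w.
Proof.
move=> fh dh; apply: dnearS2 (dnear_near fh) dh => w wz H [d dhw].
rewrite (derive1c dhw); apply: derive1c; apply: near_eq_is_derive dhw.
by move: H => /near_cmodP[e [e0 He]]; apply/near_cmodP; exists e; split=> // v /He ->.
Qed.

Lemma dnear_derive_expz f g z n : holomorphic_at g z ->
  (\forall w \near z^', f w = g w * (w - z) ^ n) ->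
  \forall w \near z^',
    f^`()%classic w = (g^`()%classic w * (w - z) + n%:~R * g w) * (w - z) ^ (n - 1).
Proof.
move=> hg fg; have hg' := near_dnear (holo_near hg).
have D : \forall w \near z^', is_derive (w : R[i]^o) 1 (fun w : R[i]^o => g w * (w - z) ^ n)
    (g w * (n%:~R * (w - z) ^ (n - 1)) + (w - z) ^ n * g^`()%classic w).
  apply: dnearS hg' => w wz hw.
  exact: is_derive_mulc (holo_is_derive hw) (is_derive_expz n wz).
have E : \forall w \near z^', f^`()%classic w = (fun w => g w * (w - z) ^ n)^`()%classic w.
  by apply: (dnear_derive fg); apply: dnearS D => w _ dw; eexists; exact: dw.
apply: dnearS2 E D => w wz -> dw; rewrite (derive1c dw).
have nz : w - z != 0 by rewrite subr_eq0.
have -> : (w - z) ^ n = (w - z) * (w - z) ^ (n - 1).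
  by rewrite -{2}(expr1z (w - z)) -expfzDr// [1 + _]addrC subrK.
ring.
Qed.

(** The new leading coefficient is [n * g z]. For order 0 it vanishes and only regularity of the
    derivative remains, which is [regular_derive]. *)
Lemma ord_derive f z n : n != 0 -> ord_at f z n -> ord_at (f^`()%classic) z (n - 1).
Proof.
move=> n0 [g [hg gz fg]].
exists (fun w => g^`()%classic w * (w - z) + n%:~R * g w); split.
- exact: holoD (holoM (holo_derive hg) (@holo_sub R z z)) (holoM (@holo_cst R _ z) hg).
- by rewrite subrr mulr0 add0r mulf_neq0// intr_eq0.
- exact: dnear_derive_expz.
Qed.

Lemma mero_derive f z : meromorphic_at f z -> meromorphic_at (f^`()%classic) z.
Proof.
move=> [k [g [hg fg]]].
have fg' : \forall w \near z^', f w = g w * (w - z) ^ (- k%:Z).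
  by apply: dnearS fg => w _ ->; rewrite -invr_expz.
exists k.+1, (fun w => g^`()%classic w * (w - z) + (- k%:Z)%:~R * g w); split.
  exact: holoD (holoM (holo_derive hg) (@holo_sub R z z)) (holoM (@holo_cst R _ z) hg).
apply: dnearS (dnear_derive_expz hg fg') => w _ ->.
by rewrite (_ : - k%:Z - 1 = - k.+1%:Z) ?intS -?invr_expz -?exprnP//; ring.
Qed.

Lemma regular_derive f z : regular_at f z -> regular_at (f^`()%classic) z.
Proof.
move=> [g [hg fg]]; exists (g^`()%classic); split; first exact: holo_derive.
apply: dnear_derive fg _; apply: near_dnear; move/holo_near: hg.
move=> /near_cmodP[e [e0 H]]; apply/near_cmodP; exists e; split=> // w we.
by eexists; exact: holo_is_derive (H w we).
Qed.

Lemma regular_ord f z n : regular_at f z -> ord_at f z n -> 0 <= n.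
Proof.
move=> [g [hg fg]] fo; have og := ord_eq fg fo.
have [zg|[m go']] := holo_ord hg; first by case: (ord_not_zero og).
by rewrite (ord_unique og go').
Qed.

Lemma ord_regular f z n : ord_at f z n -> 0 <= n -> regular_at f z.
Proof.
move=> [g [hg gz fg]]; case: n fg => // k fg _.
exists (fun w => g w * (w - z) ^+ k); split; last exact: fg.
exact: holo_mulX.
Qed.

Lemma pole_orderE f z n : ord_at f z n -> pole_order f z = if n < 0 then `|n|%N else 0%N.
Proof.
move=> fo; have uniq (m : nat) : has_pole_order f z m -> n = - m%:Z.
  move=> [g [hg gz fg]]; apply: ord_unique fo _; exists g; split=> //.
  by apply: dnearS fg => w _ ->; rewrite -invr_expz.
(* For [n > 0] no natural number satisfies [has_pole_order] and [xget] returns its default 0; for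
   [n = 0] the value 0 is the only candidate. *)
have [n0|n0] := leP 0 n.
  rewrite /pole_order; case: xgetP => // m _ /uniq nE.
  by lia.
apply: xget_unique => [|m /uniq]; last by lia.
case: fo => g [hg gz fg]; exists g; split=> //.
apply: dnearS fg => w _ ->; rewrite exprnP invr_expz.
by have -> : - `|n|%N%:Z = n by lia.
Qed.

Lemma pole_order_zero f z : zero_germ f z -> pole_order f z = 0%N.
Proof.
move=> zf; rewrite /pole_order; case: xgetP => // m _ [g [hg gz fg]].
case: (@ord_not_zero f z (- m%:Z)) => //; exists g; split=> //.
by apply: dnearS fg => w _ ->; rewrite -invr_expz.
Qed.

End Germs.

(** * Identity theorem, divisors and removal of singularities *)

Section Meromorphic.
Variable R : realType.
Implicit Types (r t e M rho : R) (s : seq R[i]^o) (z w d c a : R[i]^o) (f g h F G : R[i]^o -> R[i]^o)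
  (n m : int).

Lemma dnear_nz_not_zero f z : (\forall w \near z^', f w != 0) -> ~ zero_germ f z.
Proof.
by move=> nz zf; have [w [_ [/eqP H ]]] := dnear_exists (dnearI nz zf); exact.
Qed.

(** Around any point, either all germs vanish or none does. On the segment from [z0] to [z1],
    bisection spreads the vanishing of one germ over a small interval and then over the whole
    segment. *)
Lemma identity_theorem f z0 : meromorphic f -> zero_germ f z0 -> meq f (cst 0).
Proof.
move=> mf zf z1; set v := z1 - z0.
pose gam t : R[i]^o := z0 + v * t%:C.
pose P (x : R) (n : nat) := forall t0 t, x <= t0 <= x + 1 / 2 ^+ n ->
  x <= t <= x + 1 / 2 ^+ n -> zero_germ f (gam t0) -> zero_germ f (gam t).
suff : P 0 0%N.
  move=> /(_ 0 1); rewrite expr0 divr1 add0r !lexx ler01 => /(_ isT isT).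
  by rewrite /gam mulr0 addr0 mulr1 /v addrC subrK; exact.
apply: (@bisection1 _ P 0 1 ler01).
  move=> x n _ _ P1 P2 t0 t.
  have l0 : 0 <= 1 / 2 ^+ n.+1 :> R by rewrite divr_ge0// exprn_ge0.
  rewrite [1 / 2 ^+ n]half_powS addrA; set m := x + 1 / 2 ^+ n.+1.
  have m1 : x <= m <= m by rewrite lexx lerDl l0.
  have m2 : m <= m <= m + 1 / 2 ^+ n.+1 by rewrite lexx lerDl l0.
  move=> /andP[h1 h2] /andP[h3 h4] z_t0.
  have zm : zero_germ f (gam m).
    have [tm|/ltW tm] := leP t0 m; [apply: (P1 t0)|apply: (P2 t0)] => //; exact/andP.
  have [tm|/ltW tm] := leP t m; [apply: (P1 m)|apply: (P2 m)] => //; exact/andP.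
move=> p _.
have H : exists e : R, 0 < e /\ ((forall w, cmod (w - gam p) < e -> zero_germ f w) \/
    (forall w, w != gam p -> cmod (w - gam p) < e -> ~ zero_germ f w) /\ ~ zero_germ f (gam p)).
  have [zp|[n on]] := mero_zero_or_ord (mf (gam p)).
    have /dnear_cmodP[e [e0 He]] := dnear_near zp; exists e; split=> //; left=> w we.
    by have [->//|wz] := eqVneq w (gam p); exact: near_dnear (He w wz we).
  have /dnear_cmodP[e [e0 He]] := ord_good on; exists e; split=> //; right.
  split=> [w wz we|]; last exact: ord_not_zero on.
  have [hw fw] := He w wz we; apply: dnear_nz_not_zero.
  exact: near_dnear (near_neq0 (holo_cont hw) fw).
have [e [e0 He]] := H.
have V0 : 0 < cmod v + 1 by rewrite ltr_wpDl ?cmod_ge0.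
have [N HN] := @archi_half R 1 (e / (cmod v + 1)) (divr_gt0 e0 V0).
exists N => n x Nn _ _ px t0 t ht0 ht zt0.
have close (s : R) : x <= s <= x + 1 / 2 ^+ n -> cmod (gam s - gam p) < e.
  move=> hs; have -> : gam s - gam p = v * (s - p)%:C.
    by rewrite /gam; apply: complex_eq; rewrite !(ReB, ReD, ReM, ImB, ImD, ImM)/=; ring.
  rewrite cmodM cmodR.
  have sp : `|s - p| < e / (cmod v + 1).
    by apply: le_lt_trans (HN n Nn); exact: le_itv_dist px hs.
  apply: (@le_lt_trans _ _ ((cmod v + 1) * `|s - p|)).
    by rewrite ler_wpM2r// lerDl.
  by rewrite mulrC -ltr_pdivlMr.
case: He => [He|[He Np]]; first exact/He/close.
have c0 := close _ ht0; clear close; move: zt0 c0; move: (gam t0) => g0 zt0 c0.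
have [E|/eqP ne] := pselect (g0 = gam p); first by case: Np; rewrite -E.
by case: (He _ ne c0).
Qed.

Definition nonzero_mero f := meromorphic f /\ ~ meq f (cst 0).

(** Total version of the order; for a [nonzero_mero] function the default 0 is never taken, by
    [nzm_ord]. *)
Definition ordf f z : int := xget 0 [set n | ord_at f z n].

Lemma ordfE f z n : ord_at f z n -> ordf f z = n.
Proof.
by move=> fo; apply: (xget_unique _ fo) => m mo; exact: ord_unique mo fo.
Qed.

Lemma nzm_ord f z : nonzero_mero f -> ord_at f z (ordf f z).
Proof.
move=> [mf nf]; have [zf|[n on]] := mero_zero_or_ord (mf z).
  by case: nf; exact: identity_theorem zf.
by rewrite (ordfE on).
Qed.

Lemma nzm_of_ord f z n : meromorphic f -> ord_at f z n -> nonzero_mero f.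
Proof. by move=> mf on; split=> // /(_ z); exact: ord_not_zero on. Qed.

Lemma ordf_nonzero f z : holomorphic_at f z -> f z != 0 -> ordf f z = 0.
Proof. by move=> hf fz; apply: ordfE; exact: ord_nonzero. Qed.

Lemma nzmM f g : nonzero_mero f -> nonzero_mero g -> nonzero_mero (fun w => f w * g w).
Proof.
move=> hf hg; apply: (@nzm_of_ord _ 0 (ordf f 0 + ordf g 0)).
  by move=> z; apply: meroM; [case: hf|case: hg].
by apply: ordM; exact: nzm_ord.
Qed.

Lemma nzmV f : nonzero_mero f -> nonzero_mero (fun w => (f w)^-1).
Proof.
move=> hf; apply: (@nzm_of_ord _ 0 (- ordf f 0)); last by apply: ordV; exact: nzm_ord.
by move=> z; apply: meroV; case: hf.
Qed.

Lemma nzmX f k : nonzero_mero f -> nonzero_mero (fun w => f w ^+ k).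
Proof.
move=> hf; apply: (@nzm_of_ord _ 0 (ordf f 0 * k%:Z)); last by apply: ord_exp; exact: nzm_ord.
by move=> z; apply: meroX; case: hf.
Qed.

Lemma ordfM f g z : nonzero_mero f -> nonzero_mero g ->
  ordf (fun w => f w * g w) z = ordf f z + ordf g z.
Proof. by move=> hf hg; apply: ordfE; apply: ordM; exact: nzm_ord. Qed.

Lemma ordfV f z : nonzero_mero f -> ordf (fun w => (f w)^-1) z = - ordf f z.
Proof. by move=> hf; apply: ordfE; apply: ordV; exact: nzm_ord. Qed.

Lemma ordfX f k z : nonzero_mero f -> ordf (fun w => f w ^+ k) z = ordf f z * k%:Z.
Proof. by move=> hf; apply: ordfE; apply: ord_exp; exact: nzm_ord. Qed.

(** Concerns the values of [f] and not its germ: besides zeros and poles it includes points of order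
    0 at which [f] has been given a wrong value. *)
Definition singular f z := ~ (holomorphic_at f z /\ f z != 0).

Lemma ordf_singular f z : ordf f z != 0 -> singular f z.
Proof. by move=> H [hf fz]; move: H; rewrite ordf_nonzero ?eqxx. Qed.

Lemma finite_singular f rho : nonzero_mero f ->
  finite_set [set z | singular f z /\ cmod z <= rho].
Proof.
move=> hf; have [rho0|rho0] := ltP rho 0.
  apply: (sub_finite_set _ (finite_set0 _)) => z /= [_ zr].
  by have := cmod_ge0 z; rewrite leNgt (le_lt_trans zr).
pose l := rho + rho; have l0 : 0 <= l by rewrite addr_ge0.
pose P (x y : R) (n : nat) := finite_set [set z : R[i]^o | singular f z /\
   (x <= complex.Re z <= x + l / 2 ^+ n /\ y <= complex.Im z <= y + l / 2 ^+ n)].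
suff : P (- rho) (- rho) 0%N.
  apply: sub_finite_set => z /= [sz zr]; split=> //.
  have := Re_le_cmod z; have := Im_le_cmod z; rewrite !ler_norml => /andP[? ?] /andP[? ?].
  by rewrite expr0 /l; split; apply/andP; split; lra.
apply: (@bisection _ P (- rho) (- rho) l l l0 l0).
  move=> x y n _ _ _ _ P1 P2 P3 P4.
  have := conj (conj P1 P2) (conj P3 P4); rewrite -!finite_setU; apply: sub_finite_set.
  move=> z [sz [/andP[h1 h2] /andP[h3 h4]]].
  rewrite [l / _ ^+ n]half_powS addrA in h2; rewrite [l / _ ^+ n]half_powS addrA in h4.
  have [a|/ltW a] := leP (complex.Re z) (x + l / 2 ^+ n.+1).
    have [b|/ltW b] := leP (complex.Im z) (y + l / 2 ^+ n.+1).
      by left; left; split=> //; split; exact/andP.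
    by right; left; split=> //; split; exact/andP.
  have [b|/ltW b] := leP (complex.Im z) (y + l / 2 ^+ n.+1).
    by left; right; split=> //; split; exact/andP.
  by right; right; split=> //; split; exact/andP.
move=> p q _ _.
have /dnear_cmodP[e [e0 He]] := ord_good (nzm_ord (p +i* q) hf).
have [N HN] := @archi_half R (l + l) e e0.
exists N => n x y Nn _ _ _ _ px qy; rewrite /P.
apply: (sub_finite_set _ (finite_set1 (p +i* q : R[i]^o))) => z /= [sz [hx hy]].
apply/eqP; apply: contraT => zp; case: sz; apply: He => //.
apply: le_lt_trans (cmod_le_ReIm _) _; rewrite ReB ImB /=.
apply: le_lt_trans (HN n Nn); rewrite mulrDl; apply: lerD.
  exact: le_itv_dist px hx.
exact: le_itv_dist qy hy.
Qed.

(** Removal of singularities: the value at [z] of the holomorphic function that agrees with [F]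
    around [z]. *)
Definition reg F z : R[i]^o := xget 0
  [set c : R[i]^o | exists g, [/\ holomorphic_at g z, \forall w \near z^', F w = g w & g z = c]].

Lemma reg_eq F g z : holomorphic_at g z -> (\forall w \near z^', F w = g w) -> reg F z = g z.
Proof.
move=> hg Fg; apply: xget_unique; first by exists g.
move=> c [h [hh Fh <-]]; apply: eq_at_dnear (holo_cont hh) (holo_cont hg) _.
by apply: dnearS2 Fg Fh => w _ -> ->.
Qed.

Lemma reg_holo_val F z : holomorphic_at F z -> reg F z = F z.
Proof.
by move=> hF; apply: reg_eq => //; apply: near_dnear; apply: nearA.
Qed.

Lemma reg_near F g z : holomorphic_at g z -> (\forall w \near z^', F w = g w) ->
  \forall w \near z, reg F w = g w.
Proof.
move=> hg Fg; have /dnear_cmodP[e [e0 He]] := dnear_near Fg.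
have /near_cmodP[e' [e'0 He']] := holo_near hg.
apply/near_cmodP; exists (Num.min e e'); split; first by rewrite lt_min e0.
move=> w; rewrite lt_min => /andP[w1 w2].
have [->|wz] := eqVneq w z; first exact: reg_eq.
by apply: reg_eq (He' w w2) _; exact: near_dnear (He w wz w1).
Qed.

Lemma reg_good F z : ord_at F z 0 -> holomorphic_at (reg F) z /\ reg F z != 0.
Proof.
move=> [g [hg gz Fg]].
have Fg' : \forall w \near z^', F w = g w.
  by apply: dnearS Fg => w _ ->; rewrite expr0z mulr1.
split; last by rewrite (reg_eq hg Fg').
apply: (holo_eq _ hg); have := reg_near hg Fg'.
by move=> /near_cmodP[e [e0 H]]; apply/near_cmodP; exists e; split=> // w /H.
Qed.

(** On a duplicate-free list, the rational function with the orders of [f] at the listed points; the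
    quotient by it has order 0 there, by [ord_quot]. *)
Definition rprod f (s : seq R[i]^o) w : R[i]^o := \prod_(a <- s) (w - a) ^ (ordf f a).

Lemma ord_linear a z n : ord_at (fun w => (w - a) ^ n) z (if a == z then n else 0).
Proof.
case: eqP => [->|/eqP az].
  exists (fun=> 1); split; [exact: holo_cst|exact: oner_neq0|].
  by apply: near_dnear; apply: nearA => w; rewrite mul1r.
rewrite eq_sym in az; apply: ord_nonzero; first exact: holo_expz.
by rewrite exprz_neq0// subr_eq0.
Qed.

Lemma ord_rprod f s z :
  ord_at (rprod f s) z (\sum_(a <- s) if a == z then ordf f a else 0).
Proof.
elim: s => [|a s IH].
  rewrite big_nil; have := @ord_cst R 1 z (oner_neq0 _); apply: ord_eq.
  by apply: near_dnear; apply: nearA => w; rewrite /rprod big_nil.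
rewrite big_cons; have := ordM (@ord_linear a z (ordf f a)) IH; apply: ord_eq.
by apply: near_dnear; apply: nearA => w; rewrite /rprod big_cons.
Qed.

Lemma sum_pick s z (F : R[i]^o -> int) : uniq s ->
  \sum_(a <- s) (if a == z then F a else 0) = if z \in s then F z else 0.
Proof.
move=> us; case: ifP => zs.
  rewrite (bigD1_seq z)//= eqxx big1 ?addr0// => a az.
  by rewrite (negbTE az).
rewrite big_seq big1// => a as_; case: eqP => // az.
by rewrite -az as_ in zs.
Qed.

Lemma ord_quot f s z : nonzero_mero f -> uniq s -> (ordf f z != 0 -> z \in s) ->
  ord_at (fun w => f w / rprod f s w) z 0.
Proof.
move=> hf us H; have := ordM (nzm_ord z hf) (ordV (ord_rprod f s z)).
rewrite sum_pick//; case: ifP => zs; first by rewrite subrr.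
have -> : ordf f z = 0 by apply/eqP; apply: contraFT zs => /H.
by rewrite subrr.
Qed.

Lemma rprod_neq0 f s w : w \notin s -> rprod f s w != 0.
Proof.
move=> ws; rewrite /rprod prodf_seq_neq0; apply/allP => a as_ /=.
by rewrite exprz_neq0// subr_eq0; apply: contraNneq ws => ->.
Qed.

Lemma rprod_holo f s w : w \notin s -> holomorphic_at (rprod f s) w.
Proof.
elim: s => [|a s IH].
  move=> _; have -> : rprod f [::] = fun=> 1 by apply/funext => v; rewrite /rprod big_nil.
  exact: holo_cst.
rewrite inE negb_or => /andP[wa ws].
have -> : rprod f (a :: s) = fun v => (v - a) ^ ordf f a * rprod f s v.
  by apply/funext => v; rewrite /rprod big_cons.
exact: holoM (holo_expz _ wa) (IH ws).
Qed.

Lemma singular_seq f rho : nonzero_mero f ->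
  exists s, uniq s /\ forall z, z \in s <-> singular f z /\ cmod z <= rho.
Proof.
move=> hf; have /finite_seqP[s sE] := finite_singular rho hf.
exists (undup s); split; first exact: undup_uniq.
by move=> z; rewrite mem_undup; have := congr1 (fun A => A z) sE => /= ->.
Qed.

End Meromorphic.

(** * Zero-free functions *)

Section ZeroFree.
Variable R : realType.
Implicit Types (r s t e M rho : R) (z w d c a : R[i]^o) (f g h F G : R[i]^o -> R[i]^o).

Definition lnmod g w : R := ln (cmod (g w)).

Definition logder g w : R[i]^o := g^`()%classic w / g w.

Definition zfree g rho := forall w, cmod w <= rho -> holomorphic_at g w /\ g w != 0.

Lemma ln_sqr_cmod w : ln (complex.Re w ^+ 2 + complex.Im w ^+ 2) = 2 * ln (cmod w).
Proof.
have -> : complex.Re w ^+ 2 + complex.Im w ^+ 2 = cmod w ^+ 2.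
  by rewrite cmodE sqr_sqrtr// addr_ge0// sqr_ge0.
(* At 0 both sides vanish, since [ln] takes the value 0 there. *)
have [->|w0] := eqVneq w 0; first by rewrite cmod0 expr0n ln0// mulr0.
by rewrite lnXn ?cmod_gt0// mulr_natl.
Qed.

(** [log |g|] is the real part of a local logarithm of [g]. Differentiating half the logarithm of
    [Re^2 + Im^2] avoids the choice of a branch. *)
Lemma is_derive_lnmod (k : R -> R[i]^o) t v g : cderive k t v ->
  holomorphic_at g (k t) -> g (k t) != 0 ->
  is_derive t 1 (fun s => lnmod g (k s)) (complex.Re (logder g (k t) * v)).
Proof.
move=> dk hg g0; have D := cderive_comp dk (holo_is_derive hg).
have D1 := cderive_Re D; have D2 := cderive_Im D; cbv beta in D1, D2.
have E : (fun s => lnmod g (k s)) = fun s => 2^-1 *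
    ln (complex.Re (g (k s)) ^+ 2 + complex.Im (g (k s)) ^+ 2).
  by apply/funext => s; rewrite ln_sqr_cmod mulKf.
rewrite E.
have N0 : 0 < complex.Re (g (k t)) ^+ 2 + complex.Im (g (k t)) ^+ 2.
  rewrite -(@sqr_sqrtr _ (_ + _)) ?addr_ge0 ?sqr_ge0// -cmodE exprn_gt0//.
  by rewrite cmod_gt0.
set a := complex.Re _ in D1; set b := complex.Im _ in D2.
have D3 : is_derive t 1 (fun s => complex.Re (g (k s)) ^+ 2 + complex.Im (g (k s)) ^+ 2)
    (2 * complex.Re (g (k t)) * a + 2 * complex.Im (g (k t)) * b).
  by apply: is_derive_eq (is_deriveD (is_deriveX 2 D1) (is_deriveX 2 D2)) _;
    rewrite /GRing.scale/= !expr1.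
have D4 := @is_derive1_comp _ (@ln R) _ t _ _ (is_derive1_ln N0) D3.
have D5 := @is_deriveZ _ _ _ _ (2^-1) t 1 _ D4.
apply: is_derive_eq D5 _.
have -> : logder g (k t) * v = g^`()%classic (k t) * v / g (k t) by rewrite /logder mulrAC.
rewrite /a /b; move: N0; move: (_ * v) (g (k t)) => x [p q] /= N0.
rewrite ReM /= /GRing.scale/=.
by field; rewrite gt_eqF.
Qed.

Lemma bounded_on_disc F rho : 0 <= rho ->
  (forall w, cmod w <= rho -> {for w, continuous F}) ->
  exists M, 0 <= M /\ forall w, cmod w <= rho -> cmod (F w) <= M.
Proof.
move=> rho0 cF; pose l := rho + rho; have l0 : 0 <= l by rewrite addr_ge0.
pose P (x y : R) (n : nat) := exists M, 0 <= M /\ forall w, cmod w <= rho ->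
  x <= complex.Re w <= x + l / 2 ^+ n -> y <= complex.Im w <= y + l / 2 ^+ n ->
  cmod (F w) <= M.
suff : P (- rho) (- rho) 0%N.
  move=> [M [M0 HM]]; exists M; split=> // w wr; apply: HM => //; rewrite expr0 /l;
  have := Re_le_cmod w; have := Im_le_cmod w; rewrite !ler_norml => /andP[? ?] /andP[? ?];
  by apply/andP; split; lra.
apply: (@bisection _ P (- rho) (- rho) l l l0 l0).
  move=> x y n _ _ _ _ [M1 [h1 H1]] [M2 [h2 H2]] [M3 [h3 H3]] [M4 [h4 H4]].
  exists (M1 + M2 + M3 + M4); split; first by rewrite !addr_ge0.
  move=> w wr; rewrite [l / _ ^+ n]half_powS !addrA => /andP[x1 x2] /andP[y1 y2].
  have [a|/ltW a] := leP (complex.Re w) (x + l / 2 ^+ n.+1);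
    have [b|/ltW b] := leP (complex.Im w) (y + l / 2 ^+ n.+1).
  - by apply: le_trans (H1 w wr _ _) _; [exact/andP|exact/andP|lra].
  - by apply: le_trans (H3 w wr _ _) _; [exact/andP|exact/andP|lra].
  - by apply: le_trans (H2 w wr _ _) _; [exact/andP|exact/andP|lra].
  - by apply: le_trans (H4 w wr _ _) _; [exact/andP|exact/andP|lra].
move=> p q _ _; have [pr|pr] := leP (cmod (p +i* q : R[i]^o)) rho.
  have /ccontP/(_ _ (@ltr01 R))[e [e0 He]] := cF _ pr.
  have [N HN] := @archi_half R (l + l) e e0.
  exists N => n x y Nn _ _ _ _ px qy; exists (cmod (F (p +i* q)) + 1).
  split; first by rewrite addr_ge0 ?cmod_ge0.
  move=> w wr hx hy.
  have wp : cmod (w - p +i* q) < e.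
    apply: le_lt_trans (cmod_le_ReIm _) _; rewrite ReB ImB /=.
    apply: le_lt_trans (HN n Nn); rewrite mulrDl; apply: lerD.
      exact: le_itv_dist px hx.
    exact: le_itv_dist qy hy.
  by have := cmod_sub_ge (F w) (F (p +i* q)); have := He w wp; lra.
(* Small squares around a point outside the disc miss the disc, and the bound is vacuous. *)
have pe : 0 < cmod (p +i* q : R[i]^o) - rho by rewrite subr_gt0.
have [N HN] := @archi_half R (l + l) _ pe.
exists N => n x y Nn _ _ _ _ px qy; exists 0; split=> // w wr hx hy; exfalso.
have wp : cmod (w - p +i* q) < cmod (p +i* q : R[i]^o) - rho.
  apply: le_lt_trans (cmod_le_ReIm _) _; rewrite ReB ImB /=.
  apply: le_lt_trans (HN n Nn); rewrite mulrDl; apply: lerD.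
    exact: le_itv_dist px hx.
  exact: le_itv_dist qy hy.
by have := cmod_sub_ge (p +i* q : R[i]^o) w; rewrite cmodB; lra.
Qed.

Lemma zfreeW g rho r : r <= rho -> zfree g rho -> zfree g r.
Proof. by move=> rr zg w wr; apply: zg; exact: le_trans rr. Qed.

Lemma logder_holo g z : holomorphic_at g z -> g z != 0 -> holomorphic_at (logder g) z.
Proof. by move=> hg g0; exact: holoM (holo_derive hg) (holoV hg g0). Qed.

Lemma holo_on_of F rho : (forall w, cmod w <= rho -> holomorphic_at F w) -> holo_on F rho.
Proof. by move=> hF w /hF/holo_is_derive; eexists; eassumption. Qed.

Lemma oncirc_lnmod g r : 0 <= r -> (forall w, cmod w = r -> holomorphic_at g w /\ g w != 0) ->
  oncirc (lnmod g) r.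
Proof.
move=> r0 zg t; have [|hg g0] := zg (circle_pt r t); first exact: cmod_circle.
by have [D _] := is_derive_lnmod (@cderive_circle R r t) hg g0;
  exact/differentiable_continuous/derivable1_diffP.
Qed.

Lemma zfree_oncirc g rho r : zfree g rho -> 0 <= r <= rho -> oncirc (lnmod g) r.
Proof.
by move=> zg /andP[r0 rr]; apply: oncirc_lnmod => // w wr; apply: zg; rewrite wr.
Qed.

End ZeroFree.

Section ZeroFreeMean.
Variable R : realType.
Implicit Types (r s t e M rho : R) (z w d c a : R[i]^o) (f g h F G : R[i]^o -> R[i]^o).
Notation mu := (@lebesgue_measure R).

Lemma zero_derive_cst (A : R -> R) (a b : R) : a <= b ->
  (forall t, a <= t <= b -> is_derive t 1 A 0) -> A a = A b.
Proof.
move=> ab dA; apply/eqP; rewrite eq_sym -subr_eq0; apply/eqP.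
by rewrite -(itg_FTC ab (@within_cst R R a b 0) dA) itg_cst// mul0r.
Qed.

Lemma circle_pt1 r t : circle_pt r t = (r%:C : R[i]^o) * circle_pt 1 t.
Proof. by apply: complex_eq; rewrite ?ReM ?ImM /=; ring. Qed.

Lemma ReZ r z : complex.Re ((r%:C : R[i]^o) * z) = r * complex.Re z.
Proof. by rewrite ReM /= mul0r subr0. Qed.

(** Under the integral sign the radial derivative of [log |g|] is [r^-1] times the real part of
    [w g'/g], whose mean over the circle is its value 0 at the origin. *)
Lemma avg_lnmod_derive g rho r : zfree g rho -> 0 < r < rho ->
  is_derive r 1 (fun x => itg 0 (2 * pi) (fun t => lnmod g (circle_pt x t))) 0.
Proof.
move=> zg /andP[r0 rr]; have rho0 := lt_trans r0 rr.
pose f x t := lnmod g (circle_pt x t).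
have in_rho x : `]0, rho[%classic x -> 0 <= x <= rho.
  by rewrite /= in_itv/= => /andP[/ltW -> /ltW ->].
have d1 x t : `]0, rho[%classic x ->
    is_derive x 1 (f ^~ t) (complex.Re (logder g (circle_pt x t) * circle_pt 1 t)).
  move=> /in_rho /andP[x0 xr].
  have [|hg g0] := zg (circle_pt x t); first by rewrite cmod_circle.
  exact: is_derive_lnmod (@cderive_radius R x t) hg g0.
have hL w : cmod w <= rho -> holomorphic_at (logder g) w.
  by move=> /zg[hg g0]; exact: logder_holo.
have [M [M0 HM]] := bounded_on_disc (ltW rho0) (fun w wr => holo_cont (hL w wr)).
have intf x : `]0, rho[%classic x -> mu.-integrable `[0, 2 * pi] (EFin \o f x).
  move=> /in_rho hx; apply: itg_integrable.
  exact: (oncirc_within (zfree_oncirc zg hx)).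
have derf x t : `]0, rho[%classic x -> `[0, 2 * pi]%classic t -> derivable (f ^~ t) x 1.
  by move=> /(d1 x t)[].
have intM : mu.-integrable `[0, 2 * pi] (EFin \o (fun _ : R => M)).
  exact: itg_integrable (@within_cst R R _ _ M).
have ub x t : `]0, rho[%classic x -> `[0, 2 * pi]%classic t -> `|partial1of2 f x t| <= M.
  move=> hx _; have [_ dE] := d1 x t hx; rewrite partial1of2E dE.
  apply: le_trans (Re_le_cmod _) _; rewrite cmodM cmod_circle// mulr1; apply: HM.
  by have /andP[x0 xr] := in_rho x hx; rewrite cmod_circle.
have Ir : `]0, rho[%classic r by rewrite /= in_itv/= r0.
have D := @differentiation_under_integral R _ _ mu f `[0, 2 * pi] (measurable_itv _)
  r 0 rho Ir intf derf (fun=> M) (fun=> M0) intM ub.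
have D' : derivable (fun x => \int[mu]_(t in `[0, 2 * pi]) f x t) r 1.
  move=> A; exact: (@derivable_under_integral R _ _ mu f `[0, 2 * pi] (measurable_itv _)
    r 0 rho Ir intf derf (fun=> M) (fun=> M0) intM ub A).
split; first exact: D'.
rewrite -derive1E [LHS]D.
have oL : oncirc (fun w => logder g w * w) r.
  apply: oncirc_for (ltW r0) _ => w wr.
  by apply: holo_cont; apply: holoM (@holo_id _ _); apply: hL; rewrite wr ltW.
have MV : cavg (fun w => logder g w * w) r = 0.
  rewrite (@mean_value _ (fun w => logder g w * w) 0 r (ltW r0)); first by rewrite mulr0.
    move=> w wr; apply: holo_cont; apply: holoM (@holo_id _ _); apply: hL.
    exact: le_trans wr (ltW rr).
  move=> w wr _; eexists; apply: holo_is_derive; apply: holoM (@holo_id _ _).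
  by apply: hL; exact: le_trans wr (ltW rr).
have := congr1 (@complex.Re R) MV; rewrite cavg_Re /avg /= => /eqP.
rewrite mulf_eq0 invr_eq0 gt_eqF ?pi2_gt0//= => /eqP I0.
apply: (mulfI (lt0r_neq0 r0)); rewrite mulr0 -[RHS]I0 /itg.
have cE : {within `[0, 2 * pi], continuous (fun t => complex.Re
    (logder g (circle_pt r t) * circle_pt r t))}.
  apply: within_Re; exact: oncirc_within oL.
have E t : partial1of2 f r t = r^-1 * complex.Re (logder g (circle_pt r t) * circle_pt r t).
  have [_ dE] := d1 r t Ir; rewrite partial1of2E dE.
  move: (logder g _) => Lg; rewrite (circle_pt1 r) mulrCA ReZ mulKf//.
  by rewrite gt_eqF.
have -> : \int[mu]_(t in `[0, 2 * pi]) partial1of2 f r t = itg 0 (2 * pi)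
    (fun t => r^-1 * complex.Re (logder g (circle_pt r t) * circle_pt r t)).
  by apply: eq_Rintegral => t _; exact: E.
by rewrite (itgZ r^-1 cE) mulrA divff ?mul1r// gt_eqF.
Qed.

(** By [avg_lnmod_derive] the mean is constant on the open range of radii. Both ends, 0 and [rho],
    are reached with [cavg_limit], for which [log |g|] is viewed as a complex function. *)
Theorem avg_lnmod_zfree g rho : 0 < rho -> zfree g rho ->
  avg (lnmod g) rho = lnmod g 0.
Proof.
move=> rho0 zg; pose F w : R[i]^o := (lnmod g w)%:C.
have z0 : cmod (0 : R[i]^o) <= rho by rewrite cmod0 ltW.
have cF w : cmod w <= rho -> {for w, continuous F}.
  move=> wr; have [hg g0] := zg w wr.
  have c0 : {for w, continuous (fun _ : R[i]^o => 0 : R)} by exact: cst_continuous.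
  have c1 : {for w, continuous (fun v => cmod (g v))}.
    by apply: continuous_comp; [exact: holo_cont|exact: continuous_cmod].
  have c2 : {for w, continuous (lnmod g)}.
    apply: (@continuous_comp _ _ _ (fun v => cmod (g v)) (@ln R)) => //.
    by apply: continuous_ln; rewrite cmod_gt0.
  exact: (@curve_contP R _ F w c2 c0).
have cE r : cavg F r = (avg (lnmod g) r)%:C.
  apply: complex_eq; first by rewrite cavg_Re.
  rewrite /cavg ImM /= mul0r addr0 [itg _ _ _](_ : _ = 0) ?mulr0//.
  by rewrite itg_cst ?pi2_ge0// mul0r.
have cst r1 r2 : 0 < r1 -> r1 <= r2 -> r2 < rho -> avg (lnmod g) r1 = avg (lnmod g) r2.
  move=> r10 r12 r2r; congr (_ * _).
  apply: (@zero_derive_cst (fun x => itg 0 (2 * pi) (fun t => lnmod g (circle_pt x t))) _ _ r12).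
  move=> t /andP[t1 t2]; apply: (avg_lnmod_derive zg).
  by rewrite (lt_le_trans r10) ?(le_lt_trans t2).
have H : cavg F 0 = (avg (lnmod g) (rho / 2))%:C.
  apply: cavg_limit => //; first by move=> w wr; apply: cF; rewrite wr ltW.
  move=> h h0; exists (Num.min (h / 2) (rho / 2)).
  have m0 : 0 < Num.min (h / 2) (rho / 2) by rewrite lt_min !divr_gt0.
  have mr : Num.min (h / 2) (rho / 2) <= rho / 2 by rewrite ge_min lexx orbT.
  have r2 : rho / 2 < rho by rewrite ltr_pdivrMr// ltr_pMr// ltr1n.
  split; first exact: ltW.
  - rewrite subr0 gtr0_norm//; apply: (@le_lt_trans _ _ (h / 2)).
      by rewrite ge_min lexx.
    by rewrite ltr_pdivrMr// ltr_pMr// ltr1n.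
  - apply: oncirc_for (ltW m0) _ => w wr; apply: cF; rewrite wr.
    exact: le_trans mr (ltW r2).
  - by rewrite cE; congr (_%:C); exact: cst.
have H2 : cavg F rho = (avg (lnmod g) (rho / 2))%:C.
  apply: cavg_limit; [exact: ltW|by move=> w wr; apply: cF; rewrite wr|].
  move=> h h0; exists (Num.max (rho / 2) (rho - h / 2)).
  have r2 : rho / 2 < rho by rewrite ltr_pdivrMr// ltr_pMr// ltr1n.
  have h2 : 0 < h / 2 by rewrite divr_gt0.
  have mr : Num.max (rho / 2) (rho - h / 2) < rho by rewrite gt_max r2 ltrBlDr ltrDl.
  have m2 : rho / 2 <= Num.max (rho / 2) (rho - h / 2) by rewrite le_max lexx.
  have m0 : 0 < rho / 2 by rewrite divr_gt0.
  split.
  - exact: le_trans (ltW m0) m2.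
  - rewrite distrC ger0_norm ?subr_ge0 ?(ltW mr)//.
    have : rho - h / 2 <= Num.max (rho / 2) (rho - h / 2) by rewrite le_max lexx orbT.
    by lra.
  - apply: oncirc_for (le_trans (ltW m0) m2) _ => w wr; apply: cF; rewrite wr.
    exact: ltW.
  - by rewrite cE; congr (_%:C); apply/esym; exact: cst.
have F0 : cavg F 0 = F 0.
  rewrite -[RHS](cavg_cst _ 0); apply: eq_cavg => // w /eqP; rewrite cmod_eq0 => /eqP ->//.
by have := H2; rewrite -H F0 cE => -[].
Qed.

(** If [a] lies inside, [|w - a|] equals [|r^2 - conj(a) w| / r] on the circle and the reflected
    factor is zero-free; if [a] lies outside, [w - a] is zero-free itself. *)
Lemma avg_ln_linear a r : 0 < r -> cmod a != r ->
  avg (fun w => ln (cmod (w - a))) r = ln (Num.max r (cmod a)).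
Proof.
move=> r0; rewrite neq_lt => /orP[ar|ra].
  pose g w : R[i]^o := (r ^+ 2)%:C - (conjc (a : R[i]) : R[i]^o) * w.
  have zg : zfree g r.
    move=> w wr; split; last exact: reflect_neq0.
    exact: holoB (@holo_cst R _ w) (holoM (@holo_cst R _ w) (@holo_id R w)).
  have E w : cmod w = r -> ln (cmod (w - a)) = lnmod g w - ln r.
    move=> wr; have w0 : w != 0 by rewrite -cmod_gt0 wr.
    have -> : w - a = conjc ((g w / w : R[i]^o) : R[i]).
      rewrite /g mulrBl -(circle_conj r0 wr) mulfK// -conjB.
      by rewrite conjcK.
    rewrite cmodJ cmodf wr ln_div ?posrE//.
    by rewrite cmod_gt0 reflect_neq0// wr.
  have og := zfree_oncirc zg (_ : 0 <= r <= r).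
  rewrite (eq_avg (ltW r0) E) (@avgB R (lnmod g) (fun=> ln r)); first last.
  - by move=> t; exact: cvg_cst.
  - by apply: og; rewrite lexx ltW.
  rewrite avg_cst avg_lnmod_zfree// /lnmod /g mulr0 subr0 cmodR ger0_norm ?exprn_ge0 ?(ltW r0)//.
  by rewrite lnXn// mulr2n addrK max_l// ltW.
have zg : zfree (fun w => w - a) r.
  move=> w wr; split; first exact: holo_sub.
  by rewrite subr_eq0; apply: contraTneq ra => <-; rewrite -leNgt.
have := avg_lnmod_zfree r0 zg; rewrite /lnmod sub0r cmodN => ->.
by rewrite max_r// ltW.
Qed.

End ZeroFreeMean.

(** * The logarithmic derivative of a zero-free function *)

Section LogDerivative.
Variable R : realType.
Implicit Types (r s t e M rho : R) (z w d c a u v : R[i]^o) (f g h F G : R[i]^o -> R[i]^o).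

Lemma cderiveM (f g : R -> R[i]^o) t u v : cderive f t u -> cderive g t v ->
  cderive (fun s => f s * g s) t (f t * v + g t * u).
Proof.
move=> df dg.
have f1 := cderive_Re df; have f2 := cderive_Im df.
have g1 := cderive_Re dg; have g2 := cderive_Im dg.
apply: cderiveP.
  have -> : (fun s => complex.Re (f s * g s)) = fun s =>
      complex.Re (f s) * complex.Re (g s) - complex.Im (f s) * complex.Im (g s).
    by apply/funext => s; rewrite ReM.
  apply: is_derive_eq (is_deriveB (is_deriveM f1 g1) (is_deriveM f2 g2)) _.
  by rewrite ReD !ReM /GRing.scale/=; ring.
have -> : (fun s => complex.Im (f s * g s)) = fun s =>
    complex.Re (f s) * complex.Im (g s) + complex.Im (f s) * complex.Re (g s).
  by apply/funext => s; rewrite ImM.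
apply: is_derive_eq (is_deriveD (is_deriveM f1 g2) (is_deriveM f2 g1)) _.
by rewrite ImD !ImM /GRing.scale/=; ring.
Qed.

Lemma cderive_real (f : R -> R) t (d : R) : is_derive t 1 f d ->
  cderive (fun s => (f s)%:C) t (d%:C).
Proof. by move=> df; apply: cderiveP => //=; exact: is_derive_cst. Qed.

Lemma oncirc_cplx (F : R[i]^o -> R) r : oncirc F r -> oncirc (fun w => (F w)%:C : R[i]^o) r.
Proof.
move=> cF t.
have c0 : {for t, continuous (fun _ : R => 0 : R)} by exact: cst_continuous.
exact: (@curve_contP R _ (fun t => (F (circle_pt r t))%:C) t (cF t) c0).
Qed.

Lemma oncirc_Re F r : oncirc F r -> oncirc (fun w => complex.Re (F w)) r.
Proof.
move=> cF t; apply: (@continuous_comp _ _ _ (fun t : R => F (circle_pt r t)) (@complex.Re R)).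
  exact: cF.
exact: continuous_Re.
Qed.

Definition lnc g w : R[i]^o := (lnmod g w)%:C.

(* Integrating by parts on the circle turns the Cauchy integral of [g'/g] into
   an integral of [log |g|]; the conjugate of [g'/g] does not contribute, by
   reflection. *)
Theorem logder_formula g rho z : 0 < rho -> zfree g rho -> cmod z < rho ->
  logder g z = 2 * cavg (fun w => lnc g w * w / (w - z) ^+ 2) rho.
Proof.
move=> rho0 zg zr; set L := logder g.
have hL w : cmod w <= rho -> holomorphic_at L w.
  by move=> /zg[hg g0]; exact: logder_holo.
have rr : 0 <= rho <= rho by rewrite lexx ltW.
have nz w : cmod w = rho -> w - z != 0 by move=> wr; exact: sub_neq0 zr.
have cs : oncirc (fun w => (w - z)^-1) rho.
  exact: oncirc_cplxV (ltW rho0) (@oncirc_sub R rho z) nz.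
have cs2 : oncirc (fun w => (w - z)^-1 * (w - z)^-1) rho := oncirc_cplxM cs cs.
have cid := @oncirc_id R rho.
have hLw w : cmod w <= rho -> holomorphic_at (fun w => L w * w) w.
  by move=> wr; exact: holoM (hL w wr) (@holo_id R w).
have cLw : oncirc (fun w => L w * w) rho := holo_on_oncirc (holo_on_of hLw) rr.
have cu : oncirc (fun w => lnc g w) rho := oncirc_cplx (zfree_oncirc zg rr).
pose J : R[i]^o := 'i%C.
have cLi : oncirc (fun w => J * (L w * w)) rho := oncirc_scale cLw.
pose A w : R[i]^o := (complex.Re (J * (L w * w)))%:C.
have cA : oncirc A rho := oncirc_cplx (oncirc_Re cLi).
have cA1 : oncirc (fun w => A w / (w - z)) rho := oncirc_cplxM cA cs.
have cB : oncirc (fun w => lnc g w * w * ((w - z)^-1 * (w - z)^-1)) rho :=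
  oncirc_cplxM (oncirc_cplxM cu cid) cs2.
have cB2 : oncirc (fun w => J * (lnc g w * w * ((w - z)^-1 * (w - z)^-1))) rho :=
  oncirc_scale cB.
have cAB := oncirc_cplxD cA1 (oncirc_cplxN cB2).
(* [U] is periodic, so its derivative has mean 0; that derivative is [A w / (w - z)] minus [i] times
   the integrand of the formula. *)
pose U t : R[i]^o := lnc g (circle_pt rho t) * (circle_pt rho t - z)^-1.
have dU t : cderive U t (A (circle_pt rho t) / (circle_pt rho t - z) -
    J * (lnc g (circle_pt rho t) * circle_pt rho t *
      ((circle_pt rho t - z)^-1 * (circle_pt rho t - z)^-1))).
  have wr := cmod_circle t (ltW rho0).
  have wr' : cmod (circle_pt rho t) <= rho by rewrite wr.
  have [hg g0] := zg _ wr'.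
  have d1 := cderive_real (is_derive_lnmod (@cderive_circle R rho t) hg g0).
  have d2 := is_derive_invc (is_derive_subc (is_derive_idc (circle_pt rho t))
    (is_derive_cstc z (circle_pt rho t))) (nz _ wr).
  have d3 := cderive_comp (@cderive_circle R rho t) d2.
  have := cderiveM d1 d3; congr cderive.
  have -> : A (circle_pt rho t) = (complex.Re (logder g (circle_pt rho t) * (J * circle_pt rho t)))%:C.
    by rewrite /A mulrCA.
  rewrite subr0 expr2 invfM !mulNr mul1r mulrN addrC; congr (_ - _); first by rewrite mulrC.
  rewrite -/(lnc g (circle_pt rho t)) -/J.
  set x := (circle_pt rho t - z)^-1; set y := lnc g _; clearbody x y J.
  by ring.
have I0 : cavg (fun w => A w / (w - z) - J * (lnc g w * w * ((w - z)^-1 * (w - z)^-1))) rho = 0.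
  have FT := @citg_FTC R 0 (2 * pi) U _ (pi2_ge0 R) (oncirc_within cAB)
    (fun t _ => cderive_Re (dU t)) (fun t _ => cderive_Im (dU t)).
  by rewrite /cavg [citg _ _ _]FT /U circle_pt_2pi subrr mulr0.
rewrite (cavgB cA1 cB2) (cavgZ _ cB) in I0.
have CL : cavg (fun w => J * (L w * w / (w - z))) rho = J * L z.
  rewrite (cavgZ _ (oncirc_cplxM cLw cs)); congr (_ * _).
  exact: cauchy_formula (holo_on_of hL) zr.
have CJ : cavg (fun w => (conjc (J * (L w * w) : R[i]) : R[i]^o) / (w - z)) rho = 0.
  (* The conjugate of the integrand, made holomorphic by [conj w = rho^2 / w]; it vanishes at 0. *)
  pose H w : R[i]^o := J * (L w * w * w / ((rho ^+ 2)%:C - (conjc (z : R[i]) : R[i]^o) * w)).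
  have hH w : cmod w <= rho -> holomorphic_at H w.
    move=> wr; have n0 := reflect_neq0 wr zr.
    have h1 : holomorphic_at (fun w => (rho ^+ 2)%:C - (conjc (z : R[i]) : R[i]^o) * w) w.
      exact: holoB (@holo_cst R _ w) (holoM (@holo_cst R _ w) (@holo_id R w)).
    exact: holoM (@holo_cst R _ w) (holoM (holoM (hLw w wr) (@holo_id R w)) (holoV h1 n0)).
  have oH : oncirc H rho := holo_on_oncirc (holo_on_of hH) rr.
  transitivity (cavg (fun w => conjc (H w : R[i]) : R[i]^o) rho).
    apply: eq_cavg (ltW rho0) _ => w wr.
    have w0 : w != 0 by rewrite -cmod_gt0 wr.
    have wr' : cmod w <= rho by rewrite wr.
    have n0 := reflect_neq0 wr' zr.
    have -> : H w = J * (L w * w) / conjc ((w - z : R[i]^o) : R[i]).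
      rewrite conjB (circle_conj rho0 wr) /H.
      move: n0; set b : R[i]^o := (rho ^+ 2)%:C; set c : R[i]^o := conjc _ => n0.
      clearbody b c; have -> : b / w - c = (b - c * w) / w by rewrite mulrBl mulfK.
      by rewrite invf_div !mulrA.
    by rewrite [in RHS]conjM conjV conjcK.
  rewrite (cavg_conj oH) (@mean_value R H 0 rho (ltW rho0)).
  - by rewrite /H mulr0 mul0r mulr0 conjc0.
  - by move=> w /hH/holo_cont.
  - by move=> w /hH/holo_is_derive D _; eexists; exact: D.
(* Twice the real part is the sum of the number and its conjugate, and only the first summand has a
   non-zero mean; this is the factor 2 of the formula. *)
have CA : 2 * cavg (fun w => A w / (w - z)) rho = J * L z.
  rewrite -(cavgZ 2 cA1) -[RHS]addr0 -CJ -CL.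
  have c1 : oncirc (fun w => J * (L w * w / (w - z))) rho.
    exact: oncirc_scale (oncirc_cplxM cLw cs).
  have c2 : oncirc (fun w => (conjc (J * (L w * w) : R[i]) : R[i]^o) / (w - z)) rho.
    exact: oncirc_cplxM (oncirc_conj cLi) cs.
  rewrite -(cavgD c1 c2); apply: eq_cavg (ltW rho0) _ => w wr.
  rewrite mulrA [X in _ = X + _]mulrA -mulrDl; congr (_ / _); rewrite /A.
  by rewrite -addcJ.
have i0 : J != 0 by rewrite /J eq_complex /= oner_eq0 andbF.
apply: (mulfI i0); rewrite -CA.
move/eqP: I0; rewrite subr_eq0 => /eqP ->; rewrite [LHS]mulrCA; congr (_ * (_ * _)).
apply: eq_cavg (ltW rho0) _ => w wr.
by rewrite expr2 invfM.
Qed.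

(** The factor 4 is the 2 of [logder_formula] times the 2 of [cavg_le]; [cmod (w - z)] is at least
    [rho - cmod z]. *)
Lemma logder_bound g rho z : 0 < rho -> zfree g rho -> cmod z < rho ->
  cmod (logder g z) <= 4 * rho / (rho - cmod z) ^+ 2 * avg (fun w => `|lnmod g w|) rho.
Proof.
move=> rho0 zg zr; rewrite (logder_formula rho0 zg zr) cmodM.
have rr : 0 <= rho <= rho by rewrite lexx ltW.
have eta : 0 < rho - cmod z by rewrite subr_gt0.
have nz w : cmod w = rho -> (w - z) ^+ 2 != 0.
  by move=> wr; rewrite expf_neq0// (sub_neq0 wr zr).
have cs : oncirc (fun w => ((w - z) ^+ 2)^-1) rho.
  exact: oncirc_cplxV (ltW rho0) (@oncirc_exp R 2 _ _ (@oncirc_sub R rho z)) nz.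
have cu := zfree_oncirc zg rr.
have cI : oncirc (fun w => lnc g w * w / (w - z) ^+ 2) rho.
  exact: oncirc_cplxM (oncirc_cplxM (oncirc_cplx cu) (@oncirc_id R rho)) cs.
have ca : oncirc (fun w => `|lnmod g w|) rho by move=> t; apply: cvg_norm; exact: cu.
have -> : cmod (2 : R[i]^o) = 2.
  have -> : (2 : R[i]^o) = (2 : R)%:C by rewrite -(rmorph_nat (real_complex R)).
  by rewrite cmodR gtr0_norm.
apply: (@le_trans _ _ (2 * (2 * avg (fun w => cmod (lnc g w * w / (w - z) ^+ 2)) rho))).
  by rewrite ler_pM2l//; exact: cavg_le.
have -> : 4 * rho / (rho - cmod z) ^+ 2 * avg (fun w => `|lnmod g w|) rho =
  2 * (2 * (rho / (rho - cmod z) ^+ 2 * avg (fun w => `|lnmod g w|) rho)).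
  by field; rewrite gt_eqF.
rewrite !ler_pM2l// -avgZ//; apply: avg_le (ltW rho0) (oncirc_cmod cI) _ _.
  by move=> t; apply: cvgM; [exact: cvg_cst|exact: ca].
move=> w wr; rewrite cmodf cmodM cmodX /lnc cmodR wr.
rewrite -mulrA [leLHS]mulrC ler_wpM2r// ler_wpM2l ?(ltW rho0)//.
have zw : rho - cmod z <= cmod (w - z) by have := cmod_sub_ge w z; rewrite wr.
rewrite lef_pV2 ?posrE ?exprn_gt0// ?lerXn2r// ?nnegrE ?cmod_ge0 ?(ltW eta)//.
exact: lt_le_trans zw.
Qed.

End LogDerivative.

(** * Jensen's formula *)

Section Counting.
Variable R : realType.
Notation mu := (@lebesgue_measure R).
Implicit Types (r t M rho : R) (s : seq R[i]^o) (z w a : R[i]^o)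
  (f g : R[i]^o -> R[i]^o) (D E : R[i]^o -> R).

Definition count_div D t : R := \sum_(z \in [set z : R[i]^o | cmod z <= t]) D z.

(** The counting functional for arbitrary real divisors, signed ones included: pole divisors, order
    divisors, their absolute values and indicators are all treated by one linear functional. *)
Definition Ndiv D : R -> R := integrated (count_div D).

(* the contribution of a point [z] of multiplicity one to N(r) *)
Definition lam r z : R :=
  if z == 0 then ln r else if cmod z <= r then ln r - ln (cmod z) else 0.

(** The list may contain points outside the support, so that one list can serve two divisors. *)
Definition carries s D r := uniq s /\ forall z, D z != 0 -> cmod z <= r -> z \in s.

Lemma count_divE s D r t : carries s D r -> t <= r ->
  count_div D t = \sum_(z <- s | cmod z <= t) D z.
Proof.
move=> [us Hs] tr; rewrite (@bigfs _ _ _ _ s (fun z => cmod z <= t) D us)//.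
move=> z zt zs; apply/eqP; apply: contraNT zs => Dz.
by apply: Hs => //; exact: le_trans tr.
Qed.

Lemma eq_int_oc r (u v : R -> R) : (forall t, t \in `]0, r]%classic -> u t = v t) ->
  \int[mu]_(t in `]0, r]) u t = \int[mu]_(t in `]0, r]) v t.
Proof. by move=> uv; apply: eq_Rintegral => t; exact: uv. Qed.

(** What one point adds to [(n t - n 0) / t]. The origin adds nothing here, as it is accounted for
    by [n 0 * ln r]. *)
Let kern z t : R := if (0 < cmod z) && (cmod z <= t) then t^-1 else 0.

Let kern_int r z : 0 < r -> mu.-integrable `]0, r] (EFin \o kern z) /\
  \int[mu]_(t in `]0, r]) kern z t = if z == 0 then 0 else lam r z.
Proof.
move=> r0; have [->|z0] := eqVneq z 0.
  have E : kern 0 = fun=> 0 by apply/funext => t; rewrite /kern cmod0 ltxx.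
  rewrite E; split; last by rewrite /Rintegral integral0.
  exact: integrable0.
have zp : 0 < cmod z by rewrite cmod_gt0.
rewrite /lam (negbTE z0); case: leP => zr; last first.
  have E t : t \in `]0, r]%classic -> kern z t = 0.
    rewrite inE/= in_itv/= => /andP[_ tr]; rewrite /kern zp/= leNgt.
    by rewrite (le_lt_trans tr).
  split.
    apply: (@eq_integrable _ _ _ mu _ _ (fun=> 0%E)) => // [|].
      by move=> t tr; rewrite /= E.
    exact: integrable0.
  rewrite (eq_int_oc E).
  by rewrite /Rintegral integral0.
have ci : {within `[cmod z, r], continuous (fun t => t^-1)}.
  apply: continuous_in_subspaceT => t /set_mem/=; rewrite in_itv/= => /andP[t1 _].
  by apply: inv_continuous; rewrite gt_eqF// (lt_le_trans zp).
have E t : t \in `]0, r]%classic -> kern z t = ((fun t => t^-1) \_ `[cmod z, r]) t.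
  rewrite inE/= in_itv/= => /andP[_ tr]; rewrite /kern zp/= patchE mem_setE in_itv/= tr andbT.
  by case: ifP.
have I : `]0, r] `&` `[cmod z, r] = `[cmod z, r]%classic.
  apply/seteqP; split=> t /=; first by case.
  by rewrite !in_itv/= => /andP[h1 h2]; rewrite h1 h2 (lt_le_trans zp).
split.
  apply: (@eq_integrable _ _ _ mu _ _ (EFin \o ((fun t => t^-1) \_ `[cmod z, r]))) => //.
    by move=> t tr; rewrite /= E.
  rewrite -restrict_EFin; apply/integrable_restrict => //.
  rewrite I; exact: itg_integrable.
rewrite (eq_int_oc E) -Rintegral_mkcondr I.
apply: (itg_FTC zr ci) => t /andP[t1 _].
by apply: is_derive1_ln; exact: lt_le_trans t1.
Qed.

Let kern_sum s D r : 0 < r ->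
  mu.-integrable `]0, r] (EFin \o (fun t => \sum_(z <- s) D z * kern z t)) /\
  \int[mu]_(t in `]0, r]) (\sum_(z <- s) D z * kern z t) =
  \sum_(z <- s) D z * (if z == 0 then 0 else lam r z).
Proof.
move=> r0; elim: s => [|a s [IH1 IH2]].
  have E : (fun t : R => \sum_(z <- [::]) D z * kern z t) = fun=> 0.
    by apply/funext => t; rewrite big_nil.
  rewrite E big_nil; split; last by rewrite /Rintegral integral0.
  exact: integrable0.
have E : (fun t : R => \sum_(z <- a :: s) D z * kern z t) =
    fun t => D a * kern a t + \sum_(z <- s) D z * kern z t.
  by apply/funext => t; rewrite big_cons.
have [k1 k2] := kern_int a r0.
have k3 : mu.-integrable `]0, r] (EFin \o (fun t => D a * kern a t)).
  exact: (@integrableZl _ _ _ mu _ (measurable_itv _) (D a) _ k1).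
rewrite E; split.
  exact: (@integrableD _ _ _ mu _ (measurable_itv _) _ _ k3 IH1).
by rewrite RintegralD// RintegralZl// k2 IH2 big_cons.
Qed.

Lemma NdivE s D r : 0 < r -> carries s D r -> Ndiv D r = \sum_(z <- s) D z * lam r z.
Proof.
move=> r0 cs; have [k1 k2] := kern_sum s D r0; case: (cs) => us Hs.
have c0 : count_div D 0 = \sum_(z <- s) (if z == 0 then D z else 0).
  rewrite (count_divE cs (ltW r0)) big_mkcond; apply: eq_bigr => z _.
  by rewrite -cmod_eq0 [in RHS]eq_le cmod_ge0 andbT.
rewrite /Ndiv /integrated.
rewrite (@eq_int_oc _ _ (fun t => \sum_(z <- s) D z * kern z t)); last first.
  move=> t; rewrite inE/= in_itv/= => /andP[t0 tr].
  rewrite (count_divE cs tr) c0 big_mkcond -sumrB mulr_suml; apply: eq_bigr => z _.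
  rewrite /kern cmod_gt0; have [->|z0] := eqVneq z 0.
    by rewrite cmod0 (ltW t0) subrr mul0r mulr0.
  by rewrite subr0/=; case: ifP; rewrite ?mulr0// mul0r.
rewrite k2 c0 mulr_suml -big_split/=; apply: eq_bigr => z _.
by rewrite /lam; case: (z == 0); rewrite ?mulr0 ?add0r ?mul0r ?addr0.
Qed.

Definition locfin D := forall r, finite_set [set z | D z != 0 /\ cmod z <= r].

Lemma locfin_carries D r : locfin D -> exists s, carries s D r.
Proof.
move=> /(_ r)/finite_seqP[s sE]; exists (undup s); split; first exact: undup_uniq.
by move=> z Dz zr; rewrite mem_undup; have := congr1 (fun A => A z) sE => /= <-.
Qed.

Lemma locfin_carries2 D E r : locfin D -> locfin E -> exists s,
  carries s D r /\ carries s E r.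
Proof.
move=> /(locfin_carries r)[s1 [_ H1]] /(locfin_carries r)[s2 [_ H2]].
exists (undup (s1 ++ s2)); split; split; rewrite ?undup_uniq// => z Dz zr.
  by rewrite mem_undup mem_cat H1.
by rewrite mem_undup mem_cat H2 ?orbT.
Qed.

(** The origin contributes [ln r], which is negative for small [r]; this is why the comparisons of
    counting functions assume [1 <= r]. *)
Lemma lam_ge0 r z : 1 <= r -> 0 <= lam r z.
Proof.
move=> r1; rewrite /lam; case: eqVneq => [_|z0]; first exact: ln_ge0.
case: (leP (cmod z)) => // zr; rewrite subr_ge0 ler_ln ?posrE ?cmod_gt0//.
exact: lt_le_trans r1.
Qed.

Lemma Ndiv_le D E r : 1 <= r -> locfin D -> locfin E -> (forall z, D z <= E z) ->
  Ndiv D r <= Ndiv E r.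
Proof.
move=> r1 lD lE DE; have r0 : 0 < r by exact: lt_le_trans r1.
have [s [cD cE]] := locfin_carries2 r lD lE.
rewrite (NdivE r0 cD) (NdivE r0 cE); apply: ler_sum => z _.
by rewrite ler_wpM2r// lam_ge0.
Qed.

Lemma locfinD D E : locfin D -> locfin E -> locfin (fun z => D z + E z).
Proof.
move=> lD lE r; have := conj (lD r) (lE r); rewrite -finite_setU; apply: sub_finite_set.
move=> z /= [DE zr]; have [D0|D0] := eqVneq (D z) 0; last by left.
by right; split=> //; move: DE; rewrite D0 add0r.
Qed.

Lemma locfinZ c D : locfin D -> locfin (fun z => c * D z).
Proof.
move=> lD r; apply: sub_finite_set (lD r) => z /= [DE zr]; split=> //.
by apply: contraNneq DE => ->; rewrite mulr0.
Qed.

Lemma NdivD D E r : 0 < r -> locfin D -> locfin E ->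
  Ndiv (fun z => D z + E z) r = Ndiv D r + Ndiv E r.
Proof.
move=> r0 lD lE; have [s [cD cE]] := locfin_carries2 r lD lE.
have cDE : carries s (fun z => D z + E z) r.
  split; first by case: cD.
  move=> z DE zr; have [D0|D0] := eqVneq (D z) 0; last by case: cD => _; exact.
  by case: cE => _; apply=> //; move: DE; rewrite D0 add0r.
rewrite (NdivE r0 cD) (NdivE r0 cE) (NdivE r0 cDE) -big_split/=.
by apply: eq_bigr => z _; rewrite mulrDl.
Qed.

Lemma NdivZ c D r : 0 < r -> locfin D -> Ndiv (fun z => c * D z) r = c * Ndiv D r.
Proof.
move=> r0 lD; have [s cD] := locfin_carries r lD.
have cE : carries s (fun z => c * D z) r.
  split; first by case: cD.
  move=> z DE zr; case: cD => _; apply=> //.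
  by apply: contraNneq DE => ->; rewrite mulr0.
rewrite (NdivE r0 cD) (NdivE r0 cE) mulr_sumr.
by apply: eq_bigr => z _; rewrite mulrA.
Qed.

Lemma Ndiv_ge0 D r : 1 <= r -> locfin D -> (forall z, 0 <= D z) -> 0 <= Ndiv D r.
Proof.
move=> r1 lD D0; have r0 : 0 < r by exact: lt_le_trans r1.
have [s cD] := locfin_carries r lD.
by rewrite (NdivE r0 cD); apply: sumr_ge0 => z _; rewrite mulr_ge0// lam_ge0.
Qed.

Lemma finite_avoid (l : seq R) (a b : R) : a < b -> exists r, a < r < b /\ r \notin l.
Proof.
elim: l a b => [|x l IH] a b ab.
  exists ((a + b) / 2); split=> //; apply/andP; split; lra.
have [xa|ax] := leP x a.
  have [r [/andP[r1 r2] rl]] := IH a b ab; exists r; rewrite r1 r2 inE negb_or rl.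
  by rewrite gt_eqF// (le_lt_trans xa).
have m : a < Num.min x b by rewrite lt_min ax.
have [r [/andP[r1 r2] rl]] := IH a _ m; move: r2; rewrite lt_min => /andP[rx rb].
by exists r; rewrite r1 rb inE negb_or rl lt_eqF.
Qed.

Definition good f r := forall w, cmod w = r -> holomorphic_at f w /\ f w != 0.

Lemma good_exists f (a b : R) : nonzero_mero f -> a < b -> exists r, a < r < b /\ good f r.
Proof.
move=> hf ab; have [s [_ Hs]] := singular_seq b hf.
have [r [/andP[r1 r2] rs]] := finite_avoid (map (@cmod R) s) ab.
exists r; rewrite r1 r2; split=> // w wr; apply: contrapT => sw.
by case/mapP: rs; exists w => //; apply/Hs; rewrite wr ltW.
Qed.

Definition pole_div f z : R := (pole_order f z)%:R.

Definition ord_div f z : R := (ordf f z)%:~R.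

Lemma locfin_ord f : nonzero_mero f -> locfin (ord_div f).
Proof.
move=> hf r; apply: sub_finite_set (finite_singular r hf) => z /= [nz zr]; split=> //.
by apply: ordf_singular; move: nz; rewrite /ord_div intr_eq0.
Qed.

Lemma pole_orderE' f z : nonzero_mero f ->
  pole_order f z = if ordf f z < 0 then `|ordf f z|%N else 0%N.
Proof. by move=> hf; apply: pole_orderE; exact: nzm_ord. Qed.

Lemma locfin_le D E : locfin D -> (forall z, D z = 0 -> E z = 0) -> locfin E.
Proof.
move=> lD H r; apply: sub_finite_set (lD r) => z /= [Ez zr]; split=> //.
by apply: contraNneq Ez => /H ->.
Qed.

Lemma locfin_pole f : nonzero_mero f -> locfin (pole_div f).
Proof.
move=> hf; apply: locfin_le (locfin_ord hf) _ => z /eqP; rewrite intr_eq0 => /eqP H.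
by rewrite /pole_div pole_orderE'// H ltxx.
Qed.

Lemma pole_divB f z : nonzero_mero f ->
  ord_div f z = pole_div (fun w => (f w)^-1) z - pole_div f z.
Proof.
move=> hf; rewrite /pole_div !pole_orderE'//; last exact: nzmV.
rewrite ordfV// /ord_div; case: (ordf f z) => n.
  rewrite oppr_lt0 abszN /= subr0 pmulrn; case: n => //.
by rewrite /= sub0r NegzE mulrNz.
Qed.

Lemma countingE f r : Defs.counting f r = Ndiv (pole_div f) r.
Proof. by []. Qed.

Lemma counting_sub f r : 0 < r -> nonzero_mero f ->
  Defs.counting (fun w => (f w)^-1) r - Defs.counting f r = Ndiv (ord_div f) r.
Proof.
move=> r0 hf; have hV := nzmV hf.
have -> : ord_div f = fun z => pole_div (fun w => (f w)^-1) z + (-1) * pole_div f z.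
  by apply/funext => z; rewrite pole_divB// mulN1r.
rewrite NdivD//; [|exact: locfin_pole|apply: locfinZ; exact: locfin_pole].
by rewrite NdivZ ?mulN1r//; exact: locfin_pole.
Qed.

Lemma good_oncirc f r : 0 <= r -> good f r -> oncirc (lnmod f) r.
Proof. by move=> r0 gf; exact: oncirc_lnmod. Qed.

(** With every singular point of the closed disc in [s], the quotient by [rprod f s] has order 0
    throughout the disc, and [reg] corrects its values on [s]. *)
Lemma factor_disc f rho s : nonzero_mero f -> uniq s ->
  (forall z, z \in s <-> singular f z /\ cmod z <= rho) ->
  zfree (reg (fun w => f w / rprod f s w)) rho /\
  forall w, cmod w <= rho -> w \notin s ->
    f w = reg (fun w => f w / rprod f s w) w * rprod f s w.
Proof.
move=> hf us Hs; split.
  move=> w wr; apply: reg_good; apply: ord_quot => // H; apply/Hs; split=> //.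
  exact: ordf_singular.
move=> w wr ws; have [hw fw] : holomorphic_at f w /\ f w != 0.
  by apply: contrapT => sw; move/negP: ws; apply; apply/Hs.
have P0 := rprod_neq0 f ws.
have hq : holomorphic_at (fun w => f w / rprod f s w) w.
  exact: (@holoM R _ _ _ hw (@holoV R _ _ (rprod_holo f ws) P0)).
have -> : reg (fun w => f w / rprod f s w) w = f w / rprod f s w.
  exact: (reg_holo_val hq).
by rewrite divfK.
Qed.

Lemma lnmod_rprod f s w : w \notin s ->
  lnmod (rprod f s) w = \sum_(a <- s) ord_div f a * ln (cmod (w - a)).
Proof.
rewrite /lnmod; elim: s => [|a s IH].
  by rewrite big_nil /rprod big_nil cmod1 ln1.
rewrite inE negb_or => /andP[wa ws].
have -> : rprod f (a :: s) w = (w - a) ^ ordf f a * rprod f s w by rewrite /rprod big_cons.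
have c0 : 0 < cmod (w - a) by rewrite cmod_gt0 subr_eq0.
have P0 : 0 < cmod (rprod f s w) by rewrite cmod_gt0 rprod_neq0.
have ex n : 0 < cmod ((w - a) ^ n) by rewrite cmod_gt0 exprz_neq0// subr_eq0.
rewrite cmodM lnM ?posrE// IH// big_cons; congr (_ + _).
rewrite /ord_div; case: (ordf f a) => n.
  by rewrite -exprnP cmodX lnXn// -pmulrn mulr_natl.
rewrite NegzE -invr_expz -exprnP cmodV cmodX lnV ?posrE ?exprn_gt0// lnXn//.
by rewrite mulrNz mulNr -pmulrn mulr_natl.
Qed.

Lemma oncirc_ln_linear a r : 0 <= r -> cmod a != r ->
  oncirc (fun w => ln (cmod (w - a))) r.
Proof.
move=> r0 ar; apply: (@oncirc_lnmod R (fun w => w - a)) => // w wr.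
split; first exact: holo_sub.
by rewrite subr_eq0; apply: contraNneq ar => <-; rewrite wr.
Qed.

(** In [f = g * rprod f s] the zero-free [g] has mean [log |g 0|], and the mean [log (max r |a|)] of
    [log |w - a|] is [lam r a + log |a|], without the last term for [a = 0]. Hence [C], which so far
    depends on the disc. *)
Theorem jensen_disc f rho : nonzero_mero f -> 0 < rho -> exists C : R,
  forall r, 0 < r <= rho -> good f r -> avg (lnmod f) r = Ndiv (ord_div f) r + C.
Proof.
move=> hf rho0; have [s [us Hs]] := singular_seq rho hf.
have [zg fE] := factor_disc hf us Hs; set g := reg _ in zg fE.
pose C := lnmod g 0 + \sum_(a <- s) ord_div f a * (if a == 0 then 0 else ln (cmod a)).
exists C => r /andP[r0 rr] gf.
have ns w : cmod w = r -> w \notin s.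
  by move=> wr; apply/negP => /Hs[sw _]; exact: sw (gf w wr).
have sr a : a \in s -> cmod a != r.
  by move=> as_; apply/eqP => ar; move/negP: (ns _ ar).
have cr : carries s (ord_div f) r.
  split=> // z nz zr; apply/Hs; split; last exact: le_trans rr.
  by apply: ordf_singular; move: nz; rewrite /ord_div intr_eq0.
rewrite (NdivE r0 cr).
have E w : cmod w = r -> lnmod f w = lnmod g w + \sum_(a <- s) ord_div f a * ln (cmod (w - a)).
  move=> wr; have wr' : cmod w <= rho by rewrite wr.
  have [_ g0] := zg w wr'.
  rewrite -lnmod_rprod ?ns// /lnmod fE ?ns// cmodM lnM ?posrE ?cmod_gt0//.
  by rewrite rprod_neq0// ns.
pose u a w := if a \in s then ord_div f a * ln (cmod (w - a)) else 0.
have cu a : oncirc (u a) r.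
  rewrite /u; case: (boolP (a \in s)) => as_; last exact: oncirc_cst.
  apply: oncircM; first exact: oncirc_cst.
  by apply: oncirc_ln_linear; [exact: ltW|exact: sr].
have [cS aS] := avg_sum s cu.
have uE w : \sum_(a <- s) ord_div f a * ln (cmod (w - a)) = \sum_(a <- s) u a w.
  by rewrite big_seq [RHS]big_seq; apply: eq_bigr => a as_; rewrite /u as_.
have E' w : cmod w = r -> lnmod f w = lnmod g w + \sum_(a <- s) u a w.
  by move=> wr; rewrite E// uE.
have cg : oncirc (lnmod g) r by apply: (zfree_oncirc zg); rewrite (ltW r0).
rewrite (eq_avg (ltW r0) E') avgD// aS (avg_lnmod_zfree r0 (zfreeW rr zg)) /C.
rewrite [RHS]addrCA; congr (_ + _); rewrite -big_split/= big_seq [RHS]big_seq.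
apply: eq_bigr => a as_; rewrite -mulrDr /u as_ avgZ; last first.
  by apply: oncirc_ln_linear; [exact: ltW|exact: sr].
rewrite avg_ln_linear ?sr//; congr (_ * _); rewrite /lam; case: eqVneq => [->|a0].
  by rewrite cmod0 max_l ?addr0// ltW.
by case: leP => ar; [rewrite subrK|rewrite add0r].
Qed.

(** Evaluation at one fixed good radius [r0] determines the constant of every disc that contains it,
    so that a single constant serves all radii. *)
Theorem jensen f : nonzero_mero f -> exists C : R,
  forall r, 0 < r -> good f r -> avg (lnmod f) r = Ndiv (ord_div f) r + C.
Proof.
move=> hf; have [r0 [/andP[r00 r01] g0]] := good_exists hf (@ltr01 R).
exists (avg (lnmod f) r0 - Ndiv (ord_div f) r0) => r rp gr.
have m0 : 0 < Num.max r r0 by rewrite lt_max rp.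
have [C HC] := jensen_disc hf m0.
rewrite (HC r) ?rp ?le_max ?lexx// (HC r0) ?r00 ?le_max ?lexx ?orbT//.
by rewrite [X in _ = _ + X]addrC addKr.
Qed.

Lemma logpE f w : logp (cmod (f w)) = Num.max 0 (lnmod f w). Proof. by []. Qed.

Lemma oncirc_norm D r : oncirc D r -> oncirc (fun w => `|D w|) r.
Proof. by move=> cD t; apply: cvg_norm; exact: cD. Qed.

Lemma oncirc_max0 D r : oncirc D r -> oncirc (fun w => Num.max 0 (D w)) r.
Proof.
move=> cD; have -> : (fun w => Num.max 0 (D w)) = fun w => 2^-1 * (D w + `|D w|).
  by apply/funext => w; rewrite maxr_absE add0r sub0r normrN mulrC.
apply: oncircM; [exact: oncirc_cst|apply: oncircD => //; exact: oncirc_norm].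
Qed.

Lemma oncirc_logp f r : oncirc (lnmod f) r -> oncirc (fun w => logp (cmod (f w))) r.
Proof. exact: oncirc_max0. Qed.

Lemma proximityE f r : proximity f r = avg (fun w => logp (cmod (f w))) r.
Proof. by []. Qed.

Lemma good_inv f r : good f r -> good (fun w => (f w)^-1) r.
Proof. by move=> gf w /gf[hf f0]; split; [exact: holoV|rewrite invr_eq0]. Qed.

Lemma proximity_sub f r : 0 < r -> good f r ->
  proximity f r - proximity (fun w => (f w)^-1) r = avg (lnmod f) r.
Proof.
move=> r0 gf; rewrite !proximityE -avgB; first last.
- exact: oncirc_logp (good_oncirc (ltW r0) (good_inv gf)).
- exact: oncirc_logp (good_oncirc (ltW r0) gf).
apply: eq_avg (ltW r0) _ => w wr; have [_ f0] := gf w wr.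
rewrite !logpE /lnmod cmodV lnV ?posrE ?cmod_gt0//; set x := ln _.
by case: (leP 0 x) => x0; [rewrite max_l ?subr0// oppr_le0|rewrite max_r ?opprK ?add0r// oppr_ge0 ltW].
Qed.

Theorem first_main f : nonzero_mero f -> exists C : R, forall r, 0 < r -> good f r ->
  characteristic f r = characteristic (fun w => (f w)^-1) r + C.
Proof.
move=> hf; have [C HC] := jensen hf; exists C => r r0 gf; rewrite /characteristic.
have := proximity_sub r0 gf; have := counting_sub r0 hf; rewrite (HC r r0 gf).
by lra.
Qed.

End Counting.

(** * The lemma on the logarithmic derivative *)

Section Exceptional.
Variable R : realType.
Notation mu := (@lebesgue_measure R).
Implicit Types (r x y : R) (E : set R) (A : nat -> set R) (l : nat -> R).

Definition exceptional E :=
  [/\ E `<=` `]0, +oo[%classic, measurable E & (mu E < +oo)%E].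

Lemma exceptionalU E E' : exceptional E -> exceptional E' -> exceptional (E `|` E').
Proof.
move=> [s1 m1 f1] [s2 m2 f2]; split.
- by move=> x [/s1|/s2].
- exact: measurableU.
- by apply: le_lt_trans (@measureU2 _ _ _ mu _ _ m1 m2) _; rewrite lte_add_pinfty.
Qed.

Lemma exceptional0 : exceptional set0.
Proof. by split=> //; rewrite measure0. Qed.

(** Each [A n] lies in the interval of radius [l n] about any one of its points, so the union has
    measure at most [2 * L]. For an empty [A n] the centre is the default 0, which does no harm. *)
Lemma exceptional_cover A l (L : R) : (forall n, 0 <= l n) ->
  (forall n x y, A n x -> A n y -> `|x - y| <= l n) ->
  (forall m, \sum_(0 <= i < m) l i <= L) ->
  exists E, exceptional E /\ forall n x, 0 < x -> A n x -> E x.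
Proof.
move=> l0 Al lL; pose c n := xget 0 (A n).
pose I n := `[c n - l n, c n + l n]%classic : set R.
have AI n x : A n x -> I n x.
  move=> Ax; rewrite /I/= in_itv/=.
  have := Al n x (c n) Ax (xgetPex 0 (ex_intro _ x Ax)); rewrite ler_norml => /andP[h1 h2].
  by apply/andP; split; lra.
have mI n : measurable (I n) by exact: measurable_itv.
exists ((\bigcup_n I n) `&` `]0, +oo[); split; last first.
  move=> n x x0 Ax; split; last by rewrite /= in_itv/= x0.
  by exists n => //; exact: AI.
have mE : measurable ((\bigcup_n I n) `&` `]0, +oo[).
  by apply: measurableI; [exact: bigcup_measurable|exact: measurable_itv].
split; [by move=> x []|exact: mE|].
have H := @measure_sigma_subadditive _ _ _ mu _ I mI mE (fun x xE => xE.1).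
apply: le_lt_trans H _; apply: (@le_lt_trans _ _ (2 * L)%:E); last exact: ltry.
apply: lime_le; first by apply: is_cvg_nneseries.
near=> m; have muI n : mu (I n) = (2 * l n)%:E.
  rewrite /I lebesgue_measure_itv/= lte_fin; case: ifP => h.
    by rewrite -EFinB; congr EFin; ring.
  by congr EFin; have := l0 n; move: h => /negbT; rewrite -leNgt; lra.
rewrite (eq_bigr (fun i => (2 * l i)%:E)); last by move=> i _; exact: muI.
by rewrite sumEFin lee_fin -mulr_sumr ler_pM2l.
Unshelve. all: by end_near. Qed.

Lemma sum_half_le n : \sum_(0 <= i < n) (2 ^+ i)^-1 <= 2 :> R.
Proof.
suff -> : \sum_(0 <= i < n) (2 ^+ i)^-1 = 2 - 2 / 2 ^+ n :> R.
  by rewrite gerBl divr_ge0// exprn_ge0.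
elim: n => [|n IH]; first by rewrite big_nil expr0 divr1 subrr.
rewrite big_nat_recr//= IH exprS invfM; field.
by rewrite expf_neq0.
Qed.

Lemma dyadic_exists x : 1 <= x -> exists n, 2 ^+ n <= x < 2 ^+ n.+1.
Proof.
move=> x1; have ex : exists n, x < 2 ^+ n.
  exists (Num.bound x); have x0 : 0 <= x by apply: le_trans x1.
  apply: lt_trans (archi_boundP x0) _; rewrite -natrX ltr_nat.
  exact: ltn_expl.
case: (ex_minnP ex) => -[|n] xn Hn; first by move: xn; rewrite expr0 ltNge x1.
exists n; rewrite xn andbT leNgt; apply/negP => /Hn.
by rewrite ltnn.
Qed.

(* If [psi] more than doubles on [[r, r + 1 / psi r]], then [r] lies within
   [2^-n] of every other such point with the same [n], where
   [2^n <= psi r < 2^(n+1)]; likewise to the left. *)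
Lemma borel_growth (psi : R -> R) : {homo psi : x y / x <= y} ->
  (forall x, 1 <= psi x) -> exists E, exceptional E /\ forall r, 0 < r -> ~ E r ->
  psi (r + (psi r)^-1) <= 2 * psi r /\ psi r <= 2 * psi (r - (psi r)^-1).
Proof.
move=> mono psi1.
pose D n r := 2 ^+ n <= psi r < 2 ^+ n.+1.
have l0 n : 0 <= (2 ^+ n)^-1 :> R by rewrite invr_ge0 exprn_ge0.
have psiV n r : D n r -> (psi r)^-1 <= (2 ^+ n)^-1.
  by move=> /andP[h _]; rewrite lef_pV2 ?posrE ?exprn_gt0// (lt_le_trans _ (psi1 r)).
have sym (P : R -> Prop) (l : R) : (forall x y, P x -> P y -> x <= y -> y - x <= l) ->
    forall x y, P x -> P y -> `|x - y| <= l.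
  move=> H x y Px Py; have [xy|/ltW yx] := leP x y.
    by rewrite distrC ger0_norm ?subr_ge0// H.
  by rewrite ger0_norm ?subr_ge0// H.
have [|E1 [e1 H1]] := @exceptional_cover
  (fun n r => D n r /\ 2 * psi r < psi (r + (psi r)^-1)) (fun n => (2 ^+ n)^-1) 2 l0 _ sum_half_le.
  move=> n; apply: sym => x y [Dx bx] [Dy _] xy.
  apply: le_trans (psiV _ _ Dx); rewrite leNgt; apply/negP => h.
  have := mono (x + (psi x)^-1) y; move: Dx Dy; rewrite /D exprS => /andP[h1 _] /andP[_ h2] h3.
  by have := h3 ltac:(lra); lra.
have [|E2 [e2 H2]] := @exceptional_cover
  (fun n r => D n r /\ 2 * psi (r - (psi r)^-1) < psi r) (fun n => (2 ^+ n)^-1) 2 l0 _ sum_half_le.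
  move=> n; apply: sym => x y [Dx _] [Dy by_] xy.
  apply: le_trans (psiV _ _ Dy); rewrite leNgt; apply/negP => h.
  have := mono x (y - (psi y)^-1); move: Dx Dy; rewrite /D exprS => /andP[h1 _] /andP[_ h2] h3.
  by have := h3 ltac:(lra); lra.
exists (E1 `|` E2); split; first exact: exceptionalU.
move=> r r0 Er; have [n Dn] := dyadic_exists (psi1 r); split; rewrite leNgt; apply/negP => h.
  by apply: Er; left; apply: (H1 n).
by apply: Er; right; apply: (H2 n).
Qed.

End Exceptional.

(** * Products, Blaschke factors and quasi-monotonicity of the characteristic *)

Section LogProducts.
Variable R : realType.
Implicit Types (r s t rho : R) (l : seq R[i]^o) (z w a : R[i]^o)
  (f g h : R[i]^o -> R[i]^o).

Definition unit_at f w := holomorphic_at f w /\ f w != 0.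

Lemma logder_near f g w : (\forall v \near w, f v = g v) -> holomorphic_at f w ->
  logder f w = logder g w.
Proof.
move=> fg hf; have df := holo_is_derive hf.
have dg : is_derive w 1 g (f^`()%classic w).
  by apply: near_eq_is_derive df; move: fg => /near_cmodP[e [e0 H]];
    apply/near_cmodP; exists e; split=> // v /H.
have /near_cmodP[e [e0 H]] := fg.
by rewrite /logder (derive1c dg) (H w)// subrr cmod0.
Qed.

Lemma unitM f g w : unit_at f w -> unit_at g w -> unit_at (fun v => f v * g v) w.
Proof.
by move=> [hf f0] [hg g0]; split; [exact: (holoM hf hg)|rewrite mulf_neq0].
Qed.

Lemma logderM f g w : unit_at f w -> unit_at g w ->
  logder (fun v => f v * g v) w = logder f w + logder g w.
Proof.
move=> [hf f0] [hg g0]; rewrite /logder.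
rewrite (derive1c (is_derive_mulc (holo_is_derive hf) (holo_is_derive hg))).
have fld (F : fieldType) (a b x y : F) : a != 0 -> b != 0 ->
    (a * y + b * x) / (a * b) = x / a + y / b by move=> a0 b0; field; rewrite a0 b0.
exact: (fld _ (f w : R[i]) (g w : R[i])).
Qed.

Lemma lnmodM f g w : f w != 0 -> g w != 0 ->
  lnmod (fun v => f v * g v) w = lnmod f w + lnmod g w.
Proof. by move=> f0 g0; rewrite /lnmod cmodM lnM// posrE cmod_gt0. Qed.

Lemma unitV f w : unit_at f w -> unit_at (fun v => (f v)^-1) w.
Proof. by move=> [hf f0]; split; [exact: holoV|rewrite invr_eq0]. Qed.

Lemma logderV f w : unit_at f w -> logder (fun v => (f v)^-1) w = - logder f w.
Proof.
move=> [hf f0]; rewrite /logder (derive1c (is_derive_invc (holo_is_derive hf) f0)).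
have fld (F : fieldType) (a x : F) : a != 0 -> - x / a ^+ 2 / a^-1 = - (x / a).
  by move=> a0; rewrite invrK; field.
exact: (fld _ (f w : R[i])).
Qed.

Lemma lnmodV f w : f w != 0 -> lnmod (fun v => (f v)^-1) w = - lnmod f w.
Proof. by move=> f0; rewrite /lnmod cmodV lnV// posrE cmod_gt0. Qed.

Lemma unit_cst c w : c != 0 -> unit_at (fun=> c) w.
Proof. by move=> c0; split=> //; exact: holo_cst. Qed.

Lemma logder_cst c w : logder (fun=> c) w = 0.
Proof. by rewrite /logder (derive1c (is_derive_cstc c w)) mul0r. Qed.

Lemma unitX f w n : unit_at f w -> [/\ unit_at (fun v => f v ^+ n) w,
  logder (fun v => f v ^+ n) w = n%:R * logder f w &
  lnmod (fun v => f v ^+ n) w = n%:R * lnmod f w].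
Proof.
move=> uf; elim: n => [|n [u1 l1 l2]].
  have -> : (fun v : R[i]^o => f v ^+ 0) = fun=> 1 by [].
  rewrite logder_cst !mul0r; split=> //; first exact: (unit_cst w (oner_neq0 _)).
  by rewrite /lnmod cmod1 ln1.
have -> : (fun v : R[i]^o => f v ^+ n.+1) = fun v => f v * f v ^+ n.
  by apply/funext => v; rewrite exprS.
rewrite logderM// lnmodM//; [|by case: uf|by case: u1].
split; first exact: unitM.
  by rewrite l1 mulrS mulrDl mul1r.
by rewrite l2 mulrS mulrDl mul1r.
Qed.

Lemma unitXz f w (n : int) : unit_at f w -> [/\ unit_at (fun v => f v ^ n) w,
  logder (fun v => f v ^ n) w = n%:~R * logder f w &
  lnmod (fun v => f v ^ n) w = n%:~R * lnmod f w].
Proof.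
move=> uf; case: n => n; first exact: unitX.
have [u1 l1 l2] := unitX n.+1 uf.
have -> : (fun v : R[i]^o => f v ^ (Negz n)) = fun v => (f v ^+ n.+1)^-1 by [].
rewrite logderV// lnmodV; last by case: u1.
by rewrite l1 l2 NegzE !mulrNz !mulNr; split=> //; exact: unitV.
Qed.

Lemma unit_prod (F : R[i]^o -> R[i]^o -> R[i]^o) (n : R[i]^o -> int) l w :
  (forall a, a \in l -> unit_at (F a) w) ->
  [/\ unit_at (fun v => \prod_(a <- l) F a v ^ n a) w,
   logder (fun v => \prod_(a <- l) F a v ^ n a) w = \sum_(a <- l) (n a)%:~R * logder (F a) w &
   lnmod (fun v => \prod_(a <- l) F a v ^ n a) w = \sum_(a <- l) (n a)%:~R * lnmod (F a) w].
Proof.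
elim: l => [|a l IH] uF.
  have -> : (fun v : R[i]^o => \prod_(a <- [::]) F a v ^ n a) = fun=> 1.
    by apply/funext => v; rewrite big_nil.
  rewrite logder_cst !big_nil; split=> //; first exact: (unit_cst w (oner_neq0 _)).
  by rewrite /lnmod cmod1 ln1.
have [|u1 l1 l2] := IH; first by move=> b bl; apply: uF; rewrite inE bl orbT.
have [|u2 l3 l4] := @unitXz (F a) w (n a); first by apply: uF; rewrite inE eqxx.
have -> : (fun v : R[i]^o => \prod_(a <- a :: l) F a v ^ n a) =
    fun v => F a v ^ n a * \prod_(a <- l) F a v ^ n a.
  by apply/funext => v; rewrite big_cons.
rewrite logderM// lnmodM; [|by case: u2|by case: u1].
by rewrite !big_cons l1 l2 l3 l4; split=> //; exact: unitM.
Qed.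

Lemma avg_sum_in l (u : R[i]^o -> R[i]^o -> R) r :
  (forall a, a \in l -> oncirc (u a) r) ->
  oncirc (fun w => \sum_(a <- l) u a w) r /\
  avg (fun w => \sum_(a <- l) u a w) r = \sum_(a <- l) avg (u a) r.
Proof.
move=> cu; pose v a w := if a \in l then u a w else 0.
have E : (fun w => \sum_(a <- l) u a w) = fun w => \sum_(a <- l) v a w.
  apply/funext => w; rewrite big_seq [RHS]big_seq.
  by apply: eq_bigr => a al; rewrite /v al.
have cv a : oncirc (v a) r.
  rewrite /v; case: (boolP (a \in l)) => al; [exact: cu|exact: oncirc_cst].
have [c1 a1] := avg_sum l cv; rewrite E; split; first exact: c1.
rewrite a1 big_seq [RHS]big_seq; apply: eq_bigr => a al.
by congr (avg _ r); apply/funext => w; rewrite /v al.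
Qed.

Lemma avg_abs (u : R[i]^o -> R) r : 0 <= r -> oncirc u r ->
  `|avg u r| <= avg (fun w => `|u w|) r.
Proof.
move=> r0 cu; have cn := oncirc_norm cu; rewrite ler_norml; apply/andP; split.
  have -> : - avg (fun w => `|u w|) r = avg (fun w => -1 * `|u w|) r.
    by rewrite avgZ// mulN1r.
  apply: avg_le => //; first by apply: oncircM => //; exact: oncirc_cst.
  by move=> w _; rewrite mulN1r lerNl -normrN ler_norm.
by apply: avg_le => // w _; exact: ler_norm.
Qed.

(* The gradient bound of [logder_bound], integrated from the centre. *)
Lemma lnmod_bound g rho s z : 0 < rho -> zfree g rho -> cmod z <= s -> s < rho ->
  `|lnmod g z| <= (1 + 4 * rho * s / (rho - s) ^+ 2) * avg (fun w => `|lnmod g w|) rho.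
Proof.
move=> rho0 zg zs sr; set V := avg _ rho.
have s0 : 0 <= s := le_trans (cmod_ge0 z) zs.
have cg : oncirc (lnmod g) rho by apply: (zfree_oncirc zg); rewrite ltW/=.
have g0V : `|lnmod g 0| <= V.
  by rewrite -(avg_lnmod_zfree rho0 zg); apply: avg_abs cg; exact: ltW.
have V0 : 0 <= V := le_trans (normr_ge0 _) g0V.
have zt t : 0 <= t <= 1 -> cmod (0 + z * t%:C) <= s.
  move=> /andP[t0 t1]; rewrite add0r cmodM cmodR ger0_norm//.
  by rewrite (le_trans _ zs)// ler_piMr// cmod_ge0.
pose d t := complex.Re (logder g (0 + z * t%:C) * z).
have D t : 0 <= t <= 1 -> is_derive t 1 (fun t => lnmod g (0 + z * t%:C)) (d t).
  move=> t01; have zr := le_lt_trans (zt t t01) sr; have [hg gz] := zg _ (ltW zr).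
  exact: (is_derive_lnmod (cderive_segment 0 z t) hg gz).
have dV t : 0 <= t <= 1 -> `|d t| <= 4 * rho * s / (rho - s) ^+ 2 * V.
  move=> t01; apply: le_trans (Re_le_cmod _) _; rewrite cmodM.
  have zr := le_lt_trans (zt t t01) sr.
  have := logder_bound rho0 zg zr; rewrite -/V => H.
  have H1 : cmod (logder g (0 + z * t%:C)) <= 4 * rho / (rho - s) ^+ 2 * V.
    apply: le_trans H _; rewrite ler_wpM2r// ler_pM2l ?mulr_gt0//.
    rewrite lef_pV2 ?posrE ?exprn_gt0 ?subr_gt0// lerXn2r ?nnegrE ?subr_ge0 ?(ltW sr) ?(ltW zr)//.
    by rewrite lerD2l lerN2 zt.
  have -> : 4 * rho * s / (rho - s) ^+ 2 * V = 4 * rho / (rho - s) ^+ 2 * V * s by ring.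
  by apply: ler_pM => //; exact: cmod_ge0.
have cD : {within `[0, 1], continuous (fun t => lnmod g (0 + z * t%:C))}.
  apply: derivable_within_continuous => t; rewrite in_itv/= => t01.
  by have [] := D t t01.
have [|c c01 E] := @MVT_segment R (fun t => lnmod g (0 + z * t%:C)) d 0 1 ler01 _ cD.
  by move=> t; rewrite in_itv/= => /andP[t0 t1]; apply: D; rewrite !ltW.
have -> : lnmod g z = lnmod g 0 + d c.
  move: E; rewrite subr0 mulr1 mulr1 mulr0 !add0r => <-.
  by rewrite addrC subrK.
apply: le_trans (ler_normD _ _) _; by rewrite mulrDl mul1r lerD// dV.
Qed.

End LogProducts.

Section QuasiMonotone.
Variable R : realType.
Implicit Types (r s t rho : R) (l : seq R[i]^o) (z w a : R[i]^o)
  (f g h : R[i]^o -> R[i]^o) (D : R[i]^o -> R).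

(* T(r, h) + T(r, 1/h) *)
Definition bichar h r : R := characteristic h r + characteristic (fun w => (h w)^-1) r.

(** Positive and negative parts recombine: [log+ x + log+ (1/x) = |log x|], and the pole orders of
    [h] and [1/h] add up to the absolute value of the order. These are the quantities that
    [blaschke] can transport between circles. *)
Lemma bicharE h r : 0 < r -> nonzero_mero h -> good h r ->
  bichar h r = avg (fun w => `|lnmod h w|) r + Ndiv (fun z => `|ord_div h z|) r.
Proof.
move=> r0 hh gh; rewrite /bichar /characteristic addrACA; congr (_ + _).
  rewrite !proximityE -avgD; first last.
  - exact: oncirc_logp (good_oncirc (ltW r0) (good_inv gh)).
  - exact: oncirc_logp (good_oncirc (ltW r0) gh).
  apply: eq_avg (ltW r0) _ => w wr; have [_ h0] := gh w wr.
  rewrite /logp cmodV lnV ?posrE ?cmod_gt0// /lnmod; set x := ln _.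
  by rewrite !maxr_absE !add0r opprK normrN; field.
rewrite !countingE -NdivD//; [|exact: locfin_pole|apply: locfin_pole; exact: nzmV].
congr (Ndiv _ r); apply/funext => z; rewrite pole_divB// /pole_div.
rewrite (pole_orderE' z hh) (pole_orderE' z (nzmV hh)) ordfV// oppr_lt0.
by case: ltgtP => _; rewrite ?subr0 ?sub0r ?addr0 ?add0r ?normrN ?normr_nat.
Qed.

Lemma lam_mono s r z : 1 <= s -> s <= r -> lam s z <= lam r z.
Proof.
move=> s1 sr; have s0 : 0 < s by exact: lt_le_trans s1.
have r0 : 0 < r by exact: lt_le_trans sr.
rewrite /lam; case: eqVneq => [_|z0]; first by rewrite ler_ln.
case: (leP (cmod z) s) => zs.
  by rewrite (le_trans zs sr) lerD2r ler_ln.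
by case: (leP (cmod z)) => // zr; rewrite subr_ge0 ler_ln ?posrE ?cmod_gt0.
Qed.

Lemma Ndiv_mono D s r : locfin D -> (forall z, 0 <= D z) -> 1 <= s -> s <= r ->
  Ndiv D s <= Ndiv D r.
Proof.
move=> lD D0 s1 sr; have s0 : 0 < s by exact: lt_le_trans s1.
have r0 : 0 < r by exact: lt_le_trans sr.
have [l cr] := locfin_carries r lD.
have cs : carries l D s by case: cr => u H; split=> // z Dz zs; apply: H => //; exact: le_trans sr.
rewrite (NdivE r0 cr) (NdivE s0 cs); apply: ler_sum => z _.
by rewrite ler_wpM2l// lam_mono.
Qed.

Lemma locfin_abs_ord h : nonzero_mero h -> locfin (fun z => `|ord_div h z|).
Proof. by move=> hh; apply: locfin_le (locfin_ord hh) _ => z ->; rewrite normr0. Qed.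

Lemma bichar_ge0 h r : 1 <= r -> nonzero_mero h -> good h r ->
  [/\ 0 <= avg (fun w => `|lnmod h w|) r,
      0 <= Ndiv (fun z => `|ord_div h z|) r & 0 <= bichar h r].
Proof.
move=> r1 hh gh; have r0 : 0 < r by exact: lt_le_trans r1.
have a0 : 0 <= avg (fun w => `|lnmod h w|) r.
  by apply: avg_ge0 (ltW r0) (oncirc_norm (good_oncirc (ltW r0) gh)) _.
have n0 : 0 <= Ndiv (fun z => `|ord_div h z|) r by apply: Ndiv_ge0 (locfin_abs_ord hh) _.
by rewrite (bicharE r0 hh gh); split=> //; rewrite addr_ge0.
Qed.

(* The numerator of the Blaschke factor of [a] for the disc of radius [rho]. *)
Definition mirror rho a w : R[i]^o := (rho ^+ 2)%:C - (conjc (a : R[i]) : R[i]^o) * w.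

Lemma mirror_unit rho a w : cmod w <= rho -> cmod a < rho -> unit_at (mirror rho a) w.
Proof.
move=> wr ar; split; last exact: reflect_neq0.
by apply/holoP; exists 1; split=> // v _; eexists; exact: is_derive_reflect.
Qed.

Lemma logder_mirror rho a w :
  logder (mirror rho a) w = - ((conjc (a : R[i]) : R[i]^o) / mirror rho a w).
Proof. by rewrite /logder (derive1c (is_derive_reflect _ _ _)) mulNr. Qed.

Lemma logder_linear a w : logder (fun v : R[i]^o => v - a) w = (w - a)^-1.
Proof.
by rewrite /logder (derive1c (is_derive_subc (is_derive_idc w) (is_derive_cstc a w)))
  subr0 div1r.
Qed.

Lemma cmod_mirror rho a w : 0 < rho -> cmod w = rho ->
  cmod (mirror rho a w) = rho * cmod (w - a).
Proof.
move=> r0 wr; have w0 : w != 0 by rewrite -cmod_gt0 wr.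
have E : (rho ^+ 2)%:C = w * (conjc (w : R[i]) : R[i]^o) by rewrite -sqr_cmod wr.
rewrite /mirror E (_ : _ - _ = w * (conjc (w - a : R[i]) : R[i]^o)).
  by rewrite cmodM cmodJ wr.
by rewrite conjB mulrBr; congr (_ - _); rewrite mulrC.
Qed.

(** For the first bound, the difference of the squares is [(rho^2 - |a|^2) (rho^2 - |w|^2)]. The
    second one controls the logarithmic derivative of [mirror] inside the disc. *)
Lemma cmod_mirror_ge rho a w : cmod a < rho -> cmod w < rho ->
  rho * cmod (w - a) <= cmod (mirror rho a w) /\ rho * (rho - cmod w) <= cmod (mirror rho a w).
Proof.
move=> ar wr; have r0 : 0 < rho by apply: le_lt_trans ar; exact: cmod_ge0.
split; last first.
  apply: le_trans (cmod_sub_ge _ _).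
  rewrite cmodR ger0_norm ?exprn_ge0 ?(ltW r0)// cmodM cmodJ mulrBr -expr2 lerD2l lerN2.
  by rewrite ler_wpM2r ?cmod_ge0// ltW.
rewrite -(@ler_pXn2r _ 2) ?nnegrE ?mulr_ge0 ?cmod_ge0 ?(ltW r0)//.
rewrite exprMn.
have sq (x : R[i]^o) : cmod x ^+ 2 = complex.Re x ^+ 2 + complex.Im x ^+ 2.
  by rewrite cmodE sqr_sqrtr ?addr_ge0 ?sqr_ge0.
have : 0 <= (rho ^+ 2 - cmod a ^+ 2) * (rho ^+ 2 - cmod w ^+ 2).
  by apply: mulr_ge0; rewrite subr_ge0 lerXn2r ?nnegrE ?cmod_ge0 ?(ltW r0)// ltW.
rewrite /mirror !sq !ReB !ImB !ReM !ImM.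
by case: a w {ar wr} => [a1 a2] [w1 w2] /=; lra.
Qed.

Lemma near_notin l w : w \notin l -> \forall v \near w, v \notin l.
Proof.
elim: l => [|a l IH]; first by move=> _; apply: nearA.
rewrite inE negb_or => /andP[wa /IH/near_cmodP[e [e0 He]]].
apply/near_cmodP; exists (Num.min e (cmod (w - a))).
rewrite lt_min e0 cmod_gt0 subr_eq0 wa; split=> // v; rewrite lt_min => /andP[ve va].
rewrite inE negb_or He// andbT; apply/eqP => E; move: va.
by rewrite E cmodB ltxx.
Qed.

(** Each factor [w - a] of [h] is exchanged for [mirror rho a w / rho], which has the same modulus
    on the circle and no zero in the disc. The resulting [g] is zero-free with the boundary values
    of [log |h|], so estimates for zero-free functions become estimates for [h] up to explicit
    terms. *)
Lemma blaschke h rho : nonzero_mero h -> 0 < rho -> good h rho -> exists l g,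
  [/\ uniq l, (forall z, z \in l <-> singular h z /\ cmod z <= rho),
   (forall a, a \in l -> cmod a < rho),
   zfree g rho & (forall w, cmod w = rho -> lnmod g w = lnmod h w) /\
   forall w, cmod w < rho -> w \notin l ->
     lnmod h w = lnmod g w + \sum_(a <- l) ord_div h a *
       (ln (cmod (w - a)) - (lnmod (mirror rho a) w - ln rho)) /\
     logder h w = logder g w + \sum_(a <- l) (ordf h a)%:~R *
       ((w - a)^-1 + (conjc (a : R[i]) : R[i]^o) / mirror rho a w)].
Proof.
move=> hh r0 gh; have [l [ul Hl]] := singular_seq rho hh.
have lr a : a \in l -> cmod a < rho.
  move=> /Hl[sa ar]; rewrite lt_neqAle ar andbT; apply/eqP => E.
  exact: sa (gh a E).
have [zG hE] := factor_disc hh ul Hl; set G := reg _ in zG hE; clearbody G.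
pose c : R[i]^o := rho%:C.
have c0 : c != 0 by rewrite -cmod_gt0 cmodR normr_gt0 gt_eqF.
pose F a w : R[i]^o := mirror rho a w * c^-1.
have uF w : cmod w <= rho -> forall a, a \in l -> unit_at (F a) w.
  move=> wr a al; apply: unitM; first exact: mirror_unit (lr a al).
  by apply: unit_cst; rewrite invr_eq0.
have uL w : w \notin l -> forall a, a \in l -> unit_at (fun v => v - a) w.
  move=> wl a al; split; first exact: holo_sub.
  by rewrite subr_eq0; apply: contraNneq wl => ->.
pose P w := \prod_(a <- l) F a w ^ ordf h a.
have HP w : cmod w <= rho -> [/\ unit_at P w,
    logder P w = \sum_(a <- l) (ordf h a)%:~R * logder (F a) w &
    lnmod P w = \sum_(a <- l) (ordf h a)%:~R * lnmod (F a) w].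
  by move=> wr; exact: (unit_prod (ordf h) (uF w wr)).
pose Q := rprod h l.
have HQ w : w \notin l -> [/\ unit_at Q w,
    logder Q w = \sum_(a <- l) (ordf h a)%:~R * logder (fun v : R[i]^o => v - a) w &
    lnmod Q w = \sum_(a <- l) (ordf h a)%:~R * lnmod (fun v : R[i]^o => v - a) w].
  by move=> wl; exact: (unit_prod (ordf h) (uL w wl)).
rewrite -/Q in hE; clearbody P Q.
have main w : cmod w <= rho -> w \notin l ->
    lnmod h w = lnmod (fun v => G v * P v) w + \sum_(a <- l) ord_div h a *
       (ln (cmod (w - a)) - (lnmod (mirror rho a) w - ln rho)) /\
     (cmod w < rho -> logder h w = logder (fun v => G v * P v) w +
       \sum_(a <- l) (ordf h a)%:~R *
       ((w - a)^-1 + (conjc (a : R[i]) : R[i]^o) / mirror rho a w)).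
  move=> wr wl; have [uP lP mP] := HP w wr; have [uQ lQ mQ] := HQ w wl.
  have uG : unit_at G w := zG w wr.
  split.
    have -> : lnmod h w = lnmod (fun v => G v * Q v) w by rewrite /lnmod (hE w wr wl).
    rewrite (lnmodM (proj2 uG) (proj2 uQ)) (lnmodM (proj2 uG) (proj2 uP)).
    rewrite mP mQ -addrA; congr (_ + _); rewrite -big_split/= big_seq [RHS]big_seq.
    apply: eq_bigr => a al; rewrite -mulrDr; congr (_ * _).
    have [_ m0] := mirror_unit wr (lr a al).
    rewrite lnmodM ?invr_eq0// /lnmod cmodV cmodR ger0_norm ?(ltW r0)// lnV ?posrE//.
    by ring.
  move=> wr'.
  have uh : unit_at h w by apply: contrapT => sw; move/negP: wl; apply; apply/Hl.
  have -> : logder h w = logder (fun v => G v * Q v) w.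
    apply: logder_near; last by case: uh.
    have /near_cmodP[e [e0 He]] := near_notin wl.
    apply/near_cmodP; exists (Num.min e (rho - cmod w)).
    rewrite lt_min e0 subr_gt0 wr'; split=> // v; rewrite lt_min => /andP[ve vr].
    apply: (hE v _ (He v ve)).
    by have := cmodDB v w 0; rewrite !subr0 => /le_trans; apply; rewrite -lerBrDr ltW.
  rewrite (logderM uG uQ) (logderM uG uP) lP lQ -addrA; congr (_ + _); rewrite -big_split/= big_seq [RHS]big_seq.
  apply: eq_bigr => a al; rewrite -mulrDr; congr (_ * _).
  have uc : unit_at (fun=> c^-1) w by apply: unit_cst; rewrite invr_eq0.
  rewrite (@logderM R (mirror rho a) (fun=> c^-1) w (mirror_unit wr (lr a al)) uc).
  by rewrite logder_cst addr0 logder_mirror logder_linear [RHS]addrC addrK.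
have zGP : zfree (fun v => G v * P v) rho.
  by move=> w wr; have [uP _ _] := HP w wr; exact: (@unitM R G P w (zG w wr) uP).
exists l, (fun v => G v * P v); split; [exact: ul|exact: Hl|exact: lr|exact: zGP|].
split=> w wr.
  have wl : w \notin l by apply/negP => /lr; rewrite wr ltxx.
  rewrite (main w _ wl).1 ?wr// big_seq big1 ?addr0// => a al.
  rewrite {1}/lnmod cmod_mirror// lnM ?posrE// ?cmod_gt0; first by ring.
  by rewrite subr_eq0; apply: contraNneq wl => ->.
by move=> wl; have [H1 H2] := main w (ltW wr) wl; split; [exact: H1|exact: H2].
Qed.

(** On the smaller circle [log |h|] is [log |g|], controlled by [lnmod_bound], plus Blaschke terms
    whose absolute values have means adding up to at most the count at [rho]. The square of
    [rho / (rho - s)] stems from the gradient bound in [lnmod_bound]. *)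
Lemma quasi_monotone h rho s : nonzero_mero h -> good h rho -> good h s ->
  1 <= s -> s < rho -> bichar h s <= 6 * (rho / (rho - s)) ^+ 2 * bichar h rho.
Proof.
move=> hh gr gs s1 sr; have s0 : 0 < s by exact: lt_le_trans s1.
have r0 : 0 < rho by exact: lt_trans sr.
have [l [g [ul Hl lr zg [gE gh]]]] := blaschke hh r0 gr.
rewrite (bicharE s0 hh gs) (bicharE r0 hh gr).
set V := avg _ rho; set N := Ndiv _ rho.
have [V0 N0 _] := bichar_ge0 (le_trans s1 (ltW sr)) hh gr; rewrite -/V -/N in V0 N0.
have Ns : Ndiv (fun z => `|ord_div h z|) s <= N.
  by apply: (Ndiv_mono (locfin_abs_ord hh)) => //; exact: ltW.
have VE : V = avg (fun w => `|lnmod g w|) rho.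
  by apply: eq_avg (ltW r0) _ => w wr; rewrite gE.
have wl w : cmod w = s -> w \notin l.
  by move=> ws; apply/negP => /Hl[sw _]; exact: sw (gs w ws).
pose u a w := `|ord_div h a| * (lnmod (mirror rho a) w - ln rho - ln (cmod (w - a))).
have sa a : a \in l -> cmod a != s.
  by move=> al; apply/eqP => as_; move: (wl a as_); rewrite al.
have cm a : a \in l -> oncirc (lnmod (mirror rho a)) s.
  move=> al; apply: (oncirc_lnmod (ltW s0)) => w ws.
  by apply: mirror_unit (lr a al); rewrite ws ltW.
have cl a : a \in l -> oncirc (fun w => ln (cmod (w - a))) s.
  by move=> al; apply: oncirc_ln_linear (ltW s0) (sa a al).
have cml a : a \in l -> oncirc (fun w => lnmod (mirror rho a) w - ln rho) s.
  by move=> al; apply: (oncircD (cm a al)); exact: oncirc_cst.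
have cmll a : a \in l ->
    oncirc (fun w => lnmod (mirror rho a) w - ln rho - ln (cmod (w - a))) s.
  by move=> al; apply: (oncircD (cml a al)); apply: oncircN; exact: cl.
have cu a : a \in l -> oncirc (u a) s.
  by move=> al; apply: oncircM; [exact: oncirc_cst|exact: cmll].
have [cS aS] := avg_sum_in cu.
have K1 : avg (fun w => `|lnmod h w|) s <=
    (1 + 4 * rho * s / (rho - s) ^+ 2) * V + \sum_(a <- l) avg (u a) s.
  rewrite -aS -[X in X + _](avg_cst _ s) -avgD//; last exact: oncirc_cst.
  apply: avg_le (ltW s0) (oncirc_norm (good_oncirc (ltW s0) gs)) _ _.
    by apply: oncircD => //; exact: oncirc_cst.
  move=> w ws; have wr : cmod w < rho by rewrite ws.
  have [-> _] := gh w wr (wl w ws).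
  apply: le_trans (ler_normD _ _) _; apply: lerD.
    by rewrite VE; apply: lnmod_bound => //; rewrite ws.
  apply: le_trans (ler_norm_sum _ _ _) _; rewrite big_seq [leRHS]big_seq.
  apply: ler_sum => a al; rewrite normrM /u ler_wpM2l//.
  rewrite distrC ger0_norm//.
  have wa : 0 < cmod (w - a).
    by rewrite cmod_gt0 subr_eq0; apply: contraNneq (wl w ws) => ->.
  rewrite subr_ge0 lerBrDr -lnM ?posrE// /lnmod.
  have [H _] := cmod_mirror_ge (lr a al) wr.
  rewrite ler_ln ?posrE 1?mulrC// ?mulr_gt0//.
  by apply: lt_le_trans H; rewrite mulr_gt0.
(* By the mean value property and [avg_ln_linear], the mean for [a] is its multiplicity times
   [ln rho - ln (max s |a|)]. This is at most [lam rho a]; at the origin [1 <= s] is used. *)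
have K2 : \sum_(a <- l) avg (u a) s <= N.
  have cN : carries l (fun z => `|ord_div h z|) rho.
    split=> // z; rewrite normr_eq0 => nz zr; apply/Hl; split=> //.
    by apply: ordf_singular; move: nz; rewrite /ord_div intr_eq0.
  rewrite /N (NdivE r0 cN) big_seq [leRHS]big_seq; apply: ler_sum => a al.
  have -> : avg (u a) s =
      `|ord_div h a| * (avg (lnmod (mirror rho a)) s - ln rho - ln (Num.max s (cmod a))).
    have cc : oncirc (fun _ : R[i]^o => ln rho) s by exact: oncirc_cst.
    rewrite -(avg_ln_linear s0 (sa a al)) -{1}(avg_cst (ln rho) s).
    by rewrite -(avgB (cm a al) cc) -(avgB (cml a al) (cl a al)) -(avgZ _ (cmll a al)).
  rewrite ler_wpM2l//.
  rewrite (@avg_lnmod_zfree R (mirror rho a) s s0); last first.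
    by move=> w ws; apply: mirror_unit (lr a al); exact: le_trans ws (ltW sr).
  rewrite /lnmod /mirror mulr0 subr0 cmodR ger0_norm ?exprn_ge0 ?(ltW r0)//.
  rewrite lnXn// /lam; case: eqVneq => [->|a0].
    by rewrite cmod0 max_l ?(ltW s0)//; have := ln_ge0 s1; lra.
  rewrite (ltW (lr a al)); have : ln (cmod a) <= ln (Num.max s (cmod a)).
    by rewrite ler_ln ?posrE ?lt_max ?s0 ?cmod_gt0// le_max lexx orbT.
  by lra.
set q := rho / (rho - s).
have q1 : 1 <= q by rewrite ler_pdivlMr ?subr_gt0//; lra.
(* Both 1 and [s / (rho - s)] are at most [q], so the left side is at most [1 + 4 q^2]. *)
have K3 : 1 + 4 * rho * s / (rho - s) ^+ 2 <= 5 * q ^+ 2.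
  have -> : 4 * rho * s / (rho - s) ^+ 2 = 4 * (q * (s / (rho - s))).
    by rewrite /q; field; rewrite gt_eqF// subr_gt0.
  have : s / (rho - s) <= q by rewrite ler_pM2r ?invr_gt0 ?subr_gt0// ltW.
  have : 0 <= s / (rho - s) by rewrite divr_ge0 ?subr_ge0 ?ltW.
  by nra.
have : (1 + 4 * rho * s / (rho - s) ^+ 2) * V <= 5 * q ^+ 2 * V by rewrite ler_wpM2r.
have q2 : 1 <= q ^+ 2 by rewrite exprn_ege1.
have : N <= q ^+ 2 * N by rewrite ler_peMl.
have : 0 <= q ^+ 2 * V by rewrite mulr_ge0// (le_trans ler01).
move=> a1 a2 a3; apply: le_trans (lerD (le_trans K1 (lerD a3 K2)) Ns) _.
have -> : 6 * q ^+ 2 * (V + N) = 6 * (q ^+ 2 * V) + 6 * (q ^+ 2 * N) by ring.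
by rewrite -mulrA; move: a1 a2; move: (q ^+ 2 * V) (q ^+ 2 * N) => x y; clear -N0; lra.
Qed.

End QuasiMonotone.

(** * A pointwise bound off an exceptional set *)

Section LogDerivativePointwise.
Variable R : realType.
Implicit Types (r s t rho : R) (l : seq R[i]^o) (z w a : R[i]^o)
  (f g h : R[i]^o -> R[i]^o) (Z : R[i]^o -> Prop).

Definition listable Z := forall t, exists l, uniq l /\
  forall z, z \in l <-> Z z /\ cmod z <= t.

Lemma listable_singular h : nonzero_mero h -> listable (singular h).
Proof. by move=> hh t; exact: singular_seq. Qed.

Lemma listable_ord h : nonzero_mero h -> listable (fun z => ordf h z != 0).
Proof.
move=> hh t; have [l [ul Hl]] := singular_seq t hh.
exists [seq z <- l | ordf h z != 0]; split; first exact: filter_uniq.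
move=> z; rewrite mem_filter; split; first by move=> /andP[-> /Hl[]].
by move=> [nz zt]; rewrite nz; apply/Hl; split=> //; exact: ordf_singular.
Qed.

Lemma sum_telescope n : \sum_(0 <= i < n) 2 / (i.+1%:R * i.+2%:R) <= 2 :> R.
Proof.
suff -> : \sum_(0 <= i < n) 2 / (i.+1%:R * i.+2%:R) = 2 - 2 / n.+1%:R :> R.
  by rewrite gerBl divr_ge0.
elim: n => [|n IH]; first by rewrite big_nil divr1 subrr.
rewrite big_nat_recr//= IH; field.
have n0 : 0 <= n%:R :> R := ler0n _ _.
by apply/andP; split; apply: lt0r_neq0; lra.
Qed.

(* The points of [Z] for which exactly [n] points of [Z] have at most their
   modulus all lie on one circle, so the radii to avoid for them form one
   interval of length [O(n^-2)]. *)
Lemma avoid_moduli Z : listable Z -> exists E, exceptional E /\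
  forall r, 0 < r -> ~ E r -> forall l t a, uniq l ->
    (forall z, z \in l <-> Z z /\ cmod z <= t) -> a \in l ->
    ((size l)%:R * (size l).+1%:R)^-1 <= `|r - cmod a|.
Proof.
move=> LZ; have [L HLZ] := choice LZ.
have uL t : uniq (L t) := (HLZ t).1.
have HL t z : z \in L t <-> Z z /\ cmod z <= t := (HLZ t).2 z.
(* The count includes [a] itself, so it is positive and the index is the count minus 1. Two elements
   of [A n] differ by less than twice [1 / ((n+1)(n+2))], a telescoping bound. *)
pose A (n : nat) x := exists a, [/\ Z a, size (L (cmod a)) = n.+1 &
  `|x - cmod a| < (n.+1%:R * n.+2%:R)^-1].
have same a b : Z a -> Z b -> size (L (cmod a)) = size (L (cmod b)) -> cmod a = cmod b.
  wlog ab : a b / cmod a < cmod b.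
    by move=> H Za Zb E; case: (ltgtP (cmod a) (cmod b)) => // h; [|apply/esym]; exact: H.
  move=> Za Zb E; have : (size (b :: L (cmod a)) <= size (L (cmod b)))%N.
    apply: uniq_leq_size => /=.
      by rewrite uL andbT; apply/negP => /HL[_]; rewrite leNgt ab.
    move=> z; rewrite inE => /predU1P[->|/HL[Zz za]]; apply/HL; split=> //.
    exact: le_trans za (ltW ab).
  by rewrite /= E ltnn.
have [|||E [eE HE]] := @exceptional_cover R A (fun n => 2 / (n.+1%:R * n.+2%:R)) 2.
- by move=> n; rewrite divr_ge0// mulr_ge0.
- move=> n x y [a [Za na xa]] [b [Zb nb yb]].
  have ab : cmod a = cmod b by apply: same => //; rewrite na nb.
  rewrite ab in xa; have -> : x - y = (x - cmod b) + (cmod b - y) by rewrite addrA subrK.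
  apply: le_trans (ler_normD _ _) _; rewrite [`|cmod b - y|]distrC mulrDl.
  by rewrite mul1r lerD// ltW.
- exact: sum_telescope.
exists E; split=> // r r0 Er l t a ul Hl al; rewrite leNgt; apply/negP => H.
have [Za at_] := (Hl a).1 al.
(* [l] lists the points up to some [t >= cmod a], so it is at least as long as the list up to
   [cmod a], and the distance asked for is the smaller one. *)
have sl : (size (L (cmod a)) <= size l)%N.
  apply: uniq_leq_size => // z /HL[Zz za]; apply/Hl; split=> //; exact: le_trans at_.
case E1 : (size (L (cmod a))) => [|n].
  have : a \in L (cmod a) by apply/HL.
  by rewrite (size0nil E1).
apply: Er; apply: (HE n) => //; exists a; split=> //; apply: lt_le_trans H _.
rewrite E1 in sl; rewrite lef_pV2 ?posrE ?mulr_gt0 ?ltr0n//; last exact: leq_trans sl.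
by apply: ler_pM; rewrite ?ler0n// ler_nat.
Qed.

(** A positive lower bound for [|r - cmod w|] at all singular points [w] of the disc excludes
    [cmod w = r]. *)
Lemma exceptional_good h : nonzero_mero h -> exists E, exceptional E /\
  forall r, 0 < r -> ~ E r -> good h r.
Proof.
move=> hh; have [E [eE HE]] := avoid_moduli (listable_singular hh).
exists E; split=> // r r0 Er w wr; apply: contrapT => sw.
have [l [ul Hl]] := singular_seq r hh; have wl : w \in l by apply/Hl; rewrite wr.
have := HE r r0 Er l r w ul Hl wl; rewrite wr subrr normr0 leNgt invr_gt0 mulr_gt0//.
by rewrite ltr0n; case: (l) wl.
Qed.

(** Each point up to [rho] enters the count at [rho'] with weight at least [ln (rho' / rho)], and
    [1 - x <= - ln x] with [x = rho / rho'] gives the rational form. *)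
Lemma mult_count h rho rho' l : nonzero_mero h -> 1 <= rho -> rho < rho' -> uniq l ->
  (forall z, z \in l <-> singular h z /\ cmod z <= rho) ->
  (\sum_(a <- l) `|ord_div h a|) * (1 - rho / rho') <= Ndiv (fun z => `|ord_div h z|) rho'.
Proof.
move=> hh r1 rr ul Hl; have r0 : 0 < rho by exact: lt_le_trans r1.
have r'0 : 0 < rho' by exact: lt_trans rr.
pose D z : R := if cmod z <= rho then `|ord_div h z| else 0.
have cD : carries l D rho'.
  split=> // z; rewrite /D; case: ifP => zr; last by rewrite eqxx.
  rewrite normr_eq0 => nz _; apply/Hl; split=> //.
  by apply: ordf_singular; move: nz; rewrite /ord_div intr_eq0.
have lD : locfin D.
  by apply: locfin_le (locfin_abs_ord hh) _ => z; rewrite /D; case: ifP.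
have DE z : D z <= `|ord_div h z| by rewrite /D; case: ifP.
apply: le_trans (Ndiv_le (le_trans r1 (ltW rr)) lD (locfin_abs_ord hh) DE).
rewrite (NdivE r'0 cD) mulr_suml big_seq [leRHS]big_seq; apply: ler_sum => a al.
have [_ ar] := (Hl a).1 al; rewrite /D ar ler_wpM2l//.
have H : 1 - rho / rho' <= ln rho' - ln rho.
  rewrite -ln_div ?posrE//; have := @le_ln1Dx R (rho / rho' - 1).
  rewrite subrKC -(invf_div rho) lnV ?posrE ?divr_gt0//.
  rewrite (_ : -1 < _); last by rewrite ltrBrDr addrC subrr divr_gt0.
  by move=> /(_ isT); lra.
apply: le_trans H _; rewrite /lam; case: eqVneq => [_|a0].
  by rewrite gerBl ln_ge0.
by rewrite (le_trans ar (ltW rr)) lerD2l lerN2 ler_ln ?posrE ?cmod_gt0.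
Qed.

(** Adds up the pieces of [logder_pointwise]: [2 b^2] for the zero-free part, and at most [b] terms,
    each at most [b (b + 1) + b]. *)
Let quartic_bound (b : R) : 8 <= b -> 2 * b ^+ 2 + b * (b * (b + 1) + b) <= b ^+ 4.
Proof.
move=> b8; have b2 : 0 <= b * b by rewrite mulr_ge0//; lra.
have h1 : 8 * (b * b) <= b * (b * b) by rewrite ler_wpM2r.
have h2 : 8 * (b * (b * b)) <= b * (b * (b * b)).
  by rewrite ler_wpM2r// (le_trans _ h1)// mulr_ge0.
by lra.
Qed.

(** By [blaschke], [h'/h] is [g'/g] plus one term per zero or pole. [logder_bound] controls the
    first, [avoid_moduli] keeps the poles of the other terms away from the circle, and [mult_count]
    bounds their number; everything is expressed by [B = 8 r Y / delta]. *)
Theorem logder_pointwise h : nonzero_mero h -> exists E, exceptional E /\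
  forall r, 1 <= r -> ~ E r -> good h r /\
    forall delta Y : R, 0 < delta <= 1 -> 1 <= Y ->
    (forall rho, r < rho < r + delta -> good h rho -> bichar h rho <= Y) ->
    forall z, cmod z = r -> cmod (logder h z) <= (8 * r * Y / delta) ^+ 4.
Proof.
move=> hh; have [E1 [e1 H1]] := exceptional_good hh.
have [E2 [e2 H2]] := avoid_moduli (listable_ord hh).
exists (E1 `|` E2); split; first exact: exceptionalU.
move=> r r1 Er; have r0 : 0 < r by exact: lt_le_trans r1.
have gr : good h r by apply: H1 => // ?; apply: Er; left.
split=> // delta Y /andP[d0 d1] Y1 HY z zr.
(* Two radii inside [(r, r + delta)]: [rho], more than [delta / 4] beyond [r], for the
   factorisation, and [rho'], more than [delta / 4] beyond [rho], for counting the points up to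
   [rho]. *)
have [rho [/andP[a1 a2] grho]] := @good_exists _ h (r + delta / 4) (r + delta / 2) hh ltac:(lra).
have [rho' [/andP[a3 a4] grho']] := @good_exists _ h (r + delta * 3 / 4) (r + delta) hh ltac:(lra).
have rr : r < rho by lra.
have rho1 : 1 <= rho by lra.
have rho0 : 0 < rho by lra.
have rr' : rho < rho' by lra.
have rho'0 : 0 < rho' by lra.
have [V0 _ _] := bichar_ge0 rho1 hh grho.
have [_ N0 _] := bichar_ge0 (le_trans rho1 (ltW rr')) hh grho'.
have VY : avg (fun w => `|lnmod h w|) rho <= Y.
  have := HY rho ltac:(lra) grho; rewrite (bicharE rho0 hh grho); apply: le_trans.
  by rewrite lerDl; have [_ ? _] := bichar_ge0 rho1 hh grho.
have NY : Ndiv (fun z => `|ord_div h z|) rho' <= Y.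
  have := HY rho' ltac:(lra) grho'; rewrite (bicharE rho'0 hh grho'); apply: le_trans.
  by rewrite lerDr; have [? _ _] := bichar_ge0 (le_trans rho1 (ltW rr')) hh grho'.
have [l [g [ul Hl lr zg [gE gh]]]] := blaschke hh rho0 grho.
have VE : avg (fun w => `|lnmod g w|) rho = avg (fun w => `|lnmod h w|) rho.
  by apply: eq_avg (ltW rho0) _ => w wr; rewrite gE.
pose n : R := \sum_(a <- l) `|ord_div h a|.
have n0 : 0 <= n by apply: sumr_ge0.
set B := 8 * r * Y / delta.
have rY : 1 <= r * Y by rewrite -[1]mulr1 ler_pM.
have dV : 1 <= delta^-1 by rewrite invf_ge1.
have B8 : 8 <= B.
  by rewrite /B -!mulrA ler_peMr// mulrA -[1]mulr1 ler_pM.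
have nB : n <= B.
  have H := le_trans (mult_count hh rho1 rr' ul Hl) NY; rewrite -/n in H.
  (* From [rho' - rho > delta / 4] and [rho' <= 2 * r], the latter because [delta <= 1 <= r]. *)
  have K : delta / (8 * r) <= 1 - rho / rho'.
    rewrite ler_pdivrMr ?mulr_gt0// mulrBl mul1r -mulrA lerBrDr -lerBrDl.
    have -> : rho * (rho'^-1 * (8 * r)) = 8 * r * rho / rho' by ring.
    rewrite ler_pdivrMr//; nra.
  have : n * (delta / (8 * r)) <= Y by apply: le_trans H; rewrite ler_wpM2l.
  rewrite mulrA ler_pdivrMr ?mulr_gt0// -ler_pdivlMr// /B.
  by rewrite [Y * _]mulrC.
have zl : z \notin l by apply/negP => /Hl[sz _]; exact: sz (gr z zr).
have [_ ->] := gh z ltac:(rewrite zr; exact: rr) zl.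
(* Singular points of order 0 drop out of the sum. The remaining list is no longer than the
   multiplicity sum [n <= B], so the distances provided by [avoid_moduli] have inverses at most
   [B (B + 1)]. *)
pose l' := [seq a <- l | ordf h a != 0].
have Hl' a : a \in l' <-> ordf h a != 0 /\ cmod a <= rho.
  rewrite mem_filter; split; first by move=> /andP[-> /Hl[]].
  by move=> [nz zt]; rewrite nz; apply/Hl; split=> //; exact: ordf_singular.
have sn : (size l')%:R <= n.
  rewrite /n size_filter -sum1_count natr_sum /= big_mkcond/=; apply: ler_sum => a _.
  case: eqVneq => na; first by rewrite normr_ge0.
  have : 1 <= `|ordf h a|%:~R :> R by rewrite ler1z -gtz0_ge1 normr_gt0.
  by rewrite intr_norm.
have Er2 : ~ E2 r by move=> ?; apply: Er; right.
have dist a : a \in l' -> (cmod (z - a))^-1 <= B * (B + 1).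
  move=> al; have := H2 r r0 Er2 l' rho a (filter_uniq _ ul) Hl' al => H.
  have s0 : (0 < size l')%N by case: (l') al.
  have za : ((size l')%:R * (size l').+1%:R)^-1 <= cmod (z - a).
    apply: le_trans H _; rewrite -zr ler_norml cmod_sub_ge andbT.
    by rewrite lerNl opprB cmodB cmod_sub_ge.
  have p0 : 0 < (size l')%:R * (size l').+1%:R :> R by rewrite mulr_gt0 ?ltr0n.
  rewrite -[leRHS]invrK; apply: le_trans (_ : (size l')%:R * (size l').+1%:R <= _).
    by rewrite -[leRHS]invrK lef_pV2// posrE ?invr_gt0// (lt_le_trans _ za)// invr_gt0.
  by rewrite invrK -natr1 ler_pM ?addr_ge0// ?lerD2r (le_trans sn).
have term a : a \in l ->
    cmod ((ordf h a)%:~R * ((z - a)^-1 + (conjc (a : R[i]) : R[i]^o) / mirror rho a z)) <=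
    `|ord_div h a| * (B * (B + 1) + 4 / delta).
  move=> al; have [E0|na] := eqVneq (ordf h a) 0.
    by rewrite /ord_div E0 mul0r cmod0 normr0 mul0r.
  have -> : cmod ((ordf h a)%:~R * ((z - a)^-1 + (conjc (a : R[i]) : R[i]^o) / mirror rho a z)) =
      `|ord_div h a| * cmod ((z - a)^-1 + (conjc (a : R[i]) : R[i]^o) / mirror rho a z).
    rewrite cmodM; congr (_ * _); rewrite -cmodR /ord_div.
    by congr cmod; rewrite rmorph_int.
  rewrite ler_wpM2l//; apply: le_trans (cmodD _ _) _; apply: lerD.
    by rewrite cmodV dist// mem_filter na.
  (* The reflected term is at most [4 / delta]: [cmod a < rho], the modulus of [mirror] is at least
     [rho * (rho - r)], and [rho - r > delta / 4]. *)
  have zr' : cmod z < rho by rewrite zr.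
  have [_ M] := cmod_mirror_ge (lr a al) zr'; rewrite zr in M.
  rewrite cmodf cmodJ ler_pdivrMr; last first.
    by apply: lt_le_trans M; rewrite mulr_gt0// subr_gt0.
  apply: le_trans (_ : 4 / delta * (rho * (rho - r)) <= _); last first.
    by rewrite ler_wpM2l// divr_ge0// ltW.
  have : 1 <= 4 / delta * (rho - r) by rewrite mulrAC ler_pdivlMr//; lra.
  have := lr a al; rewrite mulrCA => c1 c2; apply: le_trans (ltW c1) _.
  by rewrite ler_peMr// ltW.
have S1 : cmod (\sum_(a <- l) (ordf h a)%:~R *
    ((z - a)^-1 + (conjc (a : R[i]) : R[i]^o) / mirror rho a z)) <= n * (B * (B + 1) + 4 / delta).
  rewrite /n mulr_suml.
  have : {subset l <= l} by [].
  elim: {1 3 4}l => [|a s IH] sub; first by rewrite !big_nil cmod0.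
  rewrite !big_cons; apply: le_trans (cmodD _ _) _; apply: lerD.
    by apply: term; apply: sub; rewrite inE eqxx.
  by apply: IH => b bs; apply: sub; rewrite inE bs orbT.
have dB : 4 / delta <= B.
  rewrite /B ler_pM2r ?invr_gt0// -mulrA; move: rY; lra.
have S2 : cmod (logder g z) <= 2 * B ^+ 2.
  have zr' : cmod z < rho by rewrite zr.
  apply: le_trans (logder_bound rho0 zg zr') _; rewrite VE zr.
  (* Here [rho <= 2 * r] and [rho - r >= delta / 4]; one more factor [r * Y >= 1] turns the result
     into [2 B^2]. *)
  apply: (@le_trans _ _ (8 * r / (delta / 4) ^+ 2 * Y)).
    apply: ler_pM => //.
      by rewrite !mulr_ge0 ?invr_ge0 ?exprn_ge0 ?subr_ge0// ltW.
    apply: ler_pM; [by rewrite mulr_ge0// ltW|by rewrite invr_ge0 exprn_ge0// subr_ge0 ltW|by lra|].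
    rewrite lef_pV2 ?posrE ?exprn_gt0 ?subr_gt0 ?divr_gt0//.
    by rewrite lerXn2r ?nnegrE ?subr_ge0 ?divr_ge0 ?ltW//; lra.
  have -> : 8 * r / (delta / 4) ^+ 2 * Y = 128 * (r * Y) * (delta^-1) ^+ 2.
    by field; rewrite gt_eqF.
  have -> : 2 * B ^+ 2 = 128 * (r * Y) ^+ 2 * (delta^-1) ^+ 2.
    by rewrite /B; field; rewrite gt_eqF.
  rewrite ler_wpM2r ?exprn_ge0 ?invr_ge0 ?(ltW d0)// ler_wpM2l//.
  by rewrite -{1}[r * Y]expr1 ler_weXn2l.
apply: le_trans (cmodD _ _) _; apply: le_trans (lerD S2 S1) _.
have B0 : 0 <= B := le_trans (ler0n _ _) B8.
apply: le_trans (quartic_bound B8); rewrite lerD2l; apply: ler_pM => //.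
  apply: addr_ge0; last by apply: divr_ge0 => //; exact: ltW.
  by apply: mulr_ge0 => //; apply: addr_ge0.
by rewrite lerD2l.
Qed.

End LogDerivativePointwise.

(** * The proximity function of the logarithmic derivative *)

Section LogDerivativeLemma.
Variable R : realType.
Implicit Types (r s t x rho : R) (z w a : R[i]^o) (f g h : R[i]^o -> R[i]^o).

(** Written as [ln (1 + max 0 (x - 1))], [log+] is visibly continuous at 0 as well; a logarithmic
    derivative may vanish on the circle. *)
Lemma oncirc_logp_cmod f r : 0 <= r -> oncirc f r -> oncirc (fun w => logp (cmod (f w))) r.
Proof.
move=> r0 cf; have E : (fun w => logp (cmod (f w))) = fun w => ln (1 + Num.max 0 (cmod (f w) - 1)).
  apply/funext => w; rewrite /logp; case: (leP (cmod (f w)) 1) => h1.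
    have -> : Num.max 0 (cmod (f w) - 1) = 0 by rewrite max_l// subr_le0.
    by rewrite addr0 ln1 max_l// ln_le0.
  have -> : Num.max 0 (cmod (f w) - 1) = cmod (f w) - 1 by rewrite max_r// subr_ge0 ltW.
  by rewrite subrKC max_r// ln_ge0// ltW.
rewrite E; apply: (@oncirc_comp R _ _ (fun w => 1 + Num.max 0 (cmod (f w) - 1))) => //.
  apply: oncircD; first exact: oncirc_cst.
  apply: oncirc_max0; apply: oncircD; last exact: oncirc_cst.
  exact: oncirc_cmod.
move=> w wr; apply: continuous_ln.
by apply: ltr_wpDr => //; rewrite le_max lexx.
Qed.

Lemma logp_ge0 x : 0 <= logp x. Proof. by rewrite /logp le_max lexx. Qed.

Lemma proximity_ge0 f r : 0 <= r -> oncirc f r -> 0 <= proximity f r.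
Proof.
move=> r0 cf; rewrite proximityE; apply: avg_ge0 r0 (oncirc_logp_cmod r0 cf) _ => w _.
exact: logp_ge0.
Qed.

Lemma ln_expD x : 0 <= x -> 1 <= ln (expR 1 + x) :> R.
Proof.
by move=> x0; rewrite -{1}(expRK 1) ler_ln ?posrE ?ltr_wpDr ?expR_gt0// lerDl.
Qed.

Section Sup.
Variable h : R[i]^o -> R[i]^o.
Variable hh : nonzero_mero h.

(** Borel's lemma needs a monotone function, hence a supremum over the good radii up to [x]. The
    element 1 keeps the set non-empty, and [expR 1] keeps every logarithm at least 1. *)
Let logs x : set R := [set y | y = 1 \/
  exists s, [/\ 1 <= s, s <= x, good h s & y = ln (expR 1 + bichar h s)]].

Let psi x := sup (logs x).

(** Quasi-monotonicity against one good radius [rho], taken more than 1 beyond every [s] in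
    question, so that [rho / (rho - s) <= rho]. *)
Let logs_sup x : has_sup (logs x).
Proof.
split; first by exists 1; left.
pose b := Num.max x 1.
have [rho [/andP[r1 r2] gr]] := @good_exists _ h (b + 1) (b + 2) hh ltac:(lra).
have b1 : 1 <= b by rewrite /b le_max lexx orbT.
have xb : x <= b by rewrite /b le_max lexx.
have rho1 : 1 <= rho by lra.
have [_ _ B0] := bichar_ge0 rho1 hh gr.
have K0 : 0 <= 6 * rho ^+ 2 * bichar h rho by rewrite !mulr_ge0 ?exprn_ge0//; lra.
exists (ln (expR 1 + 6 * rho ^+ 2 * bichar h rho)) => y [->|[s [s1 sx gs ->]]].
  exact: ln_expD.
have [_ _ B1] := bichar_ge0 s1 hh gs.
rewrite ler_ln ?posrE ?ltr_wpDr ?expR_gt0// lerD2l.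
have sr : s < rho by lra.
apply: le_trans (quasi_monotone hh gr gs s1 sr) _.
rewrite ler_wpM2r// ler_wpM2l// lerXn2r ?nnegrE ?divr_ge0 ?subr_ge0 ?(ltW sr)//; try by lra.
by rewrite ler_pdivrMr ?subr_gt0// ler_peMr//; lra.
Qed.

Let psi_ge1 x : 1 <= psi x.
Proof. by apply: (sup_upper_bound (logs_sup x)); left. Qed.

Let psi_mono : {homo psi : x y / x <= y}.
Proof.
move=> x y xy; apply: ge_sup; first by exists 1; left.
move=> u [->|[s [s1 sx gs ->]]]; first exact: psi_ge1.
apply: (sup_upper_bound (logs_sup y)); right; exists s; split=> //; exact: le_trans xy.
Qed.

Let psi_le s x : 1 <= s -> s <= x -> good h s -> ln (expR 1 + bichar h s) <= psi x.
Proof. by move=> s1 sx gs; apply: (sup_upper_bound (logs_sup x)); right; exists s. Qed.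

(** With the factor 8, the term [4 * ln (psi r)] arising in [psi_bound] is at most half of [psi r]
    up to a constant and can be absorbed. *)
Let ln_le_eighth x : 0 < x -> ln x <= x / 8 + ln 8.
Proof.
move=> x0; have -> : x = (x / 8) * 8 by rewrite divfK.
rewrite lnM ?posrE ?divr_gt0// divfK// lerD2r.
by have := @le_ln1Dx R (x / 8 - 1); rewrite subrKC ltrBrDr addrC subrr divr_gt0// => /(_ isT); lra.
Qed.

(* Quasi-monotonicity at [s <= r - 1 / psi r] turns the supremum into the value
   at [r]. *)
Let psi_bound r : 1 <= r -> good h r -> psi r <= 2 * psi (r - (psi r)^-1) ->
  psi r <= 4 * (1 + ln 6 + 2 * ln 8 + 2 * ln r + ln (expR 1 + bichar h r)).
Proof.
move=> r1 gr Hp; have r0 : 0 < r by exact: lt_le_trans r1.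
have [_ _ B0] := bichar_ge0 r1 hh gr.
have p1 := psi_ge1 r; have p0 : 0 < psi r by exact: lt_le_trans p1.
have L := ln_expD B0; have lr : 0 <= ln r by exact: ln_ge0.
have l6 : 0 <= ln 6 :> R by apply: ln_ge0; lra.
have l8 : 0 <= ln 8 :> R by apply: ln_ge0; lra.
(* An element within 1 of the supremum is enough for a bound up to constants. If it is the element
   1, then [psi r < 4]. *)
have [y ly Hy] := sup_adherent ltr01 (logs_sup (r - (psi r)^-1)).
rewrite -/(psi _) in Hy; case: ly => [y1|[s [s1 sx gs ys]]].
  by move: Hp Hy; rewrite y1; lra.
have i0 : 0 < (psi r)^-1 by rewrite invr_gt0.
have sr : s < r by lra.
have [_ _ B1] := bichar_ge0 s1 hh gs.
have H := quasi_monotone hh gr gs s1 sr.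
have q : r / (r - s) <= r * psi r.
  rewrite ler_pM2l// -[leRHS]invrK lef_pV2 ?posrE ?subr_gt0//; lra.
have q0 : 0 <= r / (r - s) by rewrite divr_ge0 ?subr_ge0 ?(ltW sr)// ltW.
have q2 : (r / (r - s)) ^+ 2 <= (r * psi r) ^+ 2 by rewrite lerXn2r ?nnegrE// mulr_ge0 ?ltW.
have rp : 1 <= (r * psi r) ^+ 2.
  by rewrite exprn_ege1// -[1]mulr1 ler_pM.
have H1 : expR 1 + bichar h s <= 6 * (r * psi r) ^+ 2 * (expR 1 + bichar h r).
  rewrite mulrDr; apply: lerD.
    by rewrite ler_peMl ?expR_ge0//; lra.
  by apply: le_trans H _; rewrite ler_wpM2r// ler_wpM2l.
have H2 : y <= ln 6 + 2 * ln r + 2 * ln (psi r) + ln (expR 1 + bichar h r).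
  have eB : 0 < expR 1 + bichar h r by rewrite ltr_wpDr ?expR_gt0.
  have rp0 : 0 < r * psi r by rewrite mulr_gt0.
  have E : ln (6 * (r * psi r) ^+ 2 * (expR 1 + bichar h r)) =
      ln 6 + 2 * ln r + 2 * ln (psi r) + ln (expR 1 + bichar h r).
    rewrite lnM ?posrE ?mulr_gt0 ?exprn_gt0// lnM ?posrE ?exprn_gt0// lnXn//.
    by rewrite lnM ?posrE//; ring.
  rewrite -E ys ler_ln ?posrE ?mulr_gt0 ?exprn_gt0//.
  by rewrite ltr_wpDr ?expR_gt0.
have := ln_le_eighth p0; move: Hp Hy H2; clear -l6 l8 lr L p1.
by lra.
Qed.

(** [logder_pointwise] with [delta = 1 / psi r] and [Y = expR (2 * psi r)], which Borel's lemma
    makes admissible: [psi] at most doubles on that interval. The logarithm of the pointwise bound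
    is linear in [psi r], up to [ln r], and [psi_bound] brings it back to the value at [r]. *)
Theorem log_derivative_lemma : exists (C : R) (E : set R), [/\ 0 <= C, exceptional E &
  forall r, 1 <= r -> ~ E r -> good h r /\
    proximity (logder h) r <= C * (1 + ln r + ln (expR 1 + bichar h r))].
Proof.
have [E1 [e1 H1]] := logder_pointwise hh.
have [E2 [e2 H2]] := borel_growth psi_mono psi_ge1.
have l6 : 0 <= ln 6 :> R by apply: ln_ge0; lra.
have l8 : 0 <= ln 8 :> R by apply: ln_ge0; lra.
pose c : R := 1 + ln 6 + 2 * ln 8.
(* [4 * ln B] is at most [4 ln 8 + 4 ln r + 12 psi r], using [ln (psi r) <= psi r]. As [psi r] is at
   most 4 times [c + 2 ln r + ln (expR 1 + bichar h r)], the factor 48 appears. *)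
exists (4 * (ln 8 + 1) + 48 * (c + 2)), (E1 `|` E2); split.
- by rewrite /c; lra.
- exact: exceptionalU.
move=> r r1 Er; have r0 : 0 < r by exact: lt_le_trans r1.
have [gr Hr] := H1 r r1 (fun e => Er (or_introl e)); split=> //.
have [up dn] := H2 r r0 (fun e => Er (or_intror e)).
have p1 := psi_ge1 r; have p0 : 0 < psi r by exact: lt_le_trans p1.
have i0 : 0 < (psi r)^-1 by rewrite invr_gt0.
have HY rho : r < rho < r + (psi r)^-1 -> good h rho -> bichar h rho <= expR (2 * psi r).
  move=> /andP[rr1 rr2] gho; have rho1 : 1 <= rho by apply: ltW; exact: le_lt_trans rr1.
  have [_ _ B0] := bichar_ge0 rho1 hh gho.
  have := le_trans (psi_le rho1 (ltW rr2) gho) up.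
  rewrite -ler_expR lnK ?posrE ?ltr_wpDr ?expR_gt0//; apply: le_trans.
  by rewrite lerDr expR_ge0.
have Y1 : 1 <= expR (2 * psi r) by rewrite -{1}expR0 ler_expR mulr_ge0// ltW.
have d1 : 0 < (psi r)^-1 <= 1 by rewrite i0 invf_le1.
have Hb := Hr _ _ d1 Y1 HY; rewrite invrK in Hb.
set B := 8 * r * _ * _ in Hb.
have lB : ln B = ln 8 + ln r + 2 * psi r + ln (psi r).
  rewrite /B lnM ?posrE ?mulr_gt0 ?expR_gt0// lnM ?posrE ?mulr_gt0 ?expR_gt0//.
  by rewrite expRK lnM ?posrE.
have B1 : 1 <= B.
  have h1 : 1 <= 8 * r by rewrite mulr_ege1//; lra.
  have h2 : 1 <= 8 * r * expR (2 * psi r) by rewrite mulr_ege1.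
  by rewrite /B mulr_ege1.
have cl : oncirc (logder h) r.
  apply: oncirc_for => [|w wr]; first exact: ltW.
  by have [hw h0] := gr w wr; apply: holo_cont; exact: logder_holo.
have H : proximity (logder h) r <= 4 * ln B.
  rewrite proximityE -[leRHS](avg_cst _ r).
  have cc : oncirc (fun _ : R[i]^o => 4 * ln B) r by exact: oncirc_cst.
  apply: (avg_le (ltW r0) (oncirc_logp_cmod (ltW r0) cl) cc) => w wr.
  have B0 : 0 < B by exact: lt_le_trans B1.
  have lB0 : 0 <= ln B by exact: ln_ge0.
  rewrite /logp ge_max mulr_ge0//=.
  have -> : 4 * ln B = ln (B ^+ 4) by rewrite lnXn// mulr_natl.
  have [->|nz] := eqVneq (logder h w) 0.
    by rewrite cmod0 ln0// ln_ge0// exprn_ege1.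
  by rewrite ler_ln ?posrE ?cmod_gt0 ?exprn_gt0//; exact: Hb.
apply: le_trans H _; rewrite lB.
have := psi_bound r1 gr dn; have [_ _ B0] := bichar_ge0 r1 hh gr.
have L := ln_expD B0; have lr : 0 <= ln r by exact: ln_ge0.
have lp : ln (psi r) <= psi r.
  by have := @le_ln1Dx R (psi r - 1); rewrite subrKC ltrBrDr addrC subrr p0 => /(_ isT); lra.
have c0 : 0 <= c by rewrite /c; lra.
rewrite -/c; move: (ln (expR 1 + _)) (ln r) (ln (psi r)) (psi r) (ln 8) c L lr lp l8 c0.
clear => L t lp p l8 c L1 t0 lpp l80 c0 pb.
have h1 : 0 <= t * l8 by rewrite mulr_ge0.
have h2 : 0 <= L * l8 by rewrite mulr_ge0//; lra.
have h3 : 0 <= t * c by rewrite mulr_ge0.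
have h4 : 0 <= L * c by rewrite mulr_ge0//; lra.
by lra.
Qed.

End Sup.

End LogDerivativeLemma.

(** * Transcendental functions *)

Section Transcendental.
Variable R : realType.
Implicit Types (r s t x rho K : R) (l : seq R[i]^o) (z w a : R[i]^o)
  (f g h : R[i]^o -> R[i]^o) (p : {poly R[i]}).

Lemma is_derive_horner p z : is_derive z 1 (fun w : R[i]^o => p.[w] : R[i]^o) (p^`().[z] : R[i]^o).
Proof.
elim/poly_ind: p => [|p c IH].
  rewrite deriv0 horner0.
  have -> : (fun w : R[i]^o => (0 : {poly R[i]}).[w] : R[i]^o) = fun=> 0.
    by apply/funext => w; rewrite horner0.
  exact: is_derive_cstc.
have -> : (fun w : R[i]^o => (p * 'X + c%:P).[w] : R[i]^o) =
    fun w : R[i]^o => (p.[w] : R[i]^o) * w + (c : R[i]^o).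
  by apply/funext => w; rewrite hornerMXaddC.
have := is_derive_addc (is_derive_mulc IH (is_derive_idc z)) (is_derive_cstc (c : R[i]^o) z).
rewrite (_ : (_ + _ : R[i]^o) = ((p * 'X + c%:P)^`()).[z])//.
by rewrite derivD derivM derivX derivC !addr0 !mulr1 hornerD hornerM hornerX addrC mulrC.
Qed.

Lemma holo_horner p z : holomorphic_at (fun w : R[i]^o => p.[w] : R[i]^o) z.
Proof. by apply/holoP; exists 1; split=> // w _; eexists; exact: is_derive_horner. Qed.

Lemma poly_antiderivative p : exists q : {poly R[i]}, q^`() = p.
Proof.
exists (\poly_(i < (size p).+1) (p`_i.-1 / i%:R)); apply/polyP => i.
rewrite coef_deriv coef_poly ltnS /=; case: ltnP => [ip|pi].
  by rewrite -(mulr_natr (_ / _)) divfK// pnatr_eq0.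
by rewrite mul0rn nth_default.
Qed.

(** Subtract the value at a regular point [z]. If the difference [h] did not vanish identically, it
    would have a positive order there, and [h'] would have an order too, contrary to [f' = 0]. *)
Lemma derive_zero f : meromorphic f -> meq f^`()%classic (cst 0) -> exists c, meq f (cst c).
Proof.
move=> mf f'0; have [|[n fo]] := mero_zero_or_ord (mf 0).
  move=> zf; exists 0; exact: identity_theorem zf.
have [z [_ [hf _]]] := dnear_exists (ord_good fo).
exists (f z); pose h w := f w - f z.
have hh : holomorphic_at h z := holoB hf (holo_cst (f z) z).
have mh : meromorphic h by move=> w; apply: meroB (mf w) (mero_cst (f z) w).
suff zh : zero_germ h z.
  move=> w; have := identity_theorem mh zh w; apply: dnearS => v _ H.
  by apply/eqP; rewrite -subr_eq0; apply/eqP.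
have [//|[m ho]] := holo_ord hh; case: m ho => [|m] ho.
  have [g [hg gz hgE]] := ho; suff : g z = 0 by move/eqP: gz.
  have E : \forall w \near z^', g w = h w.
    by apply: dnearS hgE => w _ ->; rewrite expr0z mulr1.
  by rewrite (eq_at_dnear (holo_cont hg) (holo_cont hh) E) /h subrr.
have h' := ord_derive (erefl : m.+1%:Z != 0) ho.
case: (ord_not_zero h'); have := f'0 z.
have D : \forall w \near z^', h^`()%classic w = f^`()%classic w.
  apply: near_dnear; move/holo_near: hf => /near_cmodP[e [e0 He]].
  apply/near_cmodP; exists e; split; [exact: e0|move=> w /He hfw].
  rewrite /h (derive1c (is_derive_subc (holo_is_derive hfw) (is_derive_cstc (f z) w))).
  by rewrite subr0.
by apply: dnearS2 D => w _ -> ->.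
Qed.

Lemma mero_dnear_holo f z : meromorphic_at f z -> \forall w \near z^', holomorphic_at f w.
Proof.
move=> /mero_zero_or_ord[zf|[n fo]]; last by apply: dnearS (ord_good fo) => w _ [].
apply: dnearS (dnear_near zf) => w _ H; apply: holo_eq (holo_cst 0 w).
by move: H => /near_cmodP[e [e0 He]]; apply/near_cmodP; exists e; split=> // v /He ->.
Qed.

Lemma derive_poly f p : meromorphic f ->
  meq f^`()%classic (fun w : R[i]^o => p.[w] : R[i]^o) ->
  exists q : {poly R[i]}, meq f (fun w : R[i]^o => q.[w] : R[i]^o).
Proof.
move=> mf f'p; have [q qp] := poly_antiderivative p.
have mh : meromorphic (fun w : R[i]^o => f w - (q.[w] : R[i]^o)).
  by move=> z; apply: (meroB (mf z)); apply: mero_holo; exact: holo_horner.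
have [|c Hc] := derive_zero mh.
  move=> z; apply: dnearS2 (mero_dnear_holo (mf z)) (f'p z) => w _ hf f'w.
  rewrite (derive1c (is_derive_subc (holo_is_derive hf) (is_derive_horner q w))).
  by rewrite f'w qp subrr.
exists (q + c%:P) => z; apply: dnearS (Hc z) => w _ H.
rewrite hornerD hornerC; have -> : f w = (q.[w] : R[i]^o) + (f w - (q.[w] : R[i]^o)).
  by rewrite addrC subrK.
by rewrite H.
Qed.

Lemma mero_derive_n f n : meromorphic f -> meromorphic f^`(n)%classic.
Proof.
move=> mf; elim: n => [|n IH] z; first exact: mf.
by rewrite derive1nS; exact: mero_derive.
Qed.

Lemma derive_n_poly f n p : meromorphic f ->
  meq f^`(n)%classic (fun w : R[i]^o => p.[w] : R[i]^o) ->
  exists q : {poly R[i]}, meq f (fun w : R[i]^o => q.[w] : R[i]^o).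
Proof.
move=> mf; elim: n p => [|n IH] p H; first by exists p.
rewrite derive1nS in H; have [q Hq] := derive_poly (mero_derive_n n mf) H.
exact: IH Hq.
Qed.

Lemma rational_poly f p : meq f (fun w : R[i]^o => p.[w] : R[i]^o) -> rational_function f.
Proof.
move=> H; exists p, 1; split; first exact: oner_neq0.
by move=> z; apply: dnearS (H z) => w _ ->; rewrite hornerC divr1.
Qed.

(** If some derivative vanished, repeated integration would make [f] a polynomial. *)
Lemma transcendental_derive_n f n : transcendental_meromorphic f -> nonzero_mero f^`(n)%classic.
Proof.
move=> [mf nr]; split; first exact: mero_derive_n.
move=> H; apply: nr; have [|q Hq] := @derive_n_poly f n 0 mf.
  by move=> z; apply: dnearS (H z) => w _ ->; rewrite horner0.
exact: rational_poly Hq.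
Qed.

Lemma rational_mul f g : rational_function f -> rational_function g ->
  rational_function (fun w => f w * g w).
Proof.
move=> [p [q [q0 Hf]]] [p' [q' [q'0 Hg]]]; exists (p * p'), (q * q'); split.
  by rewrite mulf_neq0.
move=> z; apply: dnearS2 (Hf z) (Hg z) => w _ -> ->.
by rewrite !hornerM invfM mulrACA.
Qed.

Lemma rational_rprod f l : rational_function (rprod f l).
Proof.
elim: l => [|a l IH].
  by apply: (@rational_poly _ 1) => z; apply: near_dnear; apply: nearA => w;
    rewrite /rprod big_nil hornerC.
have -> : rprod f (a :: l) = fun w => (w - a) ^ ordf f a * rprod f l w.
  by apply/funext => w; rewrite /rprod big_cons.
apply: rational_mul IH; case: (ordf f a) => n.
  apply: (@rational_poly _ (('X - (a : R[i])%:P) ^+ n)) => z.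
  by apply: near_dnear; apply: nearA => w; rewrite horner_exp hornerXsubC.
exists 1, (('X - (a : R[i])%:P) ^+ n.+1); split.
  by rewrite expf_neq0// polyXsubC_eq0.
move=> z; apply: near_dnear; apply: nearA => w.
by rewrite horner_exp hornerXsubC hornerC div1r.
Qed.

Lemma rational_eq f g : meq f g -> rational_function g -> rational_function f.
Proof.
move=> fg [p [q [q0 H]]]; exists p, q; split=> // z.
by apply: dnearS2 (fg z) (H z) => w _ -> ->.
Qed.

Lemma transcendental_nonzero f : transcendental_meromorphic f -> nonzero_mero f.
Proof. by move=> tf; exact: (transcendental_derive_n 0 tf). Qed.

Definition mult h l : R := \sum_(a <- l) `|ord_div h a|.

Lemma mult_Ndiv h t r l : nonzero_mero h -> 1 <= t -> t <= r -> uniq l ->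
  (forall a, a \in l -> cmod a <= t) ->
  mult h l * (ln r - ln t) <= Ndiv (fun z => `|ord_div h z|) r.
Proof.
move=> hh t1 tr ul Hl; have t0 : 0 < t by exact: lt_le_trans t1.
have r0 : 0 < r by exact: lt_le_trans tr.
pose D z : R := if z \in l then `|ord_div h z| else 0.
have cD : carries l D r.
  by split=> // z; rewrite /D; case: ifP => // _; rewrite eqxx.
have lD : locfin D.
  by apply: locfin_le (locfin_abs_ord hh) _ => z; rewrite /D; case: ifP.
have DE z : D z <= `|ord_div h z| by rewrite /D; case: ifP.
apply: le_trans (Ndiv_le (le_trans t1 tr) lD (locfin_abs_ord hh) DE).
rewrite (NdivE r0 cD) mulr_suml big_seq [leRHS]big_seq; apply: ler_sum => a al.
rewrite /D al ler_wpM2l// /lam; case: eqVneq => [_|a0].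
  by rewrite gerBl ln_ge0.
by rewrite (le_trans (Hl a al) tr) lerD2l lerN2 ler_ln ?posrE ?cmod_gt0// Hl.
Qed.

Lemma mult_size h l : (forall a, a \in l -> ordf h a != 0) -> (size l)%:R <= mult h l.
Proof.
move=> Hl; rewrite /mult -sum1_size natr_sum big_seq [leRHS]big_seq.
apply: ler_sum => a /Hl na; rewrite /ord_div.
have : 1 <= `|ordf h a|%:~R :> R by rewrite ler1z -gtz0_ge1 normr_gt0.
by rewrite intr_norm.
Qed.

(** If the number of points of non-zero order in a disc is bounded over all discs, a disc that
    attains the maximum contains them all; otherwise the multiplicity sums are unbounded, each point
    counting at least 1. *)
Lemma finite_or_many h : nonzero_mero h ->
  (exists l, uniq l /\ forall z, z \in l <-> ordf h z != 0) \/
  forall K, exists t l, [/\ 1 <= t, uniq l, (forall a, a \in l -> cmod a <= t) & K <= mult h l].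
Proof.
move=> hh; have [L HL] := choice (listable_ord hh).
have [H|H] := pselect (exists N, forall t, (size (L t) <= N)%N); last first.
  right=> K; apply: contrapT => nK; apply: H; exists (Num.bound K) => t.
  rewrite leqNgt; apply/negP => Nt; apply: nK; exists (Num.max t 1), (L t).
  have [ut Ht] := HL t; split=> //; first by rewrite le_max lexx orbT.
    by move=> a /Ht[_ at_]; rewrite le_max at_.
  apply: le_trans (mult_size _); last by move=> a /Ht[].
  have [K0|K0] := leP 0 K; last by apply: le_trans (ltW K0) _.
  by apply: le_trans (ltW (archi_boundP K0)) _; rewrite ler_nat ltnW.
left; case: H => N HN.
have ex : exists n, `[< exists t, size (L t) = n >].
  by exists (size (L 0)); apply/asboolP; exists 0.
have bd n : `[< exists t, size (L t) = n >] -> (n <= N)%N.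
  by move/asboolP => [t <-].
case: (ex_maxnP ex bd) => n /asboolP[t tn] Hn.
exists (L t); have [ut Ht] := HL t; split=> // z; split; first by move=> /Ht[].
move=> nz; pose t' := Num.max t (cmod z); have [ut' Ht'] := HL t'.
have sub : {subset L t <= L t'}.
  by move=> a /Ht[na at_]; apply/Ht'; split=> //; rewrite le_max at_.
have sz : (size (L t') <= size (L t))%N.
  by rewrite tn; apply: Hn; apply/asboolP; exists t'.
have [_ E] := uniq_min_size ut sub sz; rewrite E; apply/Ht'.
by split=> //; rewrite le_max lexx orbT.
Qed.

Theorem transcendental_growth f K : transcendental_meromorphic f ->
  exists r0, forall r, r0 <= r -> good f r -> K * ln r <= bichar f r.
Proof.
move=> tf; have hf := transcendental_nonzero tf; case: (tf) => mf nr.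
wlog K0 : K / 0 <= K.
  move=> H; have [r0 Hr] := H (Num.max 0 K) ltac:(rewrite le_max lexx//).
  exists (Num.max r0 1) => r; rewrite ge_max => /andP[rr r1] gr.
  by apply: le_trans (Hr r rr gr); rewrite ler_wpM2r ?ln_ge0// le_max lexx orbT.
apply: contrapT => nH.
have H x : exists r, [/\ x <= r, good f r & bichar f r < K * ln r].
  apply: contrapT => nx; apply: nH; exists x => r xr gr; rewrite leNgt; apply/negP => h.
  by apply: nx; exists r.
have [[l [ul Hl]]|many] := finite_or_many hf; last first.
  (* For [r >= t ^+ 2] the difference [ln r - ln t] is at least half of [ln r], which the factor 2
     makes up for. *)
  have [t [l [t1 ul lt Kl]]] := many (2 * K).
  have [r [xr gr]] := H (t ^+ 2); rewrite ltNge => /negP; apply.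
  have tr : t <= r by apply: le_trans xr; rewrite expr2 ler_peMl// (le_trans ler01).
  have t0 : 0 < t by exact: lt_le_trans t1.
  have r1 := le_trans t1 tr; have r0 : 0 < r by exact: lt_le_trans r1.
  rewrite (bicharE r0 hf gr); have [V0 _ _] := bichar_ge0 r1 hf gr.
  have M := mult_Ndiv hf t1 tr ul lt.
  apply: (le_trans _ (le_trans M _)); last by rewrite lerDr.
  have lt2 : 2 * ln t <= ln r.
    by rewrite mulr_natl -lnXn// ler_ln ?posrE ?exprn_gt0.
  have lt0 : 0 <= ln t by exact: ln_ge0.
  apply: (@le_trans _ _ (2 * K * (ln r - ln t))).
    have : 0 <= K * (ln r - 2 * ln t) by rewrite mulr_ge0// subr_ge0.
    by move: (ln r) (ln t) => x y; clear; lra.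
  by rewrite ler_wpM2r// subr_ge0 ler_ln ?posrE.
set F := fun w => f w / rprod f l w.
have F0 z : ord_at F z 0 by apply: (ord_quot hf ul) => nz; apply/Hl.
pose G := reg F.
have uG z : unit_at G z by exact: (reg_good (F0 z)).
have GF w : holomorphic_at F w -> G w = F w by move=> hF; exact: (reg_holo_val hF).
(* A common bound for the moduli. If [A + 2 <= r] and [cmod w = r], then [cmod (w - a)] lies between
   1 and [r ^+ 2], so its logarithm lies between 0 and [2 * ln r]. *)
pose A : R := \sum_(a <- l) cmod a.
have lA a : a \in l -> cmod a <= A.
  move=> al; rewrite /A (big_rem a al)/= lerDl; apply: sumr_ge0 => b _; exact: cmod_ge0.
have A0 : 0 <= A by apply: sumr_ge0 => b _; exact: cmod_ge0.
pose m := mult f l.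
have m0 : 0 <= m by apply: sumr_ge0.
have step r : A + 2 <= r -> good f r -> bichar f r < K * ln r ->
    avg (fun w => `|lnmod G w|) r <= (K + 2 * m) * ln r.
  move=> Ar gr br; have r1 : 1 <= r by lra.
  have r0 : 0 < r by lra.
  have cG : oncirc (lnmod G) r by apply: oncirc_lnmod (ltW r0) _ => w _; exact: uG.
  have cf := oncirc_norm (good_oncirc (ltW r0) gr).
  have cc : oncirc (fun _ : R[i]^o => 2 * m * ln r) r by exact: oncirc_cst.
  have : avg (fun w => `|lnmod G w|) r <= avg (fun w => `|lnmod f w| + 2 * m * ln r) r.
    apply: (avg_le (ltW r0) (oncirc_norm cG) (oncircD cf cc)) => w wr.
    have [hw fw] := gr w wr.
    have wl : w \notin l.
      apply/negP => /Hl; rewrite (ordf_nonzero hw fw); by rewrite eqxx.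
    have P0 := rprod_neq0 f wl.
    have hF : holomorphic_at F w := holoM hw (holoV (rprod_holo f wl) P0).
    have -> : lnmod G w = lnmod f w - \sum_(a <- l) ord_div f a * ln (cmod (w - a)).
      rewrite -lnmod_rprod// /lnmod (GF w hF) /F cmodf ln_div// posrE cmod_gt0//.
    apply: le_trans (ler_normB _ _) _; rewrite lerD2l.
    apply: le_trans (ler_norm_sum _ _ _) _; rewrite -mulrA mulrCA /m /mult mulr_suml.
    rewrite big_seq [leRHS]big_seq; apply: ler_sum => a al; rewrite normrM ler_wpM2l//.
    have aA := lA a al.
    have w1 : 1 <= cmod (w - a).
      by apply: le_trans (cmod_sub_ge w a); rewrite wr; move: aA Ar; clear; lra.
    have w2 : cmod (w - a) <= r ^+ 2.
      apply: le_trans (_ : r + r <= _).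
        by have := cmodD w (- a); rewrite cmodN wr; move: aA Ar; clear; lra.
      by rewrite expr2 -mulr2n -mulr_natl ler_wpM2r//; move: Ar A0; clear; lra.
    rewrite ger0_norm ?ln_ge0// mulr_natl -lnXn// ler_ln ?posrE ?exprn_gt0//.
    exact: lt_le_trans w1.
  have -> : avg (fun w => `|lnmod f w| + 2 * m * ln r) r =
      avg (fun w => `|lnmod f w|) r + 2 * m * ln r.
    by rewrite (avgD cf cc); congr (_ + _); exact: avg_cst.
  move=> H1; apply: le_trans H1 _; rewrite [leRHS]mulrDl lerD2r.
  apply: le_trans (ltW br); rewrite (bicharE r0 hf gr) lerDl.
  by have [_ ? _] := bichar_ge0 r1 hf gr.
have G' z : logder G z = 0.
  apply/eqP; rewrite -cmod_eq0; apply/eqP/le_anti; rewrite cmod_ge0 andbT.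
  apply/ler_addgt0Pr => e e0; rewrite add0r.
  pose C := K + 2 * m; have C0 : 0 <= C by rewrite addr_ge0// mulr_ge0.
  (* The last summand is what [32 * C / sqrt r <= e] requires: [logder_bound] contributes at most
     [16 / r] once [2 * cmod z <= r], and [ln r <= 2 * sqrt r]. *)
  have [r [xr gr br]] := H (A + 2 + 2 * cmod z + (32 * C / e) ^+ 2).
  have z0 := cmod_ge0 z; have q0 : 0 <= (32 * C / e) ^+ 2 by exact: sqr_ge0.
  have Ar : A + 2 <= r by lra.
  have r2 : 2 * cmod z <= r by lra.
  have r0 : 0 < r by lra.
  have zr : cmod z < r by lra.
  have qr : (32 * C / e) ^+ 2 <= r by lra.
  have zG : zfree G r by move=> w _; exact: uG.
  apply: le_trans (logder_bound r0 zG zr) _.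
  have S := step r Ar gr br; rewrite -/C in S.
  have sr : 0 < Num.sqrt r by rewrite sqrtr_gt0.
  have lr : ln r <= 2 * Num.sqrt r.
    rewrite -{1}(sqr_sqrtr (ltW r0)) lnXn// mulr_natl lerMn2r/=; exact: ltW (ln_sublinear sr).
  have d1 : 4 * r / (r - cmod z) ^+ 2 <= 16 / r.
    rewrite ler_pdivrMr ?exprn_gt0 ?subr_gt0// mulrAC ler_pdivlMr//.
    have : (r / 2) ^+ 2 <= (r - cmod z) ^+ 2.
      by rewrite lerXn2r ?nnegrE ?subr_ge0 ?(ltW zr) ?divr_ge0 ?(ltW r0)//; move: r2; clear; lra.
    by rewrite expr2; move: ((r - cmod z) ^+ 2) => y; clear; lra.
  have s0 : 0 <= avg (fun w => `|lnmod G w|) r.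
    apply: avg_ge0 (ltW r0) _ _ => [|w _]; last exact: normr_ge0.
    by apply: oncirc_norm; apply: oncirc_lnmod (ltW r0) _ => w _; exact: uG.
  apply: (@le_trans _ _ (16 / r * (C * (2 * Num.sqrt r)))).
    apply: ler_pM => //; first by rewrite divr_ge0 ?mulr_ge0 ?exprn_ge0 ?subr_ge0 ?(ltW r0) ?(ltW zr).
    by apply: le_trans S _; rewrite ler_wpM2l.
  have -> : 16 / r * (C * (2 * Num.sqrt r)) = 32 * C / Num.sqrt r.
    rewrite -{1}(sqr_sqrtr (ltW r0)); move: (Num.sqrt r) sr => y y0.
    by field; rewrite gt_eqF.
  rewrite ler_pdivrMr// -ler_pdivrMl// mulrC.
  rewrite -(@ler_pXn2r _ 2) ?nnegrE ?divr_ge0 ?mulr_ge0 ?(ltW sr) ?(ltW e0)//.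
  by rewrite sqr_sqrtr// ltW.
have mG : meromorphic G by move=> z; apply: mero_holo; case: (uG z).
have [|c Gc] := derive_zero mG.
  move=> z; apply: near_dnear; apply: nearA => w; have [_ Gw] := uG w.
  by apply/eqP; have /eqP := G' w; rewrite /logder mulf_eq0 invr_eq0 (negbTE Gw) orbF.
apply: nr; apply: (@rational_eq f (fun w => c * rprod f l w)); last first.
  apply: rational_mul (rational_rprod f l); apply: (@rational_poly _ c%:P) => z.
  by apply: near_dnear; apply: nearA => w; rewrite hornerC.
move=> z; have GP := dnearI (Gc z) (ord_good (F0 z)).
apply: dnearS2 GP (ord_good (ord_rprod f l z)) => w _ [Gw [hF _]] [_ P0].
by have := GF w hF; rewrite Gw /F /= => ->; rewrite divfK.
Qed.

End Transcendental.

(** * Small errors *)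

Section ProximityArithmetic.
Variable R : realType.
Implicit Types (r s t x y : R) (z w a : R[i]^o) (f g h : R[i]^o -> R[i]^o).

Lemma logpM x y : 0 <= x -> 0 <= y -> logp (x * y) <= logp x + logp y.
Proof.
move=> x0 y0; have l0 : logp 0 = 0 :> R by rewrite /logp ln0// maxxx.
have [->|xn] := eqVneq x 0; first by rewrite mul0r {1}l0 addr_ge0 ?logp_ge0.
have [->|yn] := eqVneq y 0; first by rewrite mulr0 {1}l0 addr_ge0 ?logp_ge0.
have xp : 0 < x by rewrite lt_neqAle eq_sym xn.
have yp : 0 < y by rewrite lt_neqAle eq_sym yn.
rewrite {1}/logp ge_max addr_ge0 ?logp_ge0//= lnM ?posrE//.
by apply: lerD; rewrite /logp le_max lexx orbT.
Qed.

Lemma logp_mono x y : 0 <= x -> x <= y -> logp x <= logp y.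
Proof.
move=> x0 xy; rewrite {1}/logp ge_max logp_ge0/=.
move: x0; rewrite le_eqVlt => /predU1P[<-|x0]; first by rewrite ln0// logp_ge0.
by rewrite /logp le_max ler_ln ?posrE ?xy ?orbT// (lt_le_trans x0).
Qed.

Lemma logpD x y : 0 <= x -> 0 <= y -> logp (x + y) <= logp x + logp y + ln 2.
Proof.
move=> x0 y0; have l2 : logp 2 = ln 2 :> R by rewrite /logp max_r// ln_ge0//; lra.
wlog xy : x y x0 y0 / x <= y.
  move=> H; have [xy|/ltW yx] := leP x y; first exact: H.
  by rewrite addrC [logp x + _]addrC; exact: H.
have : logp (x + y) <= logp (2 * y) by apply: logp_mono; lra.
move=> /le_trans; apply; apply: le_trans (logpM _ y0) _ => //.
by rewrite l2 addrC lerD2r lerDr logp_ge0.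
Qed.

Lemma logpX x n : 0 < x -> logp (x ^+ n) = n%:R * logp x.
Proof.
move=> x0; rewrite /logp lnXn// -[ln x *+ n]mulr_natl; have [h|h] := leP 0 (ln x).
  have h' : 0 <= n%:R * ln x by rewrite mulr_ge0.
  by rewrite (max_r h').
have h' : n%:R * ln x <= 0 by rewrite mulr_ge0_le0// ltW.
by rewrite (max_l h') mulr0.
Qed.

Lemma proximityM f g r : 0 <= r -> oncirc f r -> oncirc g r ->
  proximity (fun w => f w * g w) r <= proximity f r + proximity g r.
Proof.
move=> r0 cf cg; rewrite !proximityE.
have lf := oncirc_logp_cmod r0 cf; have lg := oncirc_logp_cmod r0 cg.
rewrite -(avgD lf lg); apply: (avg_le r0 _ (oncircD lf lg)).
  exact: oncirc_logp_cmod r0 (oncirc_cplxM cf cg).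
by move=> w _; rewrite cmodM logpM ?cmod_ge0.
Qed.

Lemma proximityD f g r : 0 <= r -> oncirc f r -> oncirc g r ->
  proximity (fun w => f w + g w) r <= proximity f r + proximity g r + ln 2.
Proof.
move=> r0 cf cg; rewrite !proximityE.
have lf := oncirc_logp_cmod r0 cf; have lg := oncirc_logp_cmod r0 cg.
have cc : oncirc (fun _ : R[i]^o => ln 2 : R) r by exact: oncirc_cst.
rewrite -(avg_cst (ln 2) r) -(avgD lf lg) -(avgD (oncircD lf lg) cc).
apply: (avg_le r0 _ (oncircD (oncircD lf lg) cc)).
  exact: oncirc_logp_cmod r0 (oncirc_cplxD cf cg).
move=> w _; apply: le_trans (logpD (cmod_ge0 _) (cmod_ge0 _)).
by apply: logp_mono; [exact: cmod_ge0|exact: cmodD].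
Qed.

Lemma eq_proximity f g r : 0 <= r -> (forall w, cmod w = r -> f w = g w) ->
  proximity f r = proximity g r.
Proof. by move=> r0 fg; rewrite !proximityE; apply: eq_avg r0 _ => w /fg ->. Qed.

Lemma proximityX f n r : 0 <= r -> oncirc f r -> (forall w, cmod w = r -> f w != 0) ->
  proximity (fun w => f w ^+ n) r = n%:R * proximity f r.
Proof.
move=> r0 cf f0; rewrite !proximityE -(avgZ _ (oncirc_logp_cmod r0 cf)).
by apply: eq_avg r0 _ => w wr; rewrite cmodX logpX// cmod_gt0 f0.
Qed.

Lemma proximity_cst1 r : proximity (fun=> 1) r = 0.
Proof.
rewrite proximityE -(avg_cst 0 r); congr (avg _ r); apply/funext => w.
by rewrite cmod1 /logp ln1 maxxx.
Qed.

Lemma good_oncirc_id h r : 0 <= r -> good h r -> oncirc h r.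
Proof. by move=> r0 gh; apply: oncirc_for => // w /gh[hw _]; exact: holo_cont. Qed.

Lemma counting_ge0 h r : 1 <= r -> nonzero_mero h -> 0 <= Defs.counting h r.
Proof. by move=> r1 hh; rewrite countingE; apply: Ndiv_ge0 (locfin_pole hh) _. Qed.

Lemma characteristic_ge0 h r : 1 <= r -> nonzero_mero h -> good h r ->
  [/\ 0 <= proximity h r, 0 <= Defs.counting h r & 0 <= characteristic h r].
Proof.
move=> r1 hh gh; have r0 : 0 <= r by exact: le_trans r1.
have p0 := proximity_ge0 r0 (good_oncirc_id r0 gh).
by have c0 := counting_ge0 r1 hh; split=> //; exact: addr_ge0.
Qed.

Lemma goodM f g r : good f r -> good g r -> good (fun w => f w * g w) r.
Proof. by move=> gf gg w wr; exact: unitM (gf w wr) (gg w wr). Qed.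

Lemma pole_orderM f g z : nonzero_mero f -> nonzero_mero g ->
  pole_div (fun w => f w * g w) z <= pole_div f z + pole_div g z.
Proof.
move=> hf hg; rewrite /pole_div -natrD ler_nat.
rewrite (pole_orderE' z hf) (pole_orderE' z hg) (pole_orderE' z (nzmM hf hg)).
rewrite (ordfM z hf hg); move: (ordf f z) (ordf g z) => n m; clear.
by do 3!case: ltP => ?; lia.
Qed.

Lemma characteristicM f g r : 1 <= r -> nonzero_mero f -> nonzero_mero g ->
  good f r -> good g r ->
  characteristic (fun w => f w * g w) r <= characteristic f r + characteristic g r.
Proof.
move=> r1 hf hg gf gg; have r0 : 0 < r by exact: lt_le_trans r1.
rewrite /characteristic addrACA; apply: lerD.
  by apply: proximityM (ltW r0) _ _; exact: good_oncirc_id (ltW r0) _.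
have lf := locfin_pole hf; have lg := locfin_pole hg.
rewrite !countingE -(NdivD r0 lf lg).
apply: Ndiv_le r1 (locfin_pole (nzmM hf hg)) (locfinD lf lg) _ => z.
exact: pole_orderM.
Qed.

(** A pole of order p becomes one of order [p + 1 <= 2 * p], and no new poles arise. *)
Lemma pole_div_derive h z : nonzero_mero h -> nonzero_mero h^`()%classic ->
  pole_div h^`()%classic z <= 2 * pole_div h z.
Proof.
move=> hh hh'; rewrite /pole_div -natrM ler_nat.
rewrite (pole_orderE' z hh) (pole_orderE' z hh').
have [n0|n0] := eqVneq (ordf h z) 0; last first.
  rewrite (ordfE (ord_derive n0 (nzm_ord z hh))); move: (ordf h z) n0 => n; clear.
  by do 2!case: ltP => ?; lia.
have o := nzm_ord z hh; rewrite n0 in o.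
have := regular_ord (regular_derive (ord_regular o (lexx 0))) (nzm_ord z hh').
by rewrite n0; case: ltP.
Qed.

Lemma characteristic_derive h r : 1 <= r -> nonzero_mero h -> nonzero_mero h^`()%classic ->
  good h r -> characteristic h^`()%classic r <= 2 * characteristic h r + proximity (logder h) r.
Proof.
move=> r1 hh hh' gh; have r0 : 0 < r by exact: lt_le_trans r1.
have ch := good_oncirc_id (ltW r0) gh.
have cl : oncirc (logder h) r.
  by apply: oncirc_for (ltW r0) _ => w /gh[hw h0]; apply: holo_cont; exact: logder_holo.
have [p0 c0 _] := characteristic_ge0 r1 hh gh.
have H1 : proximity h^`()%classic r <= proximity (logder h) r + proximity h r.
  apply: le_trans (proximityM (ltW r0) cl ch).
  rewrite (@eq_proximity _ (fun w => logder h w * h w) r (ltW r0))// => w /gh[_ h0].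
  by rewrite /logder divfK.
have H2 : Defs.counting h^`()%classic r <= 2 * Defs.counting h r.
  rewrite !countingE -(NdivZ 2 r0 (locfin_pole hh)).
  apply: Ndiv_le r1 (locfin_pole hh') (locfinZ 2 (locfin_pole hh)) _ => z.
  exact: pole_div_derive.
by rewrite /characteristic; lra.
Qed.

Lemma ord_sub1 f z (n : int) : ord_at f z n ->
  [/\ n < 0 -> ord_at (fun w => f w - 1) z n, 0 < n -> ord_at (fun w => f w - 1) z 0 &
      0 <= n -> regular_at (fun w => f w - 1) z].
Proof.
move=> fo; have reg0 : 0 <= n -> regular_at (fun w => f w - 1) z.
  move=> n0; have [g [hg fg]] := ord_regular fo n0.
  exists (fun w => g w - 1); split; first exact: (holoB hg (holo_cst 1 z)).
  by apply: dnearS fg => w _ ->.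
split=> //.
  case: n fo {reg0} => n // [g [hg gz fg]] _.
  exists (fun w => g w - (w - z) ^+ n.+1); split.
  - exact: (holoB hg (holoX n.+1 (@holo_sub R z z))).
  - by rewrite subrr expr0n /= subr0.
  apply: dnearS fg => w wz ->; have wz0 : w - z != 0 by rewrite subr_eq0.
  have -> : (w - z) ^ Negz n = ((w - z) ^+ n.+1)^-1 by [].
  by rewrite mulrBl divff// expf_neq0.
case: n fo {reg0} => // -[//|n] [g [hg gz fg]] _.
exists (fun w => g w * (w - z) ^+ n.+1 - 1); split.
- exact: (holoB (holoM hg (holoX n.+1 (@holo_sub R z z))) (holo_cst 1 z)).
- by rewrite subrr expr0n /= mulr0 sub0r oppr_eq0 oner_neq0.
by apply: dnearS fg => w wz ->; rewrite expr0z mulr1.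
Qed.

Lemma characteristic_sub1 f r : 1 <= r -> nonzero_mero f ->
  nonzero_mero (fun w => f w - 1) -> good f r ->
  characteristic (fun w => f w - 1) r <= characteristic f r + ln 2.
Proof.
move=> r1 hf hf1 gf; have r0 : 0 < r by exact: lt_le_trans r1.
have H1 : proximity (fun w => f w - 1) r <= proximity f r + proximity (fun=> -1) r + ln 2.
  by apply: proximityD (ltW r0) (good_oncirc_id (ltW r0) gf) _; exact: oncirc_cst.
have E : proximity (fun=> - 1) r = 0 :> R.
  rewrite -(proximity_cst1 r) !proximityE; congr (avg _ r).
  by apply/funext => w; rewrite cmodN.
have H2 : Defs.counting (fun w => f w - 1) r <= Defs.counting f r.
  rewrite !countingE; apply: Ndiv_le r1 (locfin_pole hf1) (locfin_pole hf) _ => z.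
  rewrite /pole_div ler_nat (pole_orderE' z hf) (pole_orderE' z hf1).
  have [s1 s2 s3] := ord_sub1 (nzm_ord z hf).
  case: ifP => // n1; have n0 : ordf f z < 0.
    rewrite ltNge; apply/negP => /s3 /regular_ord /(_ (nzm_ord z hf1)).
    by rewrite leNgt n1.
  by rewrite n0 (ordfE (s1 n0)).
by rewrite /characteristic; lra.
Qed.

End ProximityArithmetic.

(** * Calculus of errors that are small with respect to [f] *)

Section SmallErrors.
Variable R : realType.
Variable f : R[i]^o -> R[i]^o.
Variable tf : transcendental_meromorphic f.
Implicit Types (r s x c : R) (w : R[i]^o) (g h b : R[i]^o -> R[i]^o) (u v : R -> R)
  (P Q : R -> Prop).

Notation T := (characteristic f).

Definition evt P := exists E r0, exceptional E /\ forall r : R, r0 <= r -> ~ E r -> P r.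

(* one-sided: only upper bounds for errors are needed *)
Definition usmall u := exists E, exceptional E /\ forall eps : R, 0 < eps ->
  exists r0, forall r, r0 <= r -> ~ E r -> u r <= eps * T r.

Lemma evtI P Q : evt P -> evt Q -> evt (fun r => P r /\ Q r).
Proof.
move=> [E [r0 [eE HP]]] [E' [r0' [eE' HQ]]]; exists (E `|` E'), (Num.max r0 r0').
split; first exact: exceptionalU.
move=> r; rewrite ge_max => /andP[r1 r2] nE; split.
  by apply: HP => // ?; apply: nE; left.
by apply: HQ => // ?; apply: nE; right.
Qed.

Lemma evtS P Q : (forall r, P r -> Q r) -> evt P -> evt Q.
Proof.
by move=> PQ [E [r0 [eE HP]]]; exists E, r0; split=> // r r1 nE; apply: PQ; exact: HP.
Qed.

Lemma evt_ge x : evt (fun r => x <= r).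
Proof. by exists set0, x; split=> //; exact: exceptional0. Qed.

Lemma evt_all n (P : nat -> R -> Prop) : (forall i, evt (P i)) ->
  evt (fun r => forall i, (i <= n)%N -> P i r).
Proof.
move=> HP; elim: n => [|n IH]; first by apply: evtS (HP 0%N) => r Pr [].
apply: evtS (evtI IH (HP n.+1)) => r [H1 H2] i; rewrite leq_eqVlt => /predU1P[->//|].
by rewrite ltnS; exact: H1.
Qed.

Lemma evt_good h : nonzero_mero h -> evt (good h).
Proof.
move=> hh; have [E [eE HE]] := exceptional_good hh; exists E, 1; split=> // r r1.
by apply: HE; exact: lt_le_trans r1.
Qed.

Lemma usmall_le u v : usmall v -> evt (fun r => u r <= v r) -> usmall u.
Proof.
move=> [E [eE Hv]] [E' [r0' [eE' H]]]; exists (E `|` E'); split; first exact: exceptionalU.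
move=> eps e0; have [r0 H0] := Hv eps e0; exists (Num.max r0 r0') => r.
rewrite ge_max => /andP[r1 r2] nE; exact: le_trans (H r r2 (fun e => nE (or_intror e))) (H0 r r1 (fun e => nE (or_introl e))).
Qed.

Lemma usmallD u v : usmall u -> usmall v -> usmall (fun r => u r + v r).
Proof.
move=> [E [eE Hu]] [E' [eE' Hv]]; exists (E `|` E'); split; first exact: exceptionalU.
move=> eps e0; have e2 : 0 < eps / 2 by rewrite divr_gt0.
have [r0 H0] := Hu _ e2; have [r1 H1] := Hv _ e2; exists (Num.max r0 r1) => r.
rewrite ge_max => /andP[rr0 rr1] nE; rewrite [eps]splitr mulrDl; apply: lerD.
  by apply: H0 => // ?; apply: nE; left.
by apply: H1 => // ?; apply: nE; right.
Qed.

Let hf := transcendental_nonzero tf.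

Lemma bichar_first h : nonzero_mero h -> exists c, 0 <= c /\
  forall r, 0 < r -> good h r -> bichar h r <= 2 * characteristic h r + c /\
    2 * characteristic h r <= bichar h r + c.
Proof.
move=> hh; have [C HC] := first_main hh; exists `|C|; split=> // r r0 gr.
rewrite /bichar (HC r r0 gr); have := ler_norm C; have := ler_norm (- C); rewrite normrN.
by move: (characteristic _ r) => x h1 h2; split; lra.
Qed.

(** [transcendental_growth] with slope [4 / eps + C], where [C] bounds the difference between
    [bichar f] and [2 T], gives [2 ln r <= eps * T r]; one of the two logarithms absorbs [c]. This
    is where transcendence enters the error calculus, and smallness of constants follows from it. *)
Lemma usmall_lnD c : usmall (fun r => ln r + c).
Proof.
have [C [C0 HC]] := bichar_first hf; have [E [eE HE]] := exceptional_good hf.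
exists E; split=> // eps e0.
have [r0 Hr0] := transcendental_growth (4 / eps + C) tf.
exists (Num.max r0 (expR (Num.max 1 c))) => r; rewrite ge_max => /andP[rr0 re] nE.
have rp : 0 < r by apply: lt_le_trans re; exact: expR_gt0.
have gr := HE r rp nE; have [Hb _] := HC r rp gr.
have := le_trans (Hr0 r rr0 gr) Hb.
have : Num.max 1 c <= ln r by rewrite -[X in X <= _]expRK ler_ln ?posrE ?expR_gt0.
rewrite ge_max => /andP[l1 lc] H.
have H2 : (4 / eps) * ln r <= 2 * T r.
  have : C <= C * ln r by rewrite ler_peMr.
  by move: H; rewrite mulrDl; move: (_ / _ * _) (C * _) => x y; lra.
have : 2 * ln r <= eps * T r.
  have -> : 2 * ln r = eps / 2 * (4 / eps * ln r).
    by field; rewrite gt_eqF.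
  have -> : eps * T r = eps / 2 * (2 * T r) by field.
  by rewrite ler_wpM2l// divr_ge0// ltW.
by move: (eps * _) lc => x; lra.
Qed.

Lemma usmall_cst c : usmall (fun=> c).
Proof.
apply: usmall_le (usmall_lnD c) _; apply: evtS (evt_ge 1) => r r1.
by rewrite lerDr ln_ge0.
Qed.

Lemma usmall_ln : usmall (@ln R).
Proof. by apply: usmall_le (usmall_lnD 0) _; apply: evtS (evt_ge 1) => r _; rewrite addr0. Qed.

(** Smallness of the constant 0, taken at [eps = 1], is exactly this bound. *)
Lemma evtT0 : evt (fun r => 0 <= T r).
Proof.
have [E [eE H]] := usmall_cst 0; have [r0 H0] := H 1 ltr01.
by exists E, r0; split=> // r rr nE; have := H0 r rr nE; rewrite mul1r.
Qed.

Lemma usmallZ c u : 0 <= c -> usmall u -> usmall (fun r => c * u r).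
Proof.
move=> c0 [E [eE Hu]]; have [E' [r1 [eE' HT]]] := evtT0.
exists (E `|` E'); split; first exact: exceptionalU.
move=> eps e0; have c1 : 0 < c + 1 by rewrite ltr_wpDl.
have [r0 H0] := Hu (eps / (c + 1)) (divr_gt0 e0 c1).
exists (Num.max r0 r1) => r; rewrite ge_max => /andP[rr0 rr1] nE.
have h1 := H0 r rr0 (fun e => nE (or_introl e)).
have h2 := HT r rr1 (fun e => nE (or_intror e)).
apply: le_trans (ler_wpM2l c0 h1) _; rewrite mulrA ler_wpM2r//.
by rewrite mulrCA ler_piMr ?(ltW e0)// ler_pdivrMr// mul1r lerDl.
Qed.

(** [ln y <= d * y - ln d] for every [d > 0]. With [d = eps / (2 * (C + 1))] the linear term costs
    at most [eps / 2] of [T] and a constant, and the constant is dominated by [ln r]. *)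
Lemma usmall_log u (C : R) : 0 <= C -> evt (fun r => 0 <= u r <= C * T r) ->
  usmall (fun r => ln (expR 1 + u r)).
Proof.
move=> C0 Hu; have [E [eE Hl]] := usmall_ln; have [E' [r1 [eE' Hu']]] := evtI evtT0 Hu.
exists (E `|` E'); split; first exact: exceptionalU.
move=> eps e0; have C1 : 0 < C + 1 by rewrite ltr_wpDl.
pose d := eps / (2 * (C + 1)); have d0 : 0 < d by rewrite divr_gt0// mulr_gt0.
have e2 : 0 < eps / 2 by rewrite divr_gt0.
have [r0 H0] := Hl _ e2; pose c := d * expR 1 - ln d.
exists (Num.max (Num.max r0 r1) (expR c)) => r.
rewrite !ge_max -andbA => /and3P[rr0 rr1 rc] nE.
have rp : 0 < r by apply: lt_le_trans rc; exact: expR_gt0.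
have h1 := H0 r rr0 (fun e => nE (or_introl e)).
have [T0 /andP[u0 uT]] := Hu' r rr1 (fun e => nE (or_intror e)).
have lc : c <= ln r by rewrite -[X in X <= _]expRK ler_ln ?posrE ?expR_gt0.
have y0 : 0 < expR 1 + u r by rewrite ltr_wpDr ?expR_gt0.
have L : ln (expR 1 + u r) <= d * (expR 1 + u r) - ln d.
  rewrite lerBrDr -lnM ?posrE// mulrC.
  by apply: ltW; apply: ln_sublinear; rewrite mulr_gt0.
apply: le_trans L _; rewrite mulrDr addrAC -/c.
have dT : d * u r <= eps / 2 * T r.
  have -> : eps / 2 * T r = d * ((C + 1) * T r).
    by rewrite /d; field; rewrite gt_eqF.
  by rewrite ler_wpM2l ?(ltW d0)//; apply: le_trans uT _; rewrite mulrDl mul1r lerDl.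
rewrite [eps in leRHS]splitr [leRHS]mulrDl; apply: lerD dT.
exact: le_trans lc h1.
Qed.

(** With [bichar] in place of the characteristic the class is closed under inverses at once. It is
    also closed under products, and under non-zero derivatives and differences with 1, so that the
    logarithmic derivatives of [F] and [F - 1] are within reach. *)
Definition dominated h := nonzero_mero h /\ exists C : R, 0 <= C /\
  evt (fun r => bichar h r <= C * T r).

Lemma evt_basic h : nonzero_mero h -> evt (fun r => 1 <= r /\ good h r).
Proof. by move=> hh; apply: evtI (evt_ge 1) (evt_good hh). Qed.

Lemma evt_const_le c : evt (fun r => c <= T r).
Proof.
have [E [eE H]] := usmall_cst c; have [r0 H0] := H 1 ltr01.
by exists E, r0; split=> // r rr nE; have := H0 r rr nE; rewrite mul1r.
Qed.

Lemma dominated_char h (C : R) : nonzero_mero h -> 0 <= C ->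
  evt (fun r => characteristic h r <= C * T r) -> dominated h.
Proof.
move=> hh C0 Hc; split=> //; have [c [c0 Hb]] := bichar_first hh.
exists (2 * C + 1); split; first by rewrite addr_ge0// mulr_ge0.
apply: evtS (evtI Hc (evtI (evt_const_le c) (evt_basic hh))) => r [H1 [H2 [r1 gr]]].
have [H3 _] := Hb r (lt_le_trans ltr01 r1) gr; apply: le_trans H3 _.
have -> : (2 * C + 1) * T r = 2 * (C * T r) + T r by ring.
by move: (C * _) H1 => x; lra.
Qed.

Lemma char_le_bichar h r : nonzero_mero h -> 1 <= r -> good h r ->
  characteristic h r <= bichar h r.
Proof.
move=> hh r1 gr; have [_ _ H] := characteristic_ge0 r1 (nzmV hh) (good_inv gr).
by rewrite /bichar lerDl.
Qed.

Lemma dominated_charP h : dominated h -> exists C : R, 0 <= C /\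
  evt (fun r => characteristic h r <= C * T r).
Proof.
move=> [hh [C [C0 H]]]; exists C; split=> //.
apply: evtS (evtI H (evt_basic hh)) => r [H1 [r1 gr]].
exact: le_trans (char_le_bichar hh r1 gr) H1.
Qed.

Lemma dominated_self : dominated f.
Proof.
by apply: (@dominated_char f 1) => //; apply: evtS (evt_ge 0) => r _; rewrite mul1r.
Qed.

Lemma dominatedM g h : dominated g -> dominated h -> dominated (fun w => g w * h w).
Proof.
move=> dg dh; have [C [C0 HC]] := dominated_charP dg; have [D [D0 HD]] := dominated_charP dh.
case: dg dh => [hg _] [hh _]; apply: (@dominated_char _ (C + D)) (nzmM hg hh) (addr_ge0 C0 D0) _.
apply: evtS (evtI (evtI HC HD) (evtI (evt_basic hg) (evt_basic hh))).
move=> r [[H1 H2] [[r1 gr] [_ gr']]]; rewrite mulrDl.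
by apply: le_trans (characteristicM r1 hg hh gr gr') _; exact: lerD.
Qed.

Lemma dominatedV h : dominated h -> dominated (fun w => (h w)^-1).
Proof.
move=> [hh [C [C0 H]]]; split; first exact: nzmV.
exists C; split=> //; apply: evtS H => r; rewrite /bichar addrC.
by have -> : (fun w => (h w)^-1^-1) = h by apply/funext => w; rewrite invrK.
Qed.

Lemma nonzero_cst1 : nonzero_mero (fun _ : R[i]^o => 1 : R[i]^o).
Proof.
apply: (@nzm_of_ord _ _ 0 0); first by move=> z; exact: mero_cst.
exact: ord_cst (oner_neq0 _).
Qed.

Lemma counting_cst1 r : 0 < r -> Defs.counting (fun _ : R[i]^o => 1 : R[i]^o) r = 0.
Proof.
move=> r0; have c : carries [::] (pole_div (fun _ : R[i]^o => 1 : R[i]^o)) r.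
  split=> // z; rewrite /pole_div (pole_orderE (ord_cst z (oner_neq0 _))) /=.
  by rewrite eqxx.
by rewrite countingE (NdivE r0 c) big_nil.
Qed.

Lemma dominated_cst1 : dominated (fun=> 1).
Proof.
apply: (@dominated_char _ 1) nonzero_cst1 ler01 _.
apply: evtS (evtI evtT0 (evt_ge 1)) => r [T0 r1].
by rewrite /characteristic proximity_cst1 counting_cst1 ?add0r ?mul1r// (lt_le_trans ltr01).
Qed.

Lemma dominatedX h n : dominated h -> dominated (fun w => h w ^+ n).
Proof.
move=> dh; elim: n => [|n IH]; first exact: dominated_cst1.
have -> : (fun w => h w ^+ n.+1) = fun w => h w * h w ^+ n.
  by apply/funext => w; rewrite exprS.
exact: dominatedM.
Qed.

Lemma usmall_logder h : dominated h -> usmall (proximity (logder h)).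
Proof.
move=> [hh [C [C0 HC]]]; have [K [E [K0 eE HK]]] := log_derivative_lemma hh.
have Hb : evt (fun r => 0 <= bichar h r <= C * T r).
  apply: evtS (evtI HC (evt_basic hh)) => r [H1 [r1 gr]]; rewrite H1 andbT.
  by have [_ _] := bichar_ge0 r1 hh gr.
have S := usmallZ K0 (usmallD (usmall_lnD 1) (usmall_log C0 Hb)).
apply: usmall_le S _; exists E, 1; split=> // r r1 nE.
by have [_] := HK r r1 nE; rewrite [ln r + 1]addrC.
Qed.

Lemma oncirc_logder h r : 0 <= r -> good h r -> oncirc (logder h) r.
Proof.
by move=> r0 gh; apply: oncirc_for r0 _ => w /gh[hw h0]; apply: holo_cont; exact: logder_holo.
Qed.

Lemma dominated_derive h : dominated h -> nonzero_mero h^`()%classic ->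
  dominated h^`()%classic.
Proof.
move=> dh hh'; have [C [C0 HC]] := dominated_charP dh; have [hh _] := dh.
have [E [eE HE]] := usmall_logder dh; have [r0 H0] := HE 1 ltr01.
have L : evt (fun r => proximity (logder h) r <= T r).
  by exists E, r0; split=> // r rr nE; have := H0 r rr nE; rewrite mul1r.
apply: (@dominated_char _ (2 * C + 1)) => //; first by rewrite addr_ge0// mulr_ge0.
apply: evtS (evtI (evtI HC L) (evt_basic hh)) => r [[H1 H2] [r1 gr]].
apply: le_trans (characteristic_derive r1 hh hh' gr) _.
have -> : (2 * C + 1) * T r = 2 * (C * T r) + T r by ring.
by move: (C * _) H1 => x; lra.
Qed.

Lemma dominated_derive_n n : dominated f^`(n)%classic.
Proof.
elim: n => [|n IH]; first exact: dominated_self.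
rewrite derive1nS; apply: dominated_derive => //.
by rewrite -derive1nS; exact: transcendental_derive_n.
Qed.

Lemma dominated_sub1 h : dominated h -> nonzero_mero (fun w => h w - 1) ->
  dominated (fun w => h w - 1).
Proof.
move=> dh h1; have [C [C0 HC]] := dominated_charP dh; have [hh _] := dh.
apply: (@dominated_char _ (C + 1)) => //; first exact: addr_ge0.
apply: evtS (evtI (evtI HC (evt_const_le (ln 2))) (evt_basic hh)) => r [[H1 H2] [r1 gr]].
by apply: le_trans (characteristic_sub1 r1 hh h1 gr) _; rewrite mulrDl mul1r lerD.
Qed.

Lemma small_nonzero b : small_function f b -> nonzero_mero b.
Proof. by case. Qed.

(** By the first main theorem [1/b] is as small as [b], so both may occur as factors. *)
Lemma small_bichar b : small_function f b -> usmall (bichar b).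
Proof.
move=> sb; have hb := small_nonzero sb; case: sb => _ _ [E [E1 E2 E3 HE]].
have [c [c0 Hc]] := bichar_first hb.
have S : usmall (characteristic b).
  have [E' [r1 [eE' HT]]] := evtT0.
  exists (E `|` E'); split; first by apply: exceptionalU => //; split.
  move=> eps e0; have [r0 [_ H0]] := HE eps e0.
  exists (Num.max (r0 + 1) r1) => r; rewrite ge_max => /andP[rr0 rr1] nE.
  have := H0 r ltac:(lra) (fun e => nE (or_introl e)).
  rewrite (ger0_norm (HT r rr1 (fun e => nE (or_intror e)))).
  by apply: le_trans; exact: ler_norm.
apply: usmall_le (usmallD (usmallZ (ler0n R 2) S) (usmall_cst c)) _.
apply: evtS (evt_basic hb) => r [r1 gr].
by have [] := Hc r (lt_le_trans ltr01 r1) gr.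
Qed.

Lemma small_dominated b : small_function f b -> dominated b.
Proof.
move=> sb; split; first exact: small_nonzero.
exists 1; split=> //; have [E [eE H]] := small_bichar sb; have [r0 H0] := H 1 ltr01.
by exists E, r0.
Qed.

End SmallErrors.

(** * The differential monomial *)

(* [X] stands for [n p], where [p], [e], [d], [g] are the orders of [f], [F], [F - 1]
   and [F' / (F - 1)] at a point, and [al], [s], [be] those of the factors of
   [F = a P / phi]. *)
Lemma order_count (m : nat) (X p al s be e d g : int) :
  (d != 0 -> g = -1) -> (d = 0 -> 0 <= g) -> (0 < e -> g = e - 1) ->
  (e < 0 -> d = e) -> (0 < e -> d = 0) -> (0 <= e -> 0 <= d) ->
  e = al + s - be -> (0 <= p -> 0 <= s) -> (0 <= p -> X - m%:Z <= s) ->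
  (if 0 < p then X else 0) - g <=
    (m%:Z + 1) * (0 < p)%R%:Z + (p < 0)%R%:Z + (0 < d + be)%R%:Z + (`|al| + `|be|).
Proof.
move=> g1 g2 g3 d1 d2 d3 es s0 sX.
case: (ltgtP p 0) => p0 /=; rewrite ?mulr0 ?mulr1.
- by case: (ltP 0 (d + be)) => _ /=; case: (eqVneq d 0) => [/g2|/g1]; lia.
(* At a zero of [f] with [e > 0] one has [g = e - 1], while [X - e <= m] up to [al] and [be];
   together this gives the factor [m + 1]. *)
- have := sX (ltW p0); case: (ltgtP e 0) => e0.
  + have := g1; rewrite (d1 e0) => /(_ ltac:(lia)) ->; case: (ltP 0 (e + be)); lia.
  + rewrite (g3 e0) (d2 e0); case: (ltP 0 (0 + be)); lia.
  + by case: (ltP 0 (d + be)) => _ /=; case: (eqVneq d 0) => [/g2|/g1]; lia.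
(* Where [f] has neither zero nor pole, a simple pole of [F' / (F - 1)] is charged to a zero of the
   target, or else [al] or [be] is non-zero. *)
- have := s0; rewrite p0 => /(_ (lexx 0)) sp.
  case: (eqVneq d 0) => [/g2|dn]; first by case: (ltP 0 (d + be)); lia.
  rewrite (g1 dn); case: (ltP 0 (d + be)) => /= db; first by lia.
  by case: (ltgtP e 0) => e0; [move: (d1 e0)|move: (d2 e0)|move: (d3 (ltac:(by rewrite e0)))]; lia.
Qed.

Section DifferentialMonomial.
Variable R : realType.
Variables (f phi a : R[i]^o -> R[i]^o) (k : nat) (q : nat -> nat).
Hypothesis tf : transcendental_meromorphic f.
Hypothesis sphi : small_function f phi.
Hypothesis sa : small_function f a.
Implicit Types (r c : R) (w z : R[i]^o) (g h : R[i]^o -> R[i]^o).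

Notation T := (characteristic f).

Let hf := transcendental_nonzero tf.
Let hphi := small_nonzero sphi.
Let ha := small_nonzero sa.
Let hd i : nonzero_mero f^`(i)%classic := transcendental_derive_n i tf.

Let n := (\sum_(0 <= i < k.+1) q i)%N.

(** Continuity on the circle is carried along because [proximityM] needs it of both factors. *)
Definition prox_small g := evt (fun r => oncirc g r) /\ usmall f (proximity g).

Lemma prox_smallM g h : prox_small g -> prox_small h -> prox_small (fun w => g w * h w).
Proof.
move=> [cg ug] [ch uh]; split.
  by apply: evtS (evtI cg ch) => r [c1 c2]; exact: oncirc_cplxM.
apply: usmall_le (usmallD ug uh) _; apply: evtS (evtI (evtI cg ch) (evt_ge 0)).
by move=> r [[c1 c2] r0]; exact: proximityM.
Qed.

Lemma prox_small1 : prox_small (fun=> 1).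
Proof.
split; first by apply: evtS (evt_ge 0) => r _; exact: oncirc_cst.
apply: usmall_le (usmall_cst tf 0) _; apply: evtS (evt_ge 0) => r _.
by rewrite proximity_cst1.
Qed.

Lemma prox_smallX g m : prox_small g -> prox_small (fun w => g w ^+ m).
Proof.
move=> sg; elim: m => [|m IH]; first exact: prox_small1.
have -> : (fun w => g w ^+ m.+1) = fun w => g w * g w ^+ m.
  by apply/funext => w; rewrite exprS.
exact: prox_smallM.
Qed.

Lemma prox_small_prod (g : nat -> R[i]^o -> R[i]^o) m : (forall i, prox_small (g i)) ->
  prox_small (fun w => \prod_(0 <= i < m) g i w).
Proof.
move=> sg; elim: m => [|m IH].
  have -> : (fun w => \prod_(0 <= i < 0) g i w) = fun=> 1.
    by apply/funext => w; rewrite big_nil.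
  exact: prox_small1.
have -> : (fun w => \prod_(0 <= i < m.+1) g i w) =
    fun w => (\prod_(0 <= i < m) g i w) * g m w.
  by apply/funext => w; rewrite big_nat_recr.
exact: prox_smallM.
Qed.

Lemma prox_small_small b : small_function f b -> prox_small b.
Proof.
move=> sb; have hb := small_nonzero sb; split.
  by apply: evtS (evt_basic hb) => r [r1 gr]; exact: good_oncirc_id (le_trans ler01 r1) gr.
apply: usmall_le (small_bichar tf sb) _; apply: evtS (evt_basic hb) => r [r1 gr].
apply: le_trans (char_le_bichar hb r1 gr); rewrite /characteristic lerDl.
exact: counting_ge0.
Qed.

Lemma prox_small_smallV b : small_function f b -> prox_small (fun w => (b w)^-1).
Proof.
move=> sb; have hb := small_nonzero sb; have hV := nzmV hb; split.
  by apply: evtS (evt_basic hV) => r [r1 gr]; exact: good_oncirc_id (le_trans ler01 r1) gr.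
apply: usmall_le (small_bichar tf sb) _; apply: evtS (evt_basic hb) => r [r1 gr].
have [_ _ H] := characteristic_ge0 r1 hb gr; rewrite /bichar -[leLHS]add0r; apply: lerD H _.
by rewrite /characteristic lerDl; exact: counting_ge0.
Qed.

Lemma prox_small_logder h : dominated f h -> prox_small (logder h).
Proof.
move=> dh; have [hh _] := dh; split; last exact: usmall_logder.
by apply: evtS (evt_basic hh) => r [r1 gr]; exact: oncirc_logder (le_trans ler01 r1) gr.
Qed.

(* [f^(i) / f] as a product of logarithmic derivatives *)
Let D i w := \prod_(0 <= j < i) logder f^`(j)%classic w.

Let DE i w : (forall j, (j <= i)%N -> unit_at f^`(j)%classic w) ->
  f^`(i)%classic w = D i w * f w.
Proof.
elim: i => [|i IH] H; first by rewrite /D big_nil mul1r.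
rewrite /D big_nat_recr//= mulrAC -/(D i w) -IH; last by move=> j ji; apply: H; exact: leqW.
have [_ u0] := H i (leqnSn i).
by rewrite /logder [RHS]mulrC divfK.
Qed.

Let P m w := \prod_(0 <= i < m) f^`(i)%classic w ^+ q i.

Let hP m : dominated f (P m).
Proof.
elim: m => [|m IH].
  have -> : P 0 = fun=> 1 by apply/funext => w; rewrite /P big_nil.
  exact: dominated_cst1 tf.
have -> : P m.+1 = fun w => P m w * f^`(m)%classic w ^+ q m.
  by apply/funext => w; rewrite /P big_nat_recr.
exact: (dominatedM tf IH (dominatedX tf (q m) (dominated_derive_n tf m))).
Qed.

Let ordP m z : ordf (P m) z = \sum_(0 <= i < m) ordf f^`(i)%classic z * (q i)%:Z.
Proof.
elim: m => [|m IH].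
  rewrite big_nil; have -> : P 0 = fun=> 1 by apply/funext => w; rewrite /P big_nil.
  exact: ordfE (ord_cst z (oner_neq0 _)).
have -> : P m.+1 = fun w => P m w * f^`(m)%classic w ^+ q m.
  by apply/funext => w; rewrite /P big_nat_recr.
by rewrite (ordfM z (hP m).1 (nzmX (q m) (hd m))) IH (ordfX _ _ (hd m)) big_nat_recr.
Qed.

Let M := diff_monomial a f k q.

Let F w := M w / phi w.

Let dF : dominated f F.
Proof.
have dM : dominated f M := dominatedM tf (small_dominated tf sa) (hP k.+1).
exact: (dominatedM tf dM (dominatedV (small_dominated tf sphi))).
Qed.

(** The cofactor in [F = A * f ^+ n]; it consists of logarithmic derivatives and small functions, so
    that m(r, A) is small. *)
Let A w := a w * (phi w)^-1 * \prod_(0 <= i < k.+1) D i w ^+ q i.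

Let A_small : prox_small A.
Proof.
apply: prox_smallM; first exact: prox_smallM (prox_small_small sa) (prox_small_smallV sphi).
apply: prox_small_prod => i; apply: prox_smallX; apply: prox_small_prod => j.
by apply: prox_small_logder; exact: dominated_derive_n.
Qed.

Let prod_exp_sum (x : R[i]^o) m : \prod_(0 <= i < m) x ^+ q i = x ^+ (\sum_(0 <= i < m) q i).
Proof.
elim: m => [|m IH]; first by rewrite !big_nil.
by rewrite !big_nat_recr//= IH exprD.
Qed.

Let FE w : (forall j, (j <= k)%N -> unit_at f^`(j)%classic w) -> F w = A w * f w ^+ n.
Proof.
move=> H; rewrite /F /M /diff_monomial.
have -> : \prod_(0 <= i < k.+1) f^`(i)%classic w ^+ q i =
    (\prod_(0 <= i < k.+1) D i w ^+ q i) * f w ^+ n.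
  rewrite -prod_exp_sum -big_split/= big_nat [RHS]big_nat; apply: eq_bigr => i /andP[_ ik].
  rewrite DE ?exprMn// => j ji; apply: H; exact: leq_trans ji ik.
by rewrite /A mulrAC mulrA.
Qed.

Let hF : nonzero_mero F := dF.1.

(** On good circles [(1/f)^n = A / F], and the proximity function of an n-th power is n times that
    of the base. *)
Let prox_f : evt (fun r => n%:R * proximity (fun w => (f w)^-1) r <=
  proximity A r + proximity (fun w => (F w)^-1) r).
Proof.
have G1 := evt_all k (fun i => evt_good (hd i)).
apply: evtS (evtI (evtI G1 (evt_basic hF)) (evtI A_small.1 (evt_good hf))).
move=> r [[gd [r1 gF]] [cA gf]]; have r0 : 0 <= r := le_trans ler01 r1.
have cV := good_oncirc_id r0 (good_inv gf).
have V0 w : cmod w = r -> (f w)^-1 != 0 by move=> /gf[_ h]; rewrite invr_eq0.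
rewrite -(proximityX n r0 cV V0).
apply: le_trans (proximityM r0 cA (good_oncirc_id r0 (good_inv gF))).
rewrite (@eq_proximity _ _ (fun w => A w * (F w)^-1) r r0)// => w wr.
have E := FE (fun j jk => gd j jk w wr); have [_ F0] := gF w wr; have [_ f0] := gf w wr.
have A0 : A w != 0 by apply: contraNneq F0 => A0; rewrite E A0 mul0r.
by rewrite E invfM mulrA mulfV// mul1r exprVn.
Qed.

Lemma ord_derive_ge z i : 0 <= ordf f z ->
  0 <= ordf f^`(i)%classic z /\ ordf f z - i%:Z <= ordf f^`(i)%classic z.
Proof.
move=> p0; elim: i => [|i [IH1 IH2]]; first by rewrite subr0.
have E : f^`(i.+1)%classic = (f^`(i)%classic)^`()%classic by rewrite derive1nS.
have o := nzm_ord z (hd i); have [eq0|n0] := eqVneq (ordf f^`(i)%classic z) 0; last first.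
  by rewrite E (ordfE (ord_derive n0 o)); lia.
have := regular_ord (regular_derive (ord_regular o IH1)) _ => /(_ (ordf f^`(i.+1)%classic z)).
have o' := nzm_ord z (hd i.+1); rewrite E in o' *.
by move=> /(_ o') H; split=> //; lia.
Qed.

Let mu := weight k q.

Let ord_F z : ordf F z = ordf a z + ordf (P k.+1) z - ordf phi z.
Proof.
by rewrite (ordfM z (nzmM ha (hP k.+1).1) (nzmV hphi)) (ordfM z ha (hP k.+1).1) ordfV.
Qed.

Let ord_P z : 0 <= ordf f z ->
  0 <= ordf (P k.+1) z /\ n%:Z * ordf f z - mu%:Z <= ordf (P k.+1) z.
Proof.
move=> p0; rewrite ordP; split.
  by apply: sumr_ge0 => i _; rewrite mulr_ge0// (ord_derive_ge i p0).1.
have -> : n%:Z * ordf f z - mu%:Z = \sum_(0 <= i < k.+1) (ordf f z - i%:Z) * (q i)%:Z.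
  (* The additional term [i = 0] has weight 0, so the two sums may be taken over the same range. *)
  have -> : mu = (\sum_(0 <= i < k.+1) i * q i)%N.
    by rewrite /mu /weight [RHS]big_ltn.
  rewrite /n !(big_morph Posz PoszD (erefl _)) mulr_suml -sumrB.
  by apply: eq_bigr => i _; rewrite PoszM mulrBl mulrC.
by apply: ler_sum => i _; rewrite ler_wpM2r// (ord_derive_ge i p0).2.
Qed.

Let indicator_le g z : (0 < pole_order g z)%N%:R <= pole_div g z.
Proof. by rewrite /pole_div ler_nat; case: (pole_order g z). Qed.

Let locfin_ind g : nonzero_mero g -> locfin (fun z => (0 < pole_order g z)%N%:R : R).
Proof.
move=> hg; apply: locfin_le (locfin_pole hg) _ => z /eqP.
by rewrite /pole_div pnatr_eq0 => /eqP ->.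
Qed.

Let reduced_le g r : 1 <= r -> nonzero_mero g ->
  Ndiv (fun z => (0 < pole_order g z)%N%:R) r <= Defs.counting g r.
Proof.
by move=> r1 hg; apply: Ndiv_le r1 (locfin_ind hg) (locfin_pole hg) (indicator_le g).
Qed.

Let small_Ndiv b r : 1 <= r -> nonzero_mero b -> good b r ->
  Ndiv (fun z => `|ord_div b z|) r <= bichar b r.
Proof.
move=> r1 hb gb; rewrite (bicharE (lt_le_trans ltr01 r1) hb gb) lerDr.
by have [] := bichar_ge0 r1 hb gb.
Qed.

Let N r := reduced_counting (fun z => 1 / (M z - phi z)) r.

Let zero_order z : pole_order (fun w => (f w)^-1) z = if 0 < ordf f z then `|ordf f z|%N else 0%N.
Proof. by rewrite (pole_orderE' z (nzmV hf)) (ordfV z hf) oppr_lt0 abszN. Qed.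

(** Since [F' = 0], the function [G] is useless, but [F] has order 0 everywhere: at a zero of [f],
    [n] times its order is at most [mu] plus the absolute orders of [a] and [phi]. As m(r, 1/F) is
    constant, no counting term for the target is needed. *)
Let main_const (c : R[i]^o) : meq F (cst c) -> exists U, usmall f U /\
  evt (fun r => (n%:R - mu%:R) * T r <= U r).
Proof.
move=> Fc; have [C HC] := first_main hf.
pose U r := proximity A r + (bichar a r + bichar phi r) +
  (logp (cmod c^-1) + n%:R * C - mu%:R * C).
exists U; split.
  exact: (usmallD (usmallD A_small.2 (usmallD (small_bichar tf sa) (small_bichar tf sphi)))
    (usmall_cst tf _)).
apply: evtS (evtI prox_f (evtI (evtI (evt_basic hF) (evt_good hf))
  (evtI (evt_good ha) (evt_good hphi)))) => r [H1 [[[r1 gF] gf] [ga gphi]]].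
have r0 : 0 < r := lt_le_trans ltr01 r1.
have TE := HC r r0 gf; have hV := nzmV hf.
have mF : proximity (fun w => (F w)^-1) r = logp (cmod c^-1).
  rewrite proximityE -(avg_cst (logp _) r); apply: eq_avg (ltW r0) _ => w wr.
  have [hFw _] := gF w wr.
  by rewrite (eq_at_dnear (holo_cont hFw) (holo_cont (holo_cst c w)) (Fc w)).
have lV := locfin_pole hV.
have lA : locfin (fun z => `|ord_div a z| + `|ord_div phi z|).
  exact: locfinD (locfin_abs_ord ha) (locfin_abs_ord hphi).
have lZ := locfinZ mu%:R (locfin_ind hV).
have K : n%:R * Defs.counting (fun w => (f w)^-1) r <=
    mu%:R * characteristic (fun w => (f w)^-1) r + (bichar a r + bichar phi r).
  rewrite countingE -(NdivZ n%:R r0 lV).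
  apply: le_trans (Ndiv_le r1 (locfinZ n%:R lV) (locfinD lZ lA) _) _; last first.
    rewrite (NdivD r0 lZ lA) (NdivD r0 (locfin_abs_ord ha) (locfin_abs_ord hphi)).
    rewrite (NdivZ mu%:R r0 (locfin_ind hV)); apply: lerD.
      rewrite ler_wpM2l//; apply: le_trans (reduced_le r1 hV) _.
      have [p0 _ _] := characteristic_ge0 r1 hV (good_inv gf).
      by rewrite /characteristic lerDr.
    by apply: lerD; exact: small_Ndiv.
  move=> z; rewrite /pole_div zero_order; have [p0|_] := ltP 0 (ordf f z); last first.
    by rewrite mulr0 ltnn mulr0 add0r addr_ge0.
  have c0 : c != 0.
    apply/eqP => c0; case: hF => _; apply => v; apply: dnearS (Fc v) => w _ ->.
    by rewrite /= c0.
  have e0 : ordf F z = 0.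
    apply: ordfE; apply: ord_eq (ord_cst z c0).
    by apply: dnearS (Fc z) => w _ ->.
  have [_ H] := ord_P (ltW p0); rewrite ord_F in e0.
  have : n%:Z * ordf f z <= mu%:Z + (`|ordf a z| + `|ordf phi z|) by lia.
  rewrite -(ler_int R) !rmorphD rmorphM /= !intr_norm -!pmulrn.
  have pn : (0 < `|ordf f z|%N)%N by rewrite absz_gt0 gt_eqF.
  by rewrite pn mulr1 natr_absz (gtr0_norm p0).
rewrite /U -mF TE; move: H1 K; rewrite /characteristic.
move: (proximity _ r) (Defs.counting _ r) (proximity A r) (proximity _ r).
by move=> p N' u v; lra.
Qed.

Let G z := logder (fun w => F w - 1) z.

Let main_noncst : ~ meq F^`()%classic (cst 0) -> exists U, usmall f U /\
  evt (fun r => (n%:R - mu%:R - 2) * T r <= N r + U r).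
Proof.
move=> nF'; pose H w := F w - 1.
have mF : meromorphic F := hF.1.
have mH : meromorphic H by move=> z; exact: meroB (mF z) (mero_cst 1 z).
have H'E z : \forall w \near z^', H^`()%classic w = F^`()%classic w.
  apply: dnearS (mero_dnear_holo (mF z)) => w _ hFw.
  by rewrite /H (derive1c (is_derive_subc (holo_is_derive hFw) (is_derive_cstc 1 w))) subr0.
have hH' : nonzero_mero H^`()%classic.
  split; first by move=> z; exact: mero_derive.
  by move=> H0; apply: nF' => z; apply: dnearS2 (H'E z) (H0 z) => w _ ->.
have hH : nonzero_mero H.
  split=> // H0; case: hH' => _; apply => z.
  have D0 : \forall w \near z^', exists d, @is_derive _ (R[i]^o) (R[i]^o) w 1 (cst (0 : R[i]^o)) d.
    apply: near_dnear; apply: nearA => w; exists 0; exact: (is_derive_cstc (0 : R[i]^o) w).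
  apply: dnearS (dnear_derive (H0 z) D0) => w _ ->.
  exact: (derive1c (is_derive_cstc 0 w)).
have hG : nonzero_mero G := nzmM hH' (nzmV hH).
have hF' : nonzero_mero F^`()%classic by split=> // z; exact: mero_derive.
have dH : dominated f H := dominated_sub1 tf dF hH.
have [C1 HC1] := first_main hf; have [C2 HC2] := jensen hG.
have uG := usmall_logder tf dH; have uF := usmall_logder tf dF.
pose U r := proximity A r + (bichar a r + bichar phi r) +
  (proximity (logder F) r + proximity G r) + (ln 2 - C2 + n%:R * C1 - (mu%:R + 1) * C1).
exists U; split.
  exact: (usmallD (usmallD (usmallD A_small.2
    (usmallD (small_bichar tf sa) (small_bichar tf sphi))) (usmallD uF uG)) (usmall_cst tf _)).
apply: evtS (evtI prox_f (evtI (evtI (evt_basic hF) (evt_good hf))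
  (evtI (evtI (evt_good ha) (evt_good hphi)) (evtI (evt_good hH) (evt_good hH')))))
  => r [H1 [[[r1 gF] gf] [[ga gphi] [gH gH']]]].
have r0 : 0 < r := lt_le_trans ltr01 r1.
have r0' : 0 <= r := ltW r0.
have gG : good G r := goodM gH' (good_inv gH).
have hV := nzmV hf.
have cGV := good_oncirc_id r0' (good_inv gG).
have clF := oncirc_logder r0' gF.
have mFV : proximity (fun w => (F w)^-1) r <=
    proximity (fun w => (G w)^-1) r + proximity (logder F) r + ln 2.
  pose B w := - ((G w)^-1 * logder F w).
  have cB : oncirc B r by apply: oncirc_cplxN; exact: oncirc_cplxM.
  have c1 : oncirc (fun _ : R[i]^o => 1 : R[i]^o) r by exact: oncirc_cst.
  have -> : proximity (fun w => (F w)^-1) r = proximity (fun w => 1 + B w) r.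
    apply: eq_proximity r0' _ => w wr; have [hFw F0] := gF w wr.
    have [_ H0] := gH w wr; have [_ H'0] := gH' w wr.
    have E : F^`()%classic w = H^`()%classic w.
      by rewrite /H (derive1c (is_derive_subc (holo_is_derive hFw) (is_derive_cstc 1 w))) subr0.
    rewrite /B /G /logder -/H E; have HE : H w = F w - 1 by [].
    have fld (K : fieldType) (x y h : K) : x != 0 -> y != 0 -> h != 0 -> h = x - 1 ->
        x^-1 = 1 - (y / h)^-1 * (y / x).
      by move=> x0 y0 h0 hx; rewrite invf_div hx; field; rewrite x0 y0.
    exact: (fld _ (F w : R[i]) (H^`()%classic w : R[i]) (H w : R[i]) F0 H'0 H0 HE).
  apply: le_trans (proximityD r0' c1 cB) _; rewrite proximity_cst1 add0r lerD2r.
  apply: le_trans (proximityM r0' cGV clF).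
  by rewrite !proximityE le_eqVlt; apply/orP; left; apply/eqP; apply: eq_avg r0' _ => w _;
    rewrite /B cmodN.
have mG := proximity_sub r0 gG; rewrite (HC2 r r0 gG) in mG.
have TE := HC1 r r0 gf.
have lV := locfin_pole hV; have lG := locfin_ord hG.
have lA := locfin_abs_ord ha; have lphi := locfin_abs_ord hphi.
have lz := locfin_ind hV; have lp := locfin_ind hf.
have hMp : nonzero_mero (fun w => H w * phi w) := nzmM hH hphi.
(* [M - phi = (F - 1) * phi] around every point, so the order of the target is read off from [F - 1]
   and [phi] even where the functions have wrong values. *)
have MpE z : \forall w \near z^', H w * phi w = M w - phi w.
  apply: dnearS (ord_good (nzm_ord z hphi)) => w _ [_ p0].
  by rewrite /H /F mulrBl mul1r divfK.
have hMV : nonzero_mero (fun w => 1 / (M w - phi w)).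
  have E z : \forall w \near z^', (H w * phi w)^-1 = 1 / (M w - phi w).
    by apply: dnearS (MpE z) => w _ ->; rewrite div1r.
  split; first by move=> z; apply: mero_eq (E z) ((nzmV hMp).1 z).
  move=> Z; case: (nzmV hMp) => _; apply => z.
  by apply: dnearS2 (E z) (Z z) => w _ -> ->.
have lt_ := locfin_ind hMV.
have target_order z : pole_order (fun w => 1 / (M w - phi w)) z =
    if 0 < ordf H z + ordf phi z then absz (ordf H z + ordf phi z) else 0%N.
  have o := ordV (ord_eq (MpE z) (nzm_ord z hMp)).
  rewrite (ordfM z hH hphi) in o; rewrite -[in RHS]oppr_lt0 -abszN -(pole_orderE o).
  by congr pole_order; apply/funext => w; rewrite div1r.
(* [order_count], summed over all points. The distinct zeros of [f] are then bounded by T(r, 1/f)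
   and the distinct poles by T(r, f). *)
have K : n%:R * Defs.counting (fun w => (f w)^-1) r - Ndiv (ord_div G) r <=
    (mu%:R + 1) * characteristic (fun w => (f w)^-1) r + T r + N r +
      (bichar a r + bichar phi r).
  have lL : locfin (fun z => n%:R * pole_div (fun w => (f w)^-1) z + (-1) * ord_div G z).
    by apply: locfinD; exact: locfinZ.
  have l1 := locfinZ (mu%:R + 1) lz; have l2 := locfinD l1 lp; have l3 := locfinD l2 lt_.
  have l4 := locfinD lA lphi; have lR := locfinD l3 l4.
  have -> : n%:R * Defs.counting (fun w => (f w)^-1) r - Ndiv (ord_div G) r =
      Ndiv (fun z => n%:R * pole_div (fun w => (f w)^-1) z + (-1) * ord_div G z) r.
    rewrite (NdivD r0 (locfinZ _ lV) (locfinZ _ lG)) (NdivZ _ r0 lV) (NdivZ _ r0 lG).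
    by rewrite mulN1r countingE.
  apply: le_trans (Ndiv_le r1 lL lR _) _; last first.
    rewrite (NdivD r0 l3 l4) (NdivD r0 l2 lt_) (NdivD r0 l1 lp) (NdivZ _ r0 lz) (NdivD r0 lA lphi).
    apply: lerD; last by apply: lerD; exact: small_Ndiv.
    rewrite lerD2r; apply: lerD.
      rewrite ler_wpM2l ?addr_ge0//; apply: le_trans (reduced_le r1 hV) _.
      by have [p0 _ _] := characteristic_ge0 r1 hV (good_inv gf); rewrite /characteristic lerDr.
    apply: le_trans (reduced_le r1 hf) _.
    by have [p0 _ _] := characteristic_ge0 r1 hf gf; rewrite /characteristic lerDr.
  move=> z; rewrite /pole_div zero_order target_order (pole_orderE' z hf).
  have [s1 s2 s3] := ord_sub1 (nzm_ord z hF).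
  have oG : ordf G z = ordf H^`()%classic z - ordf H z.
    by rewrite (ordfM z hH' (nzmV hH)) (ordfV z hH).
  have d1 : ordf H z != 0 -> ordf G z = -1.
    by move=> d0; rewrite oG (ordfE (ord_derive d0 (nzm_ord z hH))) addrAC subrr add0r.
  have d2 : ordf H z = 0 -> 0 <= ordf G z.
    move=> d0; rewrite oG d0 subr0; have o := nzm_ord z hH; rewrite d0 in o.
    exact: regular_ord (regular_derive (ord_regular o (lexx 0))) (nzm_ord z hH').
  have d3 : 0 < ordf F z -> ordf G z = ordf F z - 1.
    move=> e0; rewrite oG (ordfE (s2 e0)) subr0; apply: ordfE.
    have e0' : ordf F z != 0 by rewrite gt_eqF.
    apply: ord_eq (ord_derive e0' (nzm_ord z hF)).
    by apply: dnearS (H'E z) => w _ ->.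
  have d4 : ordf F z < 0 -> ordf H z = ordf F z by move=> /s1/ordfE.
  have d5 : 0 < ordf F z -> ordf H z = 0 by move=> /s2/ordfE.
  have d6 : 0 <= ordf F z -> 0 <= ordf H z by move=> /s3 /regular_ord; apply; exact: nzm_ord.
  have e := ord_F z; have ep := @ord_P z.
  have main := order_count d1 d2 d3 d4 d5 d6 e (fun x => (ep x).1) (fun x => (ep x).2).
  have ind (x : int) : (0 < (if (0 < x)%R then absz x else 0))%N = (0 < x).
    by case: ltP => // x0; rewrite absz_gt0 gt_eqF.
  have ind' (x : int) : (0 < (if (x < 0)%R then absz x else 0))%N = (x < 0).
    by case: ltP => // x0; rewrite absz_gt0 lt_eqF.
  have -> : n%:R * (if 0 < ordf f z then `|ordf f z|%N else 0%N)%:R =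
      (if 0 < ordf f z then n%:Z * ordf f z else 0)%:~R :> R.
    case: ltP => [x0|_]; last by rewrite mulr0.
    by rewrite natr_absz (gtr0_norm x0) rmorphM.
  rewrite !ind ind' mulN1r /ord_div; move: main; rewrite -(ler_int R).
  by rewrite !rmorphD rmorphN rmorphM /= rmorphD /= !intr_norm -!pmulrn.
(* Jensen's formula has replaced m(r, 1/G) by m(r, G) - N(ord G) - C2, and [TE] exchanges T(r, f)
   and T(r, 1/f) up to C1; what remains is linear arithmetic. *)
move: H1 mFV mG K; rewrite /U TE; rewrite /characteristic.
move: (proximity _ r) (Defs.counting _ r) (proximity A r) (proximity _ r).
move=> x1 x2 x3 x4; move: (proximity _ r) (proximity _ r) (proximity _ r) => x5 x6 x7.
by move: (Ndiv _ r) => x8; lra.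
Qed.

(** The zero function has to be included: if [F] is identically 1, then [M - phi] vanishes and, as
    [1 / 0 = 0], so does the function whose poles are counted. *)
Lemma reduced_counting_ge0 g r : meromorphic g -> 1 <= r -> 0 <= reduced_counting g r.
Proof.
move=> mg r1; have r0 : 0 < r := lt_le_trans ltr01 r1.
have [Z|nZ] := pselect (meq g (cst 0)); last first.
  have hg : nonzero_mero g by split.
  exact: Ndiv_ge0 r1 (locfin_ind hg) _.
have cs : carries [::] (fun z => (0 < pole_order g z)%N%:R : R) r.
  by split=> // z; rewrite (pole_order_zero (Z z)) eqxx.
by rewrite /reduced_counting -/(Ndiv (fun z => (0 < pole_order g z)%N%:R) r) (NdivE r0 cs) big_nil.
Qed.

(** The degree [n] is at least [q 0] and [T] is eventually non-negative, so the coefficient may be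
    lowered. When [F] is constant, the non-negative counting term is added for free. *)
Theorem monomial_bound : (3 + mu <= q 0)%N -> exists U, usmall f U /\
  evt (fun r => ((q 0%N)%:R - 2 - mu%:R) * T r <= N r + U r).
Proof.
move=> q0; have nq : (q 0 <= n)%N by rewrite /n big_nat_recl// leq_addr.
have nq' : (q 0%N)%:R <= n%:R :> R by rewrite ler_nat.
have mM : meromorphic (fun z => 1 / (M z - phi z)).
  move=> z; apply: meroM (mero_cst 1 z) _; apply: meroV; apply: meroB (hphi.1 z).
  exact: meroM (ha.1 z) ((hP k.+1).1.1 z).
have [F'0|nF'] := pselect (meq F^`()%classic (cst 0)).
  have [c Fc] := derive_zero hF.1 F'0; have [U [uU HU]] := main_const Fc.
  exists U; split=> //; apply: evtS (evtI HU (evtI (evtT0 tf) (evt_ge 1))) => r [H1 [T0 r1]].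
  have N0 : 0 <= N r := reduced_counting_ge0 mM r1.
  apply: le_trans (le_trans H1 _); last by rewrite lerDr.
  by rewrite ler_wpM2r//; move: nq'; lra.
have [U [uU HU]] := main_noncst nF'.
exists U; split=> //; apply: evtS (evtI HU (evtT0 tf)) => r [H1 T0].
by apply: le_trans H1; rewrite ler_wpM2r//; move: nq'; lra.
Qed.

End DifferentialMonomial.

(** Passing to the positive part turns a one-sided bound into one for the absolute value. *)
Lemma usmall_small_error (R : realType) (f : R[i]^o -> R[i]^o) (u : R -> R) :
  usmall f u -> small_error f (fun r => Num.max 0 (u r)).
Proof.
move=> [E [[E1 E2 E3] H]]; exists E; split=> // eps e0; have [r0 H0] := H eps e0.
exists r0; split; first exact: num_real.
move=> r rr nE; rewrite ger0_norm ?le_max ?lexx// ge_max mulr_ge0 ?(ltW e0)//=.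
by apply: le_trans (H0 r (ltW rr) nE) _; rewrite ler_wpM2l ?(ltW e0)// ler_norm.
Qed.

Theorem corollary2p1 (R : realType) (f phi a : R[i]^o -> R[i]^o)
    (k : nat) (q : nat -> nat)
    (hf : transcendental_meromorphic f)
    (hphi : small_function f phi)
    (hk : (1 <= k)%N) (hqk : (1 <= q k)%N)
    (hq0 : (3 + weight k q <= q 0)%N)
    (ha : small_function f a) :
  exists S : R -> R, small_error f S /\
    forall r : R, 0 < r ->
      characteristic f r <=
        1 / ((q 0%N)%:R - 2 - (weight k q)%:R) *
          reduced_counting (fun z => 1 / (diff_monomial a f k q z - phi z)) r
        + S r.
Proof.
have [U [uU [E [r0 [eE HE]]]]] := monomial_bound hf hphi ha hq0.
set c := (q 0%N)%:R - 2 - (weight k q)%:R in HE *.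
have c1 : 1 <= c.
  have : (3 + weight k q)%:R <= (q 0%N)%:R :> R by rewrite ler_nat.
  by rewrite natrD /c; lra.
have c0 : 0 < c := lt_le_trans ltr01 c1.
set N := reduced_counting _ in HE *.
(* The positive part of the excess over the main term: the inequality then holds at every radius by
   construction, and it remains to see that this error is small. *)
exists (fun r => Num.max 0 (characteristic f r - 1 / c * N r)); split; last first.
  by move=> r _; rewrite -lerBlDl le_max lexx orbT.
apply: usmall_small_error; have cV : 0 <= c^-1 by rewrite invr_ge0 ltW.
apply: usmall_le (usmallZ hf cV uU) _; exists E, r0; split=> // r rr nE.
have := HE r rr nE; rewrite div1r lerBlDl -mulrDr addrC -ler_pdivlMl//.
Qed.
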